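(* Let $\beta\in(0,\infty)$, $p\ge1$, and let $\xi=([0,L],(X_i)_{i\ge1},(P_i)_{i\ge1})$ be random with $0\le X_i\le L$, $P_1\ge P_2\ge\cdots\ge0$, $\mathbb E[L^p]<\infty$ and $\mathbb E[\sum_{j\ge1}P_j^{p\beta}]<1$. Let $\check{\mathcal T}$ be the random compact $\mathbb R$-tree recursively constructed from independent copies $\xi_{\mathbf i}$, $\mathbf i\in\mathbb U$, of $\xi$, i.e. the a.s. Gromov-Hausdorff limit of the trees $\check{\mathcal T}_n$ described in the context. Let $\varphi(q)=\mathbb E[\sum_{i\ge1}P_i^q]$ (sum over $i$ with $P_i>0$) and $q^*=\inf\{q>0:\varphi(q)<1\}$. Assume further that $\mathbb E[L^{-q/\beta}]<\infty$ for all $0<q<q^*$, and that $\mathbb P(X_i>0\text{ for all }i\ge1\text{ with }P_i>0)=1$. Then, a.s. on the event $\mathcal E^c$ of non-extinction, the set ${\rm Lf}(\check{\mathcal T})$ of leaves of $\check{\mathcal T}$ has Hausdorff dimension $\dim_{\rm H}({\rm Lf}(\check{\mathcal T}))=q^*/\beta$, and $\check{\mathcal T}$ itself has Hausdorff dimension $\dim_{\rm H}(\check{\mathcal T})=\max\{q^*/\beta,1\}$.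
   Context: $\mathbb U=\bigcup_{n\ge0}\mathbb N^n$, $\mathbb N^0=\{\varnothing\}$. $L$ takes values in $(0,\infty)$; the $X_i$ need not be distinct. Let $\xi_{\mathbf i}=([0,L_{\mathbf i}],(X_{\mathbf ij})_{j\ge1},(P_{\mathbf ij})_{j\ge1})$, $\mathbf i\in\mathbb U$, be i.i.d. copies of $\xi$. Put $\check P_\varnothing=1$ and $\check P_{\mathbf i}=P_{i_1}P_{i_1i_2}\cdots P_{i_1\ldots i_n}$ for $\mathbf i=i_1\ldots i_n\in\mathbb N^n$. $\check{\mathcal T}_0$ is the interval $[0,L_\varnothing]$, rooted at $0$; $\check{\mathcal T}_{n+1}$ is obtained from $\check{\mathcal T}_n$ by attaching, for each $\mathbf i\in\mathbb N^n$ and $j\ge1$, an interval of length $\check P_{\mathbf ij}^\beta L_{\mathbf ij}$, its left endpoint being identified with the point at distance $\check P_{\mathbf i}^\beta X_{\mathbf ij}$ from the left endpoint of the interval (of length $\check P_{\mathbf i}^\beta L_{\mathbf i}$) associated with $\mathbf i$ (path metric). These trees converge a.s. in the pointed Gromov-Hausdorff topology to a compact rooted $\mathbb R$-tree $\check{\mathcal T}$ (concretely, the completion of $\bigcup_n\check{\mathcal T}_n$). An $\mathbb R$-tree is a separable metric space in which any two points are joined by a unique injective path, isometric to an interval of length their distance. A leaf of a tree $T$ with root $\rho$ is a point $x\in T\setminus\{\rho\}$ with $T\setminus\{x\}$ connected; ${\rm Lf}(T)$ is the set of leaves. The extinction event is $\mathcal E=\{\inf\{n\ge1:\check P_{\mathbf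 i}=0\text{ for all }\mathbf i\in\mathbb N^n\}<\infty\}$; $\mathcal E^c$ is the event of non-extinction. *)

(* Defs.v *)
From HB Require Import structures.
From mathcomp Require Import all_boot all_order all_algebra.
From mathcomp Require Import generic_quotient.
From mathcomp Require Import all_classical all_reals all_analysis.
From mathcomp Require Import ring lra.

Set Implicit Arguments.
Unset Strict Implicit.
Unset Printing Implicit Defensive.

Import Order.TTheory GRing.Theory Num.Theory.
Import numFieldNormedType.Exports.

Local Open Scope classical_set_scope.
Local Open Scope ring_scope.
Local Open Scope quotient_scope.

Section hausdorff_dimension.
Context {R : realType} {T : metricType R}.
Local Open Scope ereal_scope.

(* The added 0 only matters for [diam set0 = 0]. *)
Definition diam (U : set T) : \bar R :=
  ereal_sup (0 |` [set (mdist z.1 z.2)%:E | z in U `*` U]).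

Definition hausdorff_premeasure (s delta : R) (A : set T) : \bar R :=
  ereal_inf [set \sum_(0 <= k <oo) poweR (diam (U k)) s |
    U in [set U : nat -> set T |
            A `<=` \bigcup_k U k /\ forall k, diam (U k) <= delta%:E]].

Definition hausdorff_measure (s : R) (A : set T) : \bar R :=
  ereal_sup [set hausdorff_premeasure s delta A |
              delta in [set delta : R | (0 < delta)%R]].

(* Restricting to s > 0 does not change the infimum and avoids 0 `^ 0. *)
Definition hausdorff_dim (A : set T) : \bar R :=
  ereal_inf [set s%:E | s in [set s : R | (0 < s)%R /\
                                          hausdorff_measure s A = 0]].

End hausdorff_dimension.

Definition leaves {T : topologicalType} (rho : T) : set T :=
  [set x | x <> rho /\ connected (~` [set x])].

Record pseudodist (R : realType) (S : Type) := Pseudodist {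
  pdist :> S -> S -> R ;
  pdistxx : forall x, pdist x x = 0 ;
  pdist_sym : forall x y, pdist x y = pdist y x ;
  pdist_triangle : forall y x z, pdist x z <= pdist x y + pdist y z }.

(* The metric completion of a pseudometric space: Cauchy sequences, modulo
   having limit distance 0. *)
Section completion.
Context {R : realType} {S : choiceType} (D : pseudodist R S).

Definition cauchy_seq (u : nat -> S) := forall e : R, 0 < e ->
  exists N : nat, forall m n : nat, (N <= m)%N -> (N <= n)%N ->
    D (u m) (u n) < e.

Definition cseq := {u : nat -> S | `[< cauchy_seq u >]}.

Definition cdist (u v : cseq) : R := limn (fun n => D (val u n) (val v n)).

Lemma pdist_ge0 x y : 0 <= D x y.
Proof.
have := pdist_triangle D y x x; rewrite pdistxx (pdist_sym D y x).
lra.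
Qed.

Lemma cseqP (u : cseq) : cauchy_seq (val u).
Proof. by case: u => u /= /asboolP. Qed.

Lemma cvg_cdist (u v : cseq) : D (val u n) (val v n) @[n --> \oo] --> cdist u v.
Proof.
apply/cauchy_cvgP/cauchyP => e e0.
have e2 : 0 < e / 2 by rewrite divr_gt0.
have [N1 H1] := cseqP u e2; have [N2 H2] := cseqP v e2.
pose N := maxn N1 N2.
exists (D (val u N) (val v N)).
exists N => //= n /= Nn.
have N1n : (N1 <= n)%N by rewrite (leq_trans _ Nn)// leq_maxl.
have N2n : (N2 <= n)%N by rewrite (leq_trans _ Nn)// leq_maxr.
have h1 := H1 N n (leq_maxl _ _) N1n.
have h2 := H2 N n (leq_maxr _ _) N2n.
have t1 := pdist_triangle D (val u N) (val u n) (val v n).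
have t2 := pdist_triangle D (val v N) (val u N) (val v n).
have t3 := pdist_triangle D (val u n) (val u N) (val v N).
have t4 := pdist_triangle D (val v n) (val u n) (val v N).
rewrite (pdist_sym D (val u n) (val u N)) in t1.
rewrite (pdist_sym D (val v n) (val v N)) in t4.
rewrite /ball/= ltr_norml; apply/andP; split; lra.
Qed.

Lemma cdistxx u : cdist u u = 0.
Proof.
rewrite /cdist; under eq_fun do rewrite pdistxx.
exact: lim_cst.
Qed.

Lemma cdist_sym u v : cdist u v = cdist v u.
Proof. by rewrite /cdist; under eq_fun do rewrite pdist_sym. Qed.

Lemma cdist_triangle v u w : cdist u w <= cdist u v + cdist v w.
Proof.
have h : D (val u n) (val v n) + D (val v n) (val w n) @[n --> \oo]
    --> cdist u v + cdist v w by apply: cvgD; exact: cvg_cdist.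
rewrite -(cvg_lim _ h)//; apply: ler_lim.
- by apply/cvg_ex; exists (cdist u w); exact: cvg_cdist.
- by apply/cvg_ex; eexists; exact: h.
- by near=> n; exact: pdist_triangle.
Unshelve. all: by end_near. Qed.

Lemma cdist_ge0 u v : 0 <= cdist u v.
Proof.
have := cdist_triangle v u u; rewrite cdistxx (cdist_sym v u).
lra.
Qed.

Definition ceq : rel cseq := fun u v => cdist u v == 0.

Lemma ceq_refl : reflexive ceq.
Proof. by move=> u; rewrite /ceq cdistxx. Qed.

Lemma ceq_sym : symmetric ceq.
Proof. by move=> u v; rewrite /ceq cdist_sym. Qed.

Lemma ceq_trans : transitive ceq.
Proof.
move=> v u w /eqP uv /eqP vw; rewrite /ceq eq_le cdist_ge0 andbT.
by rewrite (le_trans (cdist_triangle v u w))// uv vw addr0.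
Qed.

Canonical ceq_equiv := EquivRel ceq ceq_refl ceq_sym ceq_trans.

Definition completion := {eq_quot ceq}.
HB.instance Definition _ := Choice.on completion.
HB.instance Definition _ := Quotient.on completion.

Definition completion_dist (a b : completion) : R := cdist (repr a) (repr b).

Lemma cdist_pi u v : completion_dist (\pi_completion u) (\pi_completion v)
  = cdist u v.
Proof.
have h w : cdist (repr (\pi_completion w)) w = 0.
  by apply/eqP; have /eqmodP := reprK (\pi_completion w).
have h' w : cdist w (repr (\pi_completion w)) = 0 by rewrite cdist_sym.
rewrite /completion_dist; apply/eqP; rewrite eq_le; apply/andP; split.
- rewrite (le_trans (cdist_triangle u _ _))// h add0r.
  by rewrite (le_trans (cdist_triangle v _ _))// h' addr0.
- rewrite (le_trans (cdist_triangle (repr (\pi_completion u)) _ _))// h' add0r.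
  by rewrite (le_trans (cdist_triangle (repr (\pi_completion v)) _ _))// h addr0.
Qed.

Lemma completion_distxx a : completion_dist a a = 0.
Proof. exact: cdistxx. Qed.

Lemma completion_dist0_eq a b : completion_dist a b = 0 -> a = b.
Proof.
move=> ab; rewrite -[a]reprK -[b]reprK; apply/eqmodP.
by rewrite /= /ceq; apply/eqP.
Qed.

Lemma completion_dist_sym a b : completion_dist a b = completion_dist b a.
Proof. exact: cdist_sym. Qed.

Lemma completion_dist_triangle b a c :
  completion_dist a c <= completion_dist a b + completion_dist b c.
Proof. exact: cdist_triangle. Qed.

HB.instance Definition _ := isMetric.Build R completion completion_distxx
  completion_dist0_eq completion_dist_sym completion_dist_triangle.

Lemma cauchy_seq_cst x : `[< cauchy_seq (fun=> x) >].
Proof. by apply/asboolP => e e0; exists 0%N => m n _ _; rewrite pdistxx. Qed.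

Definition embed (x : S) : completion :=
  \pi_completion (exist _ (fun=> x) (cauchy_seq_cst x) : cseq).

Lemma mdist_embed x y : mdist (embed x) (embed y) = D x y.
Proof. rewrite [LHS]cdist_pi /cdist /=; exact: lim_cst. Qed.

Lemma embed_cvg (u : cseq) : embed (val u n) @[n --> \oo] --> \pi_completion u.
Proof.
apply/metricType_numDomainType.cvgrPdist_le => e e0.
have [N HN] := cseqP u e0; exists N => //= n /= Nn.
rewrite [leLHS]cdist_pi.
apply: limr_le; first by apply/cvg_ex; eexists; exact: cvg_cdist.
exists N => //= k /= Nk; apply: ltW; exact: HN.
Qed.

Lemma dense_embed : dense (range embed).
Proof.
move=> O [a Oa] oO; have : nbhs a O by exact: open_nbhs_nbhs.
rewrite -metricType_numDomainType.filter_from_mdist_nbhs => -[e e0 eO].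
have := @embed_cvg (repr a); rewrite reprK.
move=> /metricType_numDomainType.cvgrPdist_lt/(_ e e0)[N _ /(_ N (leqnn N))] h.
by exists (embed (val (repr a) N)); split; [exact: eO | exists (val (repr a) N)].
Qed.

Lemma completion_complete (a : nat -> completion) :
  (forall e : R, 0 < e -> exists N : nat, forall m n : nat,
      (N <= m)%N -> (N <= n)%N -> mdist (a m) (a n) < e) ->
  exists l : completion, a n @[n --> \oo] --> l.
Proof.
move=> ca.
have ap n : exists x, mdist (a n) (embed x) < n.+1%:R^-1.
  have := @embed_cvg (repr (a n)); rewrite reprK.
  move=> /metricType_numDomainType.cvgrPdist_lt/(_ n.+1%:R^-1).
  rewrite invr_gt0 ltr0n => /(_ isT)[N _ /(_ N (leqnn N))] h.
  by exists (val (repr (a n)) N).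
have [x ax] := choice ap.
have ax0 e : 0 < e ->
    exists N, forall n, (N <= n)%N -> mdist (a n) (embed (x n)) < e.
  move=> e0; exists (Num.truncn e^-1) => n /= Nn.
  rewrite (lt_trans (ax n))// -[ltRHS]invrK ltf_pV2 ?posrE ?invr_gt0//.
  by rewrite -truncn_lt_nat ?invr_ge0 ?(ltW e0).
have cx : `[< cauchy_seq x >].
  apply/asboolP => e e0; have e3 : 0 < e / 3 by rewrite divr_gt0.
  have [N1 H1] := ca _ e3; have [N2 H2] := ax0 _ e3.
  exists (maxn N1 N2) => m n; rewrite !geq_max => /andP[m1 m2] /andP[n1 n2].
  have h := H1 m n m1 n1; have hm := H2 m m2; have hn := H2 n n2.
  rewrite -mdist_embed.
  have t1 := metric_triangle (embed (x m)) (a m) (embed (x n)).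
  have t2 := metric_triangle (a m) (a n) (embed (x n)).
  rewrite (metric_sym (embed (x m)) (a m)) in t1.
  lra.
exists (\pi_completion (exist _ x cx : cseq)).
have := embed_cvg (u := exist _ x cx) => /= /metricType_numDomainType.cvgrPdist_lt xl.
apply/metricType_numDomainType.cvgrPdist_lt => e e0.
have e2 : 0 < e / 2 by rewrite divr_gt0.
have [N1 _ H1] := xl _ e2; have [N2 H2] := ax0 _ e2.
exists (maxn N1 N2) => //= n /=; rewrite geq_max => /andP[n1 n2].
have h1 := H1 n n1; have h2 := H2 n n2.
rewrite metric_sym in h2.
by rewrite (le_lt_trans (metric_triangle _ (embed (x n)) _))// (splitr e) ltrD.
Qed.

End completion.

(* Real sequences with the product sigma-algebra. *)
Definition rseq_cylinders (R : realType) : set (set (nat -> R)) :=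
  [set A | exists (n : nat) (B : set R),
             measurable B /\ A = (fun u => u n) @^-1` B].

Definition rseq (R : realType) := g_sigma_algebraType (@rseq_cylinders R).
HB.instance Definition _ (R : realType) := Measurable.on (rseq R).

(* The possible values of xi: a length, attachment points and scaling factors.
   The indices j >= 1 are shifted to j : nat. *)
Notation block R := (R * rseq R * rseq R)%type.
Definition len {R : realType} (b : block R) : R := b.1.1.
Definition att {R : realType} (b : block R) : nat -> R := b.1.2.
Definition wgt {R : realType} (b : block R) : nat -> R := b.2.

Section random_elements.
Context {R : realType} {d d' : measure_display} {T : measurableType d}
  {T' : measurableType d'} {P : probability T R}.
Local Open Scope ereal_scope.

Definition mutually_independent (I : eqType) (X : I -> {RV P >-> T'}) :=
  forall (s : seq I) (A : I -> set T'), uniq s -> (forall i, measurable (A i)) ->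
    P (\bigcap_(i in [set` s]) (X i @^-1` A i))
    = \prod_(i <- s) P (X i @^-1` A i).

Definition iid_copies (I : eqType) (d0 : measure_display)
    (T0 : measurableType d0) (P0 : probability T0 R)
    (X : I -> {RV P >-> T'}) (Y : {RV P0 >-> T'}) :=
  mutually_independent X /\
  forall i (A : set T'), measurable A ->
    distribution P (X i) A = distribution P0 Y A.

Definition phi (xi : {RV P >-> block R}) (q : R) : \bar R :=
  \int[P]_w \sum_(0 <= j <oo | (0 < wgt (xi w) j)%R)
    (powR (wgt (xi w) j) q)%:E.

Definition qstar (xi : {RV P >-> block R}) : R :=
  inf [set q : R | (0 < q)%R /\ phi xi q < 1].

End random_elements.

(* The tree built from a deterministic family of blocks. The word i_1...i_n is
   represented by the reversed list [:: i_n; ...; i_1], so that the j-th child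
   of i is j :: i. *)
Section tree.
Context {R : realType} (beta : R) (xi : seq nat -> block R).

Fixpoint cwgt (i : seq nat) : R :=
  if i is j :: i' then cwgt i' * wgt (xi i') j else 1.

Definition extinction_time : \bar R :=
  ereal_inf [set n%:R%:E | n in [set n : nat | (1 <= n)%N /\
                forall i : seq nat, size i = n -> cwgt i = 0]].

Definition interval_len (i : seq nat) : R := cwgt i `^ beta * len (xi i).

(* (i, x) is the point at distance x from the left endpoint of the interval
   associated with i; [foot i] is the point to which the left endpoint of this
   interval is glued when i is not the empty word. *)
Definition foot (i : seq nat) : seq nat * R :=
  if i is j :: i' then (i', cwgt i' `^ beta * att (xi i') j) else ([::], 0).

(* The path metric on the n-th tree (points (i, x) with size i <= n), before
   identification of the points at distance 0. The (n+1)-st tree is obtained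
   from the n-th one by gluing the intervals of the words of length n+1. *)
Fixpoint level_dist (n : nat) (u v : seq nat * R) : R :=
  if n is m.+1 then
    match size u.1 == n, size v.1 == n with
    | false, false => level_dist m u v
    | true, false => `|u.2| + level_dist m (foot u.1) v
    | false, true => level_dist m u (foot v.1) + `|v.2|
    | true, true => if u.1 == v.1 then `|u.2 - v.2|
                    else `|u.2| + level_dist m (foot u.1) (foot v.1) + `|v.2|
    end
  else `|u.2 - v.2|.

Definition tree_dist (u v : seq nat * R) : R :=
  level_dist (maxn (size u.1) (size v.1)) u v.

Lemma level_distxx n u : level_dist n u u = 0.
Proof.
elim: n => [|n IH] /=; first by rewrite subrr normr0.
by case: (size u.1 == n.+1) => //; rewrite eqxx subrr normr0.
Qed.

Lemma level_dist_sym n u v : level_dist n u v = level_dist n v u.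
Proof.
elim: n u v => [|n IH] u v /=; first by rewrite distrC.
case: (size u.1 == n.+1); case: (size v.1 == n.+1).
- by rewrite eq_sym distrC IH; case: ifP => // _; ring.
- by rewrite addrC IH.
- by rewrite addrC IH.
- exact: IH.
Qed.

Lemma level_dist_triangle n v u w :
  level_dist n u w <= level_dist n u v + level_dist n v w.
Proof.
elim: n v u w => [|n IH] v u w /=; first exact: ler_distD.
have ge0 a b : 0 <= level_dist n a b.
  have := IH b a a; rewrite level_distxx (level_dist_sym _ b a); lra.
have := ler_distD v.2 u.2 w.2.
have := normr_ge0 u.2; have := normr_ge0 v.2; have := normr_ge0 w.2.
have := ler_normB u.2 v.2; have := ler_normB v.2 w.2.
have := ler_normD (u.2 - v.2) v.2; have := ler_normD (w.2 - v.2) v.2.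
have := ler_normB u.2 w.2; rewrite !subrK (distrC w.2 v.2).
have := ler_normD (v.2 - u.2) u.2; have := ler_normD (v.2 - w.2) w.2.
rewrite !subrK (distrC v.2 u.2).
case: (size u.1 == n.+1); case: (size v.1 == n.+1); case: (size w.1 == n.+1).
- case: (u.1 =P v.1) => [uv|_]; case: (v.1 =P w.1) => [vw|_].
  + rewrite uv vw eqxx; lra.
  + by have := ge0 (foot v.1) (foot w.1); rewrite uv; case: eqP => _; lra.
  + by have := ge0 (foot u.1) (foot w.1); rewrite vw; case: eqP => _; lra.
  + have := IH (foot v.1) (foot u.1) (foot w.1).
    have := ge0 (foot u.1) (foot v.1); have := ge0 (foot v.1) (foot w.1).
    case: eqP => _; lra.
- case: (u.1 =P v.1) => [->|_]; first lra.
  have := IH (foot v.1) (foot u.1) w; lra.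
- have := IH v (foot u.1) (foot w.1); have := ge0 (foot u.1) v.
  have := ge0 v (foot w.1); case: eqP => _; lra.
- have := IH v (foot u.1) w; lra.
- case: (v.1 =P w.1) => [->|_]; first lra.
  have := IH (foot v.1) u (foot w.1); lra.
- have := IH (foot v.1) u w; lra.
- have := IH v u (foot w.1); lra.
- have := IH v u w; lra.
Qed.

Lemma level_distE n u v : (size u.1 <= n)%N -> (size v.1 <= n)%N ->
  level_dist n u v = tree_dist u v.
Proof.
move=> un vn.
have mn : (maxn (size u.1) (size v.1) <= n)%N by rewrite geq_max un.
rewrite /tree_dist -(subnKC mn).
elim: (_ - _)%N => [|k IH]; first by rewrite addn0.
by rewrite addnS /= !ltn_eqF ?ltnS -?{}IH// (leq_trans _ (leq_addr _ _))//
  ?leq_maxl ?leq_maxr.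
Qed.

Lemma tree_distxx u : tree_dist u u = 0.
Proof. exact: level_distxx. Qed.

Lemma tree_dist_sym u v : tree_dist u v = tree_dist v u.
Proof. by rewrite /tree_dist maxnC level_dist_sym. Qed.

Lemma tree_dist_triangle v u w :
  tree_dist u w <= tree_dist u v + tree_dist v w.
Proof.
pose n := (size u.1 + size v.1 + size w.1)%N.
have un : (size u.1 <= n)%N by rewrite /n -addnA leq_addr.
have vn : (size v.1 <= n)%N by rewrite /n addnAC leq_addl.
have wn : (size w.1 <= n)%N by rewrite /n leq_addl.
by rewrite -!(@level_distE n)// level_dist_triangle.
Qed.

(* The points of the union of all the finite-height trees. The truncation
   [Num.max 0] keeps the root in this type also on the null event where some
   length is not positive. *)
Definition tree_point : Type :=
  {u : seq nat * R | 0 <= u.2 <= Num.max 0 (interval_len u.1)}.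

Definition tree_point_dist (u v : tree_point) : R := tree_dist (val u) (val v).

Definition tree_pseudodist : pseudodist R tree_point :=
  @Pseudodist R tree_point tree_point_dist
    (fun u => tree_distxx (val u))
    (fun u v => tree_dist_sym (val u) (val v))
    (fun v u w => tree_dist_triangle (val v) (val u) (val w)).

Definition tree : metricType R := completion tree_pseudodist.

Lemma tree_point0_subproof :
  0 <= (0 : R) <= Num.max 0 (interval_len [::]).
Proof. by rewrite lexx le_max lexx. Qed.

Definition tree_root : tree :=
  embed tree_pseudodist (exist _ ([::], 0) tree_point0_subproof : tree_point).

End tree.

(* Main.v *)
(* Upper bound.  If phi(s beta) < 1, then for some y > 1 the sum over all words
   of (y^|w| times the length of the interval of w)^s has finite expectation.
   The points of the tree outside of all intervals lie in the closures of the
   subtrees above any generation n, whose diameters are bounded by tails of this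
   sum, so that they form a set of zero s-dimensional measure.  A leaf inside of
   some interval is one of its two endpoints, and there are countably many.

   Lower bound.  By convexity phi > 1 on (0, q* ).  For q in this range keep
   finitely many children with weights in [eps, 1/eps] and attachment points at
   distance at least eps from the left endpoint, and group m generations.  Then
   limits of distinct rays are leaves at a distance comparable to the scale of
   the branching, and a cover of the leaves by small sets with small sum of
   diam^(q/beta) gives a cut of the tree of words of small q-capacity.  The
   minimal cut up to depth n satisfies Z_n = min(1, sum_j c_j Z_(n-1)(j)), and a
   second moment estimate keeps its expectation away from 0 uniformly in n.
   Hence every individual has, given its past, a chance eta > 0 of having a
   subtree of positive minimal cut, and on non-extinction some individual
   succeeds: otherwise approximate the failure event by an event of the first n
   generations and consider the first individual alive in generation n.  *)

From HB Require Import structures.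
Require Import Defs.
From mathcomp Require Import all_boot all_order all_algebra.
From mathcomp Require Import all_classical all_reals all_analysis.
From mathcomp Require Import measurable_realfun ring lra.

Set Implicit Arguments.
Unset Strict Implicit.
Unset Printing Implicit Defensive.

Import Order.TTheory GRing.Theory Num.Theory.
Import numFieldNormedType.Exports.

Local Open Scope classical_set_scope.
Local Open Scope ring_scope.

(** * Hausdorff measure *)

(** Cuts replace a random measure on the leaves: a positive minimal cut refutes cheap covers, and no
    mass distribution has to be built. A path that leaves a subtree must run down the interval at
    its base, so gaps between rays are read off attachment heights; hence [truncw] bounds both the
    weight and [att] from below.

    Grouping m generations raises the truncated mean A > 1 to [A ^+ m] and makes the words that fail
    to contract by 1/2 negligible: on these the q-th power is at most a constant times the power
    [p * beta], whose total is [B ^+ m] with B < 1. A mean of at least 3 - 1 = 2 remains, and its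
    surplus over 1 pays for the second moment.

    A generation may be infinite, so before truncation there is no finite branching to rely on.
    Tails of the summable lengths stand in for it in the geometry, and in the probability the first
    living individual in the order of an enumeration of words.

    The geometry concerns a fixed family of blocks; probability supplies countably many almost sure
    facts about it. *)

Section hausdorff_lemmas.
Context {R : realType} {T : metricType R}.
Implicit Types (A B U : set T) (s t e : R).
Local Open Scope ereal_scope.

Lemma diam_ge0 U : 0 <= diam U.
Proof. by apply: ereal_sup_ubound; left. Qed.

Lemma diam_le U (r : \bar R) : 0 <= r ->
  (forall x y, U x -> U y -> (mdist x y)%:E <= r) -> diam U <= r.
Proof.
move=> r0 h; apply: ge_ereal_sup => _ [->//|[[x y] /= [Ux Uy] <-]]; exact: h.
Qed.

Lemma mdist_le_diam U x y : U x -> U y -> (mdist x y)%:E <= diam U.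
Proof. by move=> Ux Uy; apply: ereal_sup_ubound; right; exists (x, y). Qed.

(** Each term is at most the sum, so a small sum forces all diameters to be small; the supremum over
    [delta] may therefore be tested at [delta = 1] alone. *)
Lemma hausdorff_measure_eq0P s A : (0 < s)%R ->
  hausdorff_measure s A = 0 <->
  forall e, (0 < e)%R -> exists U : nat -> set T,
    [/\ A `<=` \bigcup_k U k, forall k, diam (U k) <= 1%:E &
        \sum_(0 <= k <oo) poweR (diam (U k)) s <= e%:E].
Proof.
move=> s0; split=> [h e e0|h].
  have : hausdorff_premeasure s 1 A < e%:E.
    apply: (@le_lt_trans _ _ 0); last by rewrite lte_fin.
    by rewrite -h; apply: ereal_sup_ubound; exists 1%R => //=.
  by move=> /ereal_inf_lt[_ [U [AU U1] <-] /ltW]; exists U.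
apply/eqP; rewrite eq_le; apply/andP; split; last first.
  apply: (@le_trans _ _ (hausdorff_premeasure s 1 A)); last first.
    by apply: ereal_sup_ubound; exists 1%R => //=.
  apply: le_ereal_inf_tmp => _ [U _ <-].
  by apply: nneseries_ge0 => k _ _; exact: poweR_ge0.
apply: ge_ereal_sup => _ [d /= d0 <-].
apply/lee_addgt0Pr => e e0; rewrite add0e.
(* The second bound makes every single diameter at most [d]. *)
pose e' := Num.min e (d `^ s)%R.
have e'0 : (0 < e')%R by rewrite lt_min e0 powR_gt0.
have [U [AU U1 Us]] := h _ e'0.
apply: (@le_trans _ _ e'%:E); last by rewrite lee_fin ge_min lexx.
apply: (le_trans _ Us); apply: ereal_inf_lbound; exists U => //; split => // k.
have : poweR (diam (U k)) s <= (d `^ s)%:E.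
  apply: (@le_trans _ _ e'%:E); last by rewrite lee_fin ge_min lexx orbT.
  apply: (le_trans _ Us); rewrite (@nneseriesD1 _ _ k)//.
    by rewrite leeDl// nneseries_ge0// => *; exact: poweR_ge0.
  by move=> *; exact: poweR_ge0.
have := diam_ge0 (U k); have := U1 k.
case: (diam (U k)) => [r|//|//]; rewrite poweR_EFin !lee_fin => _ r0.
rewrite leNgt => /negP rd; rewrite leNgt; apply/negP => dr; apply: rd.
by apply: gt0_ltr_powR => //; rewrite nnegrE// ltW.
Qed.

(** Once the sum is at most 1 no diameter exceeds 1, so covers may be given without any size
    restriction. *)
Lemma hausdorff_measure0_cover s A : (0 < s)%R ->
  (forall e, (0 < e)%R -> exists U : nat -> set T,
    A `<=` \bigcup_k U k /\ \sum_(0 <= k <oo) poweR (diam (U k)) s <= e%:E) ->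
  hausdorff_measure s A = 0.
Proof.
move=> s0 h; apply/hausdorff_measure_eq0P => // e e0.
have [|U [AU Us]] := h (Num.min e 1%R); first by rewrite lt_min e0 ltr01.
exists U; split => // [k|]; last first.
  by rewrite (le_trans Us)// lee_fin ge_min lexx.
have : poweR (diam (U k)) s <= 1.
  apply: (@le_trans _ _ (Num.min e 1%R)%:E); last by rewrite lee_fin ge_min lexx orbT.
  apply: (le_trans _ Us); rewrite (@nneseriesD1 _ _ k)//.
    by rewrite leeDl// nneseries_ge0// => *; exact: poweR_ge0.
  by move=> *; exact: poweR_ge0.
have := diam_ge0 (U k); case: (diam (U k)) => [r|_|//]; last first.
  by rewrite poweRyr ?gt_eqF.
rewrite poweR_EFin !lee_fin => r0; rewrite leNgt => /negP rd.
rewrite leNgt; apply/negP => dr; apply: rd.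
have -> : 1%R = (1 `^ s)%R :> R by rewrite powR1.
by apply: gt0_ltr_powR => //; rewrite nnegrE.
Qed.

Lemma hausdorff_measure0_le s t A : (0 < s)%R -> (s <= t)%R ->
  hausdorff_measure s A = 0 -> hausdorff_measure t A = 0.
Proof.
move=> s0 st /(hausdorff_measure_eq0P _ s0) h.
have t0 := lt_le_trans s0 st.
apply/(hausdorff_measure_eq0P _ t0) => e /h[U [AU U1 Us]].
exists U; split => //; apply: (le_trans _ Us); apply: lee_nneseries => k.
  by move=> *; exact: poweR_ge0.
have := diam_ge0 (U k); have := U1 k.
case: (diam (U k)) => [r|//|//]; rewrite !poweR_EFin !lee_fin => r1 r0 _.
have [->|rN0] := eqVneq r 0%R; first by rewrite !powR0 ?gt_eqF.
by apply: ger_powR => //; rewrite r1 lt_neqAle eq_sym rN0 r0.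
Qed.

Lemma hausdorff_measure0_sub s A B : (0 < s)%R -> A `<=` B ->
  hausdorff_measure s B = 0 -> hausdorff_measure s A = 0.
Proof.
move=> s0 AB /(hausdorff_measure_eq0P _ s0) h.
apply/(hausdorff_measure_eq0P _ s0) => e /h[U [BU U1 Us]].
by exists U; split => //; apply: subset_trans BU.
Qed.

Lemma hausdorff_measure0_bigcup s (A : nat -> set T) : (0 < s)%R ->
  (forall n, hausdorff_measure s (A n) = 0) ->
  hausdorff_measure s (\bigcup_n A n) = 0.
Proof.
move=> s0 A0; apply: hausdorff_measure0_cover => // e e0.
have h n : exists U : nat -> set T, A n `<=` \bigcup_k U k /\
    \sum_(0 <= k <oo) poweR (diam (U k)) s <= (e / (2 ^ n.+1)%:R)%:E.
  have [|U [AU _ Us]] := (hausdorff_measure_eq0P (A n) s0).1 (A0 n) (e / (2 ^ n.+1)%:R)%R.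
    by rewrite divr_gt0// ltr0n expn_gt0.
  by exists U.
have [U hU] := choice h.
have /card_esym/ppcard_eqP[f] := card_nat2.
exists (fun k => U (f k).1 (f k).2); split.
  move=> x [n _ Anx]; have [k _ Ux] := (hU n).1 _ Anx.
  exists ((f^-1)%FUN (n, k)) => //=.
  by rewrite (_ : f _ = (n, k))// invK ?inE.
have p0 n k : 0 <= poweR (diam (U n k)) s by exact: poweR_ge0.
rewrite nneseries_esumT//.
rewrite -(reindex_esum [set: nat] [set: nat * nat] f (fun z => poweR (diam (U z.1 z.2)) s)); last exact: bij.
rewrite -setXTT -(@esum_esum _ _ _ [set: nat] (fun=> [set: nat]) (fun i j => poweR (diam (U i j)) s))//.
apply: le_trans (epsilon_trick0 xpredT (ltW e0)).
rewrite [leRHS]nneseries_esumT; last first.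
  by move=> n; rewrite lee_fin divr_ge0// ltW.
apply: le_esum => n _; rewrite -nneseries_esumT//.
exact: (hU n).2.
Qed.

Lemma hausdorff_measure0U s A B : (0 < s)%R ->
  hausdorff_measure s A = 0 -> hausdorff_measure s B = 0 ->
  hausdorff_measure s (A `|` B) = 0.
Proof.
move=> s0 A0 B0.
apply: (@hausdorff_measure0_sub _ _ (\bigcup_n (if n is 0%N then A else B))) => //.
  by move=> x [Ax|Bx]; [exists 0%N|exists 1%N].
by apply: hausdorff_measure0_bigcup => // -[|n].
Qed.

Lemma hausdorff_measure0_countable s (x : nat -> T) : (0 < s)%R ->
  hausdorff_measure s (range x) = 0.
Proof.
move=> s0; apply: (@hausdorff_measure0_sub _ _ (\bigcup_n [set x n])) => //.
  by move=> _ [n _ <-]; exists n.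
apply: hausdorff_measure0_bigcup => // n.
apply: hausdorff_measure0_cover => // e e0; exists (fun=> [set x n]); split.
  by move=> y ->; exists 0%N.
have -> : diam [set x n] = 0.
  apply/eqP; rewrite eq_le diam_ge0 andbT diam_le// => y z -> ->.
  by rewrite mdistxx.
rewrite poweR0r ?gt_eqF// eseries0// lee_fin; exact: ltW.
Qed.

Lemma hausdorff_dim_le s A : (0 < s)%R -> hausdorff_measure s A = 0 ->
  hausdorff_dim A <= s%:E.
Proof. by move=> s0 h; apply: ereal_inf_lbound; exists s. Qed.

Lemma hausdorff_dim_ge (t : \bar R) A :
  (forall s, (0 < s)%R -> s%:E < t -> hausdorff_measure s A <> 0) ->
  t <= hausdorff_dim A.
Proof.
move=> h; apply: le_ereal_inf_tmp => _ [s [s0 As] <-].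
by rewrite leNgt; apply/negP => st; exact: (h s).
Qed.

Lemma hausdorff_dim_sub A B : A `<=` B -> hausdorff_dim A <= hausdorff_dim B.
Proof.
move=> AB; apply: le_ereal_inf => _ [s [s0 Bs] <-]; exists s => //; split => //.
exact: hausdorff_measure0_sub Bs.
Qed.

End hausdorff_lemmas.

(** * Distances and leaves in the tree *)

(** Words are stored reversed, so [suffix s w] means that [s] is [w] or an ancestor of it; this is
    the step from a word to its parent. *)
Lemma suffix_consE (T : eqType) (s w : seq T) (a : T) :
  suffix s (a :: w) = (s == a :: w) || suffix s w.
Proof.
apply/idP/orP => [/suffixP[[|b t]]|[/eqP ->|]].
- by rewrite cat0s => ->; left.
- by case=> _ ->; right; exact: suffix_suffix.
- exact: suffix_refl.
- by move=> /(suffix_catr [:: a]).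
Qed.

Lemma suffix_size_eq (T : eqType) (s t w : seq T) :
  suffix s w -> suffix t w -> size s = size t -> s = t.
Proof. by rewrite !suffixE => /eqP sw /eqP tw st; rewrite -sw -tw st. Qed.

Lemma connected_dense (T : topologicalType) (A B : set T) :
  connected A -> A `<=` B -> B `<=` closure A -> connected B.
Proof.
move=> cA AB BA U [z Uz] [C oC UC] [D cD UD].
have ACD : A `&` C = A `&` D.
  by rewrite -(setIidl AB) -setIA -UC UD setIA.
have : A `&` C = A.
  apply: cA; last by exists D.
    have [Bz Cz] : (B `&` C) z by rewrite -UC.
    by apply: (BA z Bz); exact: open_nbhs_nbhs.
  by exists C.
rewrite ACD => /setIidPl AD; rewrite UD; apply/setIidPl.
by apply: subset_trans BA _; rewrite (closure_id D).1//; exact: closureS.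
Qed.

Section four_point.
Context {R : realType} {T : metricType R}.

Hypothesis four_point : forall x y z w : T,
  mdist y z + mdist x w <= Num.max (mdist y w + mdist x z) (mdist x y + mdist z w).

(* The points z with positive Gromov product (a|z)_x form a clopen subset of
   the complement of x. *)
Lemma between_disconnected (x a b : T) : a <> x -> b <> x ->
  mdist a b = mdist a x + mdist x b -> ~ connected (~` [set x]).
Proof.
move=> ax bx abx con.
pose B : set T := [set z | mdist a z < mdist a x + mdist x z].
(* Together with [trans']: membership in [B] is constant on the ball about [z0] of radius
   [mdist z0 x], so away from [x] both [B] and its complement are open. *)
have trans z0 z : mdist z0 z < mdist z0 x -> B z0 -> B z.
  rewrite /B /= => h B0.
  have := mdist_ge0 x z; rewrite (metric_sym x z0) in B0.
  have := four_point x a z z0; rewrite le_max.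
  rewrite (metric_sym x a) (metric_sym z z0) (metric_sym x z0) => /orP[]; lra.
have trans' z0 z : mdist z0 z < mdist z0 x -> B z -> B z0.
  rewrite /B /= => h Bz.
  have := mdist_ge0 x z.
  have := four_point x a z0 z; rewrite le_max.
  rewrite (metric_sym x a) (metric_sym x z0) => /orP[]; lra.
have nx z0 z : mdist z0 z < mdist z0 x -> z <> x by move=> + zx; rewrite zx ltxx.
have nbx z0 (P : set T) : z0 <> x -> (forall z, mdist z0 z < mdist z0 x -> P z) ->
    nbhs z0 P.
  move=> z0x h; rewrite -metricType_numDomainType.filter_from_mdist_nbhs.
  by exists (mdist z0 x); [rewrite /= mdist_gt0; exact/eqP|exact: h].
have Bx z : B z -> z <> x.
  by move=> + zx; rewrite /B/= zx mdistxx addr0 ltxx.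
have oB : open B.
  rewrite openE => z Bz; apply: nbx (Bx _ Bz) _ => y zy; exact: trans Bz.
have : B = ~` [set x].
  apply: con.
  - by exists a; rewrite /B/= mdistxx (metric_sym x a) -mulr2n mulrn_wgt0// mdist_gt0; exact/eqP.
  - exists B => //; apply/seteqP; split=> [z Bz|z []//]; split => //; exact: Bx.
  - exists (~` (~` B `\` [set x])); last first.
      apply/seteqP; split=> [z Bz|z [/= zx]]; first by split; [exact: Bx|move=> []].
      by move=> h; apply: contrapT => Bz; apply: h.
    rewrite closedC openE => z [nBz zx]; apply: nbx zx _ => y zy.
    by split; [move=> By; apply: nBz; exact: trans' By|exact: nx zy].
move=> /seteqP[_ /(_ b bx)]; rewrite /B/= abx ltxx//.
Qed.

End four_point.

Section tree_distance.
Context {R : realType} (beta : R) (xi : seq nat -> block R).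
Local Notation ft := (foot beta xi).
Local Notation td := (tree_dist beta xi).
Local Notation ld := (level_dist beta xi).

Lemma size_foot w : size (ft w).1 = (size w).-1.
Proof. by case: w. Qed.

Lemma level_dist_ge0 n u v : 0 <= ld n u v.
Proof.
have := level_dist_triangle beta xi n v u u.
rewrite level_distxx (level_dist_sym _ _ n v u); lra.
Qed.

Lemma tree_dist_ge0 u v : 0 <= td u v.
Proof. exact: level_dist_ge0. Qed.

Lemma tree_dist_same w (s t : R) : td (w, s) (w, t) = `|s - t|.
Proof. by rewrite /tree_dist/= maxnn; case e: (size w) => [//|n] /=; rewrite e !eqxx. Qed.

Lemma tree_dist_lt u v : (size v.1 < size u.1)%N ->
  td u v = `|u.2| + td (ft u.1) v.
Proof.
move=> vu; have vu' := vu; case e: (size u.1) vu' => [//|n] vn.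
rewrite -(@level_distE _ _ _ n.+1 u v) ?e//; last exact: ltnW.
by rewrite /= e eqxx (ltn_eqF vn) level_distE// size_foot e.
Qed.

Lemma tree_dist_eq u v : size v.1 = size u.1 -> u.1 <> v.1 ->
  td u v = `|u.2| + td (ft u.1) (ft v.1) + `|v.2|.
Proof.
move=> vu /eqP uv; case e: (size u.1) vu => [|n] vu.
  by case/eqP: uv; rewrite (size0nil e) (size0nil vu).
rewrite -(@level_distE _ _ _ n.+1 u v) ?e ?vu//.
by rewrite /= e vu eqxx (negbTE uv) level_distE// size_foot ?e ?vu.
Qed.

(** The subtree at [w] touches the rest of the tree only at its left endpoint, so every path out of
    it passes [foot w]. Since [level_dist] takes off the deepest interval first, the words [v]
    longer than [w] are shortened by induction. *)
Lemma tree_dist_foot w (s : R) v : w <> [::] -> ~~ suffix w v.1 ->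
  td (w, s) v = `|s| + td (ft w) v.
Proof.
move=> w0; have [n] := ubnP (size v.1); elim: n v => // n IH [v t] /=.
rewrite ltnS => vn wv.
have [vw|wv'|/esym vw] := ltngtP (size v) (size w).
- exact: tree_dist_lt.
- rewrite tree_dist_sym tree_dist_lt//= tree_dist_sym IH ?size_foot//.
  + rewrite (tree_dist_sym _ _ (ft w) (v, t)) (@tree_dist_lt (v, t))/= ?size_foot//.
      by rewrite (tree_dist_sym _ _ (ft v)) addrCA.
    by rewrite (leq_ltn_trans _ wv')// leq_pred.
  + by rewrite (leq_trans _ vn)// prednK// (leq_ltn_trans _ wv').
  + by case: v {vn wv'} wv => //= a v; rewrite suffix_consE negb_or => /andP[].
- have nwv : w <> v by move=> e; rewrite e suffix_refl in wv.
  rewrite tree_dist_eq// -addrA; congr (_ + _).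
  rewrite (tree_dist_sym _ _ (ft w) (v, t)) (@tree_dist_lt (v, t))/= ?size_foot.
    by rewrite addrC tree_dist_sym.
  by rewrite -vw; case: (w) w0.
Qed.

Hypothesis att_ge0 : forall w j, 0 <= att (xi w) j.

Lemma foot_ge0 w : 0 <= (ft w).2.
Proof. by case: w => //= a w; rewrite mulr_ge0// powR_ge0. Qed.

(** Twice the Gromov product with the root as base point, that is, twice the length shared by the
    paths from the root to [u] and to [v]. *)
Let gromov n (u v : seq nat * R) := ld n u ([::], 0) + ld n v ([::], 0) - ld n u v.

Let gromov_sym n u v : gromov n u v = gromov n v u.
Proof. by rewrite /gromov (level_dist_sym _ _ n u v) (addrC (ld n u _)). Qed.

Let gromov_le n u v : gromov n u v <= gromov n u u.
Proof.
rewrite /gromov level_distxx.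
have := level_dist_triangle beta xi n u v ([::], 0).
rewrite (level_dist_sym _ _ n v u); lra.
Qed.

Let gromov_ultra n u v w : 0 <= u.2 -> 0 <= v.2 -> 0 <= w.2 ->
  gromov n u v <= gromov n u w \/ gromov n v w <= gromov n u w.
Proof.
elim: n u v w => [|n IH] u v w u0 v0 w0.
  rewrite /gromov /= !subr0 (ger0_norm u0) (ger0_norm v0) (ger0_norm w0).
  case: (lerP u.2 v.2) => uv; case: (lerP v.2 w.2) => vw; case: (lerP u.2 w.2) => uw;
    lra.
pose f (x : seq nat * R) := if size x.1 == n.+1 then ft x.1 else x.
pose same (x y : seq nat * R) := (size x.1 == n.+1) && (x.1 == y.1).
have f0 x : 0 <= x.2 -> 0 <= (f x).2.
  by rewrite /f; case: ifP => // _ _; exact: foot_ge0.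
(* Gluing a generation changes the product of two points only if they lie on the same new interval,
   where the common path grows by the smaller parameter; otherwise the product is that of the
   feet. *)
have gS x y : 0 <= x.2 -> 0 <= y.2 -> gromov n.+1 x y =
    gromov n (f x) (f y) + (if same x y then 2 * Num.min x.2 y.2 else 0).
  move=> x0 y0; rewrite /gromov /= /f /same.
  have [sx|sx] := eqVneq (size x.1) n.+1; have [sy|sy] := eqVneq (size y.1) n.+1 => /=.
  - have [xy|xy] := eqVneq x.1 y.1.
      rewrite xy level_distxx ger0_norm// ger0_norm//.
      by case: (lerP x.2 y.2) => ?; lra.
    by rewrite ger0_norm// ger0_norm//; lra.
  - have [xy|xy] := eqVneq x.1 y.1; first by rewrite -xy sx eqxx in sy.
    by rewrite ger0_norm//; lra.
  - by rewrite (ger0_norm y0); lra.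
  - by lra.
rewrite !gS//.
have feq x y : same x y -> f x = f y.
  by rewrite /same /f => /andP[/eqP sx /eqP <-]; rewrite sx eqxx.
have ming x y : 0 <= x -> 0 <= y -> 0 <= 2 * Num.min x y :> R.
  by move=> x0 y0; rewrite mulr_ge0// le_min x0.
have [uv|uv] := boolP (same u v); have [vw|vw] := boolP (same v w).
- have uw : same u w by move: uv vw; rewrite /same => /andP[-> /eqP ->] /andP[_ ->].
  rewrite uw (feq _ _ uv) (feq _ _ vw) !lerD2l.
  case: (lerP u.2 v.2) => ?; case: (lerP v.2 w.2) => ?; case: (lerP u.2 w.2) => ?; lra.
- by right; rewrite (feq _ _ uv) lerD2l; case: ifP => _ //; exact: ming.
- by left; rewrite (feq _ _ vw) lerD2l; case: ifP => _ //; exact: ming.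
- rewrite !addr0; have [uw|uw] := boolP (same u w).
    left; rewrite (feq _ _ uw).
    have := ming _ _ u0 w0.
    have := gromov_le n (f w) (f v); lra.
  by rewrite addr0; apply: IH; exact: f0.
Qed.

(** The ultrametric inequality at one base point already yields the four-point condition for all
    quadruples: four instances of it leave a linear problem. *)
Lemma tree_dist_four_point x y z w : 0 <= x.2 -> 0 <= y.2 -> 0 <= z.2 -> 0 <= w.2 ->
  td y z + td x w <= Num.max (td y w + td x z) (td x y + td z w).
Proof.
move=> x0 y0 z0 w0.
pose n := (size x.1 + size y.1 + size z.1 + size w.1)%N.
have xn : (size x.1 <= n)%N by rewrite /n -!addnA leq_addr.
have yn : (size y.1 <= n)%N by rewrite /n -!addnA addnCA leq_addr.
have zn : (size z.1 <= n)%N by rewrite /n addnAC leq_addl.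
have wn : (size w.1 <= n)%N by rewrite /n leq_addl.
rewrite -!(@level_distE _ _ _ n)//.
have := gromov_ultra n y0 w0 z0; have := gromov_ultra n y0 x0 z0.
have := gromov_ultra n x0 y0 w0; have := gromov_ultra n x0 z0 w0.
rewrite (gromov_sym n w z) (gromov_sym n y x) /gromov le_max => h1 h2 h3 h4.
apply/orP.
have [h5|h5] := lerP (ld n y z + ld n x w) (ld n y w + ld n x z); first by left.
right; move: h5.
case: h1 => h1; case: h2 => h2; case: h3 => h3; case: h4 => h4; lra.
Qed.

End tree_distance.

Section completion_lemmas.
Context {R : realType} {S : choiceType} (D : pseudodist R S).

Lemma embed_approx (a : completion D) (e : R) : 0 < e ->
  exists x, mdist a (embed D x) < e.
Proof.
move=> e0; have := @embed_cvg _ _ D (repr a); rewrite reprK.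
move=> /metricType_numDomainType.cvgrPdist_lt/(_ e e0)[N _ /(_ N (leqnn N))] h.
by exists (val (repr a) N).
Qed.

Lemma completion_four_point :
  (forall x y z w : S,
     D y z + D x w <= Num.max (D y w + D x z) (D x y + D z w)) ->
  forall x y z w : completion D,
     mdist y z + mdist x w <= Num.max (mdist y w + mdist x z) (mdist x y + mdist z w).
Proof.
move=> h x y z w; rewrite leNgt; apply/negP => lt.
set A := (X in X < _) in lt; set B := (X in _ < X) in lt.
(* Approximating the points within [e] moves a distance by less than [2 * e] and a sum of two by
   less than [4 * e]; a gap of [16 * e] survives this on both sides. *)
have e0 : 0 < (B - A) / 16%:R by rewrite divr_gt0// subr_gt0.
set e := (B - A) / 16%:R in e0.
have [x' xx] := embed_approx x e0; have [y' yy] := embed_approx y e0.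
have [z' zz] := embed_approx z e0; have [w' ww] := embed_approx w e0.
have ap (p q p' q' : completion D) : mdist p p' < e -> mdist q q' < e ->
    mdist p q < mdist p' q' + 2 * e /\ mdist p' q' < mdist p q + 2 * e.
  move=> pp qq.
  have := metric_triangle p p' q; have := metric_triangle p' q' q.
  have := metric_triangle p' p q'; have := metric_triangle p q q'.
  by rewrite (metric_sym p' p) (metric_sym q' q); lra.
have [a1 a2] := ap _ _ _ _ yy zz; have [b1 b2] := ap _ _ _ _ xx ww.
have [c1 c2] := ap _ _ _ _ yy ww; have [d1 d2] := ap _ _ _ _ xx zz.
have [f1 f2] := ap _ _ _ _ xx yy; have [g1 g2] := ap _ _ _ _ zz ww.
have := h x' y' z' w'; rewrite !mdist_embed in a1 a2 b1 b2 c1 c2 d1 d2 f1 f2 g1 g2.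
have eE : B = A + 16%:R * e by rewrite /e; field.
rewrite le_max => /orP[] hh; move: eE; rewrite /A /B; case: leP; lra.
Qed.

End completion_lemmas.

Section tree_points.
Context {R : realType} (beta : R) (xi : seq nat -> block R).
Local Notation ft := (foot beta xi).
Local Notation td := (tree_dist beta xi).
Local Notation len_ := (interval_len beta xi).
Local Notation tree_ := (tree beta xi).

Definition clamp (l t : R) : R := Num.max 0 (Num.min t (Num.max 0 l)).

Lemma clamp_subproof l t : 0 <= clamp l t <= Num.max 0 l.
Proof. by rewrite /clamp le_max lexx/= ge_max ge_min lexx orbT andbT le_max lexx. Qed.

Lemma clamp_id l t : 0 <= t <= l -> clamp l t = t.
Proof.
move=> /andP[t0 tl]; rewrite /clamp (max_idPr (le_trans t0 tl)).
by rewrite (min_idPl tl) (max_idPr t0).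
Qed.

Lemma clamp_lip l s t : `|clamp l s - clamp l t| <= `|s - t|.
Proof.
rewrite /clamp; set m := Num.max 0 l.
have m0 : 0 <= m by rewrite le_max lexx.
case: (leP s m) => sm; case: (leP t m) => tm; rewrite ?(max_idPr m0);
case: (leP 0 s) => ?; case: (leP 0 t) => ?; rewrite ler_norml;
case: (ler0P (s - t)) => ?; apply/andP; split; lra.
Qed.

(* The parameter is clamped to the interval so that [ipoint] is total. *)
Definition ipoint (w : seq nat) (t : R) : tree_ :=
  embed (tree_pseudodist beta xi)
    (exist _ (w, clamp (len_ w) t) (clamp_subproof (len_ w) t) : tree_point beta xi).

Lemma mdist_point w s v t : mdist (ipoint w s) (ipoint v t) =
  td (w, clamp (len_ w) s) (v, clamp (len_ v) t).
Proof. exact: mdist_embed. Qed.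

Lemma range_embedP (x : tree_) : range (embed (tree_pseudodist beta xi)) x ->
  exists w t, [/\ 0 <= t, t <= Num.max 0 (len_ w) & x = ipoint w t].
Proof.
move=> [[[w t] /= wt] _ <-]; have /andP[t0 tl] := wt; exists w, t; split => //.
rewrite /ipoint; congr embed; apply: val_inj => /=; congr pair.
by rewrite /clamp (min_idPl tl) (max_idPr t0).
Qed.

Lemma point_range w t : range (embed (tree_pseudodist beta xi)) (ipoint w t).
Proof. by eexists. Qed.

Lemma tree_root_point : tree_root beta xi = ipoint [::] 0.
Proof.
rewrite /tree_root /ipoint; congr embed; apply: val_inj => /=; congr pair.
by rewrite /clamp (min_idPl _) ?maxxx// le_max lexx.
Qed.

Lemma mdist_point_same w s t : mdist (ipoint w s) (ipoint w t) =
  `|clamp (len_ w) s - clamp (len_ w) t|.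
Proof. by rewrite mdist_point tree_dist_same. Qed.

Lemma continuous_point w : continuous (ipoint w).
Proof.
move=> t; apply/metricType_numDomainType.cvgrPdist_le => e e0.
apply/nbhs_ballP; exists e => //= s ts.
by rewrite mdist_point_same (le_trans (clamp_lip _ _ _))// ltW.
Qed.

Hypothesis len_gt0 : forall w, 0 < len (xi w).
Hypothesis att_itv : forall w j, 0 <= att (xi w) j <= len (xi w).

Lemma interval_len_ge0 w : 0 <= len_ w.
Proof. by rewrite mulr_ge0// ?powR_ge0// ltW. Qed.

Lemma foot_itv a w : 0 <= (ft (a :: w)).2 <= len_ w.
Proof.
have /andP[h1 h2] := att_itv w a.
by rewrite mulr_ge0 ?powR_ge0//= ler_wpM2l ?powR_ge0.
Qed.

Lemma clamp_itv w t : 0 <= clamp (len_ w) t <= len_ w.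
Proof. by have := clamp_subproof (len_ w) t; rewrite (max_idPr (interval_len_ge0 w)). Qed.

Lemma point_glue a w : ipoint (a :: w) 0 = ipoint w (ft (a :: w)).2.
Proof.
apply: mdist_positivity; rewrite mdist_point clamp_id ?lexx ?interval_len_ge0//.
rewrite clamp_id ?foot_itv//.
rewrite tree_dist_foot//=; last first.
  by apply/negP => /size_suffix/=; rewrite ltnn.
by rewrite normr0 add0r tree_distxx.
Qed.

Lemma att_ge0' w j : 0 <= att (xi w) j.
Proof. by have /andP[] := att_itv w j. Qed.

Lemma tree_four_point (x y z w : tree_) :
  mdist y z + mdist x w <= Num.max (mdist y w + mdist x z) (mdist x y + mdist z w).
Proof.
apply: completion_four_point => {x y z w} -[x hx] [y hy] [z hz] [w hw].
rewrite /= /tree_point_dist /=.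
have /andP[? _] := hx; have /andP[? _] := hy; have /andP[? _] := hz.
have /andP[? _] := hw.
by apply: tree_dist_four_point => //; exact: att_ge0'.
Qed.

Definition chain (w : seq nat) : set tree_ := \bigcup_(v in [set v | suffix v w]) range (ipoint v).

Lemma connected_chain w : connected (chain w).
Proof.
have cE v : connected (range (ipoint v)).
  apply: connected_continuous_connected.
    by apply/connected_intervalP => x y _ _ z _.
  by apply: continuous_subspaceT; exact: continuous_point.
elim: w => [|a w IH].
  rewrite (_ : chain _ = range (ipoint [::]))//; apply/seteqP; split=> x.
    by case=> v /=; rewrite suffixs0 => /eqP ->.
  by move=> h; exists [::] => //=; exact: suffix_refl.
rewrite (_ : chain _ = range (ipoint (a :: w)) `|` chain w); last first.
  apply/seteqP; split=> x.
    by case=> v /=; rewrite suffix_consE => /orP[/eqP ->|vw] h; [left|right; exists v].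
  case=> [h|[v /= vw h]]; first by exists (a :: w) => //=; exact: suffix_refl.
  by exists v => //=; rewrite suffix_consE vw orbT.
apply: connectedU => //; exists (ipoint (a :: w) 0); split; first by exists 0.
by exists w => /=; [exact: suffix_refl|exists (ft (a :: w)).2 => //; rewrite point_glue].
Qed.

Lemma connected_range_embed : connected (range (embed (tree_pseudodist beta xi))).
Proof.
rewrite (_ : range _ = \bigcup_(w in setT) chain w).
  apply: bigcup_connected => [|w _]; last exact: connected_chain.
  by exists (ipoint [::] 0) => w _; exists [::]; [exact: suffix0s|exists 0].
apply/seteqP; split=> [x /range_embedP[w [t [_ _ ->]]]|x [w _ [v _ [t _ <-]]]].
  by exists w => //; exists w => /=; [exact: suffix_refl|exists t].
exact: point_range.
Qed.

(** The union of the intervals is connected, dense and avoids [x], so the complement of [x] lies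
    between a connected set and its closure. *)
Lemma limit_point_leaf (x : tree_) :
  ~ range (embed (tree_pseudodist beta xi)) x -> leaves (tree_root beta xi) x.
Proof.
move=> nx; split; first by move=> e; apply: nx; rewrite e tree_root_point; exact: point_range.
apply: (connected_dense connected_range_embed) => [y ry /= yx|y _].
  by apply: nx; rewrite -yx.
rewrite closureEnbhs /= => A B; rewrite /globally => /= rA yB.
have [z [Bz [u _ uz]]] := @dense_embed _ _ (tree_pseudodist beta xi) (interior B)
  (ex_intro _ y yB) (open_interior B).
exists z; split; last exact: interior_subset.
by apply: rA; exists u.
Qed.

(** A point strictly inside an interval lies between the two endpoints and separates them. Which
    endpoint occurs does not matter later, as only countability is used. *)
Lemma leaf_endpoint (x : tree_) : leaves (tree_root beta xi) x ->
  range (embed (tree_pseudodist beta xi)) x ->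
  exists w, x = ipoint w 0 \/ x = ipoint w (len_ w).
Proof.
move=> [_ cx] /range_embedP[w [t [t0]]].
rewrite (max_idPr (interval_len_ge0 w)) => tl xE.
exists w; have [t0'|tN0] := eqVneq t 0; first by left; rewrite xE t0'.
have [tl'|tNl] := eqVneq t (len_ w); first by right; rewrite xE tl'.
have {}t0 : 0 < t by rewrite lt_neqAle eq_sym tN0.
have {}tl : t < len_ w by rewrite lt_neqAle tNl.
have c0 : clamp (len_ w) 0 = 0 by rewrite clamp_id// lexx interval_len_ge0.
have cl : clamp (len_ w) (len_ w) = len_ w by rewrite clamp_id// lexx interval_len_ge0.
have ct : clamp (len_ w) t = t by rewrite clamp_id// !ltW.
exfalso; apply: (between_disconnected tree_four_point _ _ _ cx (a := ipoint w 0)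
  (b := ipoint w (len_ w))).
- move=> e; have := mdistxx x; rewrite -{1}e xE mdist_point_same c0 ct sub0r normrN.
  by rewrite gtr0_norm//; lra.
- move=> e; have := mdistxx x; rewrite -{1}e xE mdist_point_same cl ct.
  by rewrite gtr0_norm//; lra.
- rewrite xE !mdist_point_same c0 cl ct !sub0r !normrN gtr0_norm//; last exact: lt_trans tl.
  by rewrite gtr0_norm// ler0_norm//; lra.
Qed.

(** The path from [w] comes down to the point where [b :: i] is attached and must then run along the
    interval of [i] to its left endpoint, the only way out of the subtree at [i]. *)
Lemma tree_dist_ge i b w v (s t : R) : i <> [::] -> suffix (b :: i) w -> ~~ suffix i v ->
  (ft (b :: i)).2 <= td (w, s) (v, t).
Proof.
move=> i0; elim: w s => [|c w IH] s; first by rewrite suffixs0.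
rewrite suffix_consE => bw iv.
have nwv : ~~ suffix (c :: w) v.
  apply: contra iv; apply: suffix_trans.
  case/orP: bw => [/eqP <-|bw]; first exact: suffix_cons.
  by apply: suffix_trans (suffix_cons _ _); apply: suffix_trans bw; exact: suffix_cons.
rewrite tree_dist_foot//.
case/orP: bw => [/eqP e|bw]; last first.
  by rewrite -[leLHS]add0r lerD// ?normr_ge0//=; apply: IH.
rewrite -e -[leLHS]add0r lerD// ?normr_ge0// [ft (b :: i)]/= tree_dist_foot//.
by rewrite -[leLHS]addr0 lerD ?tree_dist_ge0// ler_norm.
Qed.

Lemma geo_sum_le (x : R) k n : 0 <= x -> x < 1 ->
  \sum_(k <= l < n) x ^+ l <= x ^+ k * (1 - x)^-1.
Proof.
move=> x0 x1; rewrite ler_pdivlMr ?subr_gt0//.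
have [nk|kn] := leqP n k; first by rewrite big_geq// mul0r exprn_ge0.
rewrite -(subnKC (ltnW kn)); elim: (n - k)%N => [|l IH].
  by rewrite addn0 big_geq// mul0r exprn_ge0.
rewrite addnS.
have -> : (\sum_(k <= i < (k + l).+1) x ^+ i) * (1 - x) = x ^+ k - x ^+ (k + l).+1.
  elim: {IH}l => [|l IH].
    by rewrite addn0 big_nat1 exprSr; ring.
  by rewrite addnS big_nat_recr ?leqW ?leq_addr//= mulrDl IH !exprSr; ring.
by rewrite gerBl exprn_ge0.
Qed.

(** Going down from [w] to [i] uses at most one whole interval per generation, and the lengths decay
    geometrically. *)
Lemma tree_dist_le i w (s K x : R) : suffix i w -> `|s| <= len_ w ->
  0 <= K -> 0 <= x -> x < 1 -> (forall v, suffix i v -> len_ v <= K * x ^+ size v) ->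
  td (w, s) (i, 0) <= K * x ^+ size i * (1 - x)^-1.
Proof.
move=> iw sw K0 x0 x1 h.
apply: (@le_trans _ _ (K * \sum_(size i <= l < (size w).+1) x ^+ l)); last first.
  by rewrite -mulrA ler_wpM2l// geo_sum_le.
elim: w s iw sw => [|a w IH] s iw sw.
  have hw := h _ iw; move: iw; rewrite suffixs0 => /eqP ->.
  by rewrite tree_dist_same subr0 big_nat1 (le_trans sw).
have hw := le_trans sw (h _ iw).
have si : (size i <= (size w).+1)%N := size_suffix iw.
rewrite big_nat_recr//= mulrDr.
move: iw; rewrite suffix_consE => /orP[/eqP ->|iw].
  by rewrite tree_dist_same subr0 big_geq// mulr0 add0r.
rewrite tree_dist_foot//=; last first.
  apply/negP => /size_suffix/=; have /= := size_suffix iw => h1 h2.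
  by have := leq_trans h2 h1; rewrite ltnn.
rewrite addrC lerD//; apply: IH => //.
by have /andP[f0 f1] := foot_itv a w; rewrite ger0_norm.
Qed.

End tree_points.

(** * Covers of the tree *)

Lemma nneseries_small_tail (R : realType) (f : nat -> \bar R) (e : R) :
  (forall k, 0 <= f k)%E -> (\sum_(0 <= k <oo) f k < +oo)%E -> 0 < e ->
  exists N : nat, (\sum_(N <= k <oo) f k < e%:E)%E.
Proof.
move=> f0 foo e0.
have /fine_cvgP[[N1 _ h1] /cvgrPdist_lt/(_ e e0)[N2 _ h2]] :=
  @nneseries_tail_cvg R f xpredT foo (fun k _ => f0 k).
pose N := maxn N1 N2; exists N.
have := h2 N (leq_maxr _ _); rewrite /= sub0r normrN => h.
rewrite -(fineK (h1 N (leq_maxl _ _))) lte_fin.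
exact: le_lt_trans (ler_norm _) h.
Qed.

Lemma nneseries_cond_le_tail (R : realType) (f : nat -> \bar R) (P : pred nat) N :
  (forall k, 0 <= f k)%E -> (forall k, (k < N)%N -> ~~ P k) ->
  (\sum_(0 <= k <oo | P k) f k <= \sum_(N <= k <oo) f k)%E.
Proof.
move=> f0 NP.
rewrite (@nneseries_split_cond _ _ 0%N N)// add0n.
rewrite big_nat_cond big1 ?add0e; last first.
  by move=> k /andP[/andP[_ kN] Pk]; have := NP k kN; rewrite Pk.
by apply: subset_lee_nneseries.
Qed.

Lemma le_sumn (a : nat) (v : seq nat) : a \in v -> (a <= sumn v)%N.
Proof.
elim: v => // b v IH; rewrite inE => /orP[/eqP ->|/IH h] /=; first exact: leq_addr.
exact: leq_trans h (leq_addl _ _).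
Qed.

Section upper_bound.
Context {R : realType} (beta : R) (xi : seq nat -> block R).
Hypothesis len_gt0 : forall w, 0 < len (xi w).
Hypothesis att_itv : forall w j, 0 <= att (xi w) j <= len (xi w).
Local Notation len_ := (interval_len beta xi).
Local Notation ipoint := (ipoint beta xi).
Local Notation word := CodeSeq.decode.

Variables (y s : R).
Hypotheses (y_gt1 : 1 < y) (s_gt0 : 0 < s).

(** For [s > 1] a finite sum of s-th powers bounds each length but not their sum along a branch; the
    factor with [y > 1] supplies a geometric decay that does. *)
Definition weighted_len (w : seq nat) : R := (len_ w * y ^+ size w) `^ s.

Hypothesis summable_len : (\sum_(0 <= k <oo) (weighted_len (word k))%:E < +oo)%E.

Definition subtree_mass (i : seq nat) : \bar R :=
  (\sum_(0 <= k <oo | suffix i (word k)) (weighted_len (word k))%:E)%E.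

(** A single term of the mass bounds a single length by [mass^(1/s) * y^(-size v)]; the second
    factor is the geometric series over a branch. *)
Definition subtree_radius (i : seq nat) : R :=
  fine (subtree_mass i) `^ s^-1 * (1 - y^-1)^-1.

Definition subtree_ball (i : seq nat) : set (tree beta xi) :=
  [set x | mdist x (ipoint i 0) <= subtree_radius i].

Definition subtree (i : seq nat) : set (tree beta xi) :=
  \bigcup_(w in [set w | suffix i w]) range (ipoint w).

Let y_gt0 : 0 < y. Proof. exact: lt_trans y_gt1. Qed.
Let yV_ge0 : 0 <= y^-1. Proof. by rewrite invr_ge0 ltW. Qed.
Let yV_lt1 : y^-1 < 1. Proof. by rewrite invf_lt1. Qed.
Let K_gt0 : 0 < (1 - y^-1)^-1. Proof. by rewrite invr_gt0 subr_gt0. Qed.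
Let wl_ge0 w : (0 <= (weighted_len w)%:E)%E. Proof. by rewrite lee_fin powR_ge0. Qed.
Let len_ge0 := interval_len_ge0 beta len_gt0.

Lemma subtree_mass_ge0 i : (0 <= subtree_mass i)%E.
Proof. by apply: nneseries_ge0 => k _ _. Qed.

Lemma subtree_mass_fin i : subtree_mass i \is a fin_num.
Proof.
rewrite ge0_fin_numE ?subtree_mass_ge0//; apply: le_lt_trans summable_len.
by apply: subset_lee_nneseries.
Qed.

Lemma interval_len_le i v : suffix i v ->
  len_ v <= fine (subtree_mass i) `^ s^-1 * y^-1 ^+ size v.
Proof.
move=> iv; have : ((weighted_len v)%:E <= subtree_mass i)%E.
  rewrite /subtree_mass (@nneseriesD1 _ _ (CodeSeq.code v)) ?CodeSeq.codeK//.
  by rewrite leeDl// nneseries_ge0.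
rewrite -[X in (_ <= X)%E](fineK (subtree_mass_fin i)) lee_fin /weighted_len => h.
have b0 : 0 <= len_ v * y ^+ size v by rewrite mulr_ge0// exprn_ge0// ltW.
rewrite exprVn ler_pdivlMr ?exprn_gt0//.
rewrite -[leLHS]powRr1// -(@divff _ s) ?gt_eqF// powRrM.
apply: ge0_ler_powR => //; rewrite ?invr_ge0 ?nnegrE ?powR_ge0//; first exact: ltW.
by rewrite fine_ge0// subtree_mass_ge0.
Qed.

Lemma subtree_radius_ge0 i : 0 <= subtree_radius i.
Proof. by rewrite mulr_ge0 ?powR_ge0// ltW. Qed.

Lemma mdist_subtree i w t : suffix i w ->
  mdist (ipoint w t) (ipoint i 0) <= subtree_radius i.
Proof.
move=> iw; rewrite mdist_point (clamp_id (t := 0)) ?lexx ?len_ge0//.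
apply: le_trans (tree_dist_le att_itv iw _ (powR_ge0 _ _) yV_ge0 yV_lt1 (fun v iv => interval_len_le iv)) _.
- by have /andP[c0 cl] := clamp_itv beta len_gt0 w t; rewrite ger0_norm.
- by rewrite ler_wpM2r ?(ltW K_gt0)// ler_piMr ?powR_ge0// exprn_ile1// ltW.
Qed.

Lemma closure_subtree i : closure (subtree i) `<=` subtree_ball i.
Proof.
move=> x cx; rewrite /subtree_ball/=; apply/ler_addgt0Pr => e e0.
have := cx (ball x e) (nbhsx_ballx _ _ e0).
move=> [z [[w /= iw [t _ <-]]]]; rewrite ballEmdist/= => xz.
have := mdist_subtree t iw; have := metric_triangle x (ipoint w t) (ipoint i 0); lra.
Qed.

Lemma diam_subtree_ball i : (poweR (diam (subtree_ball i)) s <=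
  ((2 * (1 - y^-1)^-1) `^ s)%:E * subtree_mass i)%E.
Proof.
have d : (diam (subtree_ball i) <= (2 * subtree_radius i)%:E)%E.
  apply: diam_le; first by rewrite lee_fin mulr_ge0// subtree_radius_ge0.
  move=> a b; rewrite /subtree_ball/= lee_fin => ha hb.
  have := metric_triangle a (ipoint i 0) b; rewrite (metric_sym (ipoint i 0) b); lra.
have f0 : 0 <= fine (subtree_mass i) by rewrite fine_ge0// subtree_mass_ge0.
have -> : (((2 * (1 - y^-1)^-1) `^ s)%:E * subtree_mass i =
    ((2 * subtree_radius i) `^ s)%:E)%E.
  rewrite -[X in (_ * X)%E](fineK (subtree_mass_fin i)) -EFinM /subtree_radius.
  rewrite mulrCA [in RHS]powRM ?powR_ge0//; last by rewrite mulr_ge0// ltW.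
  by rewrite -powRrM mulVf ?gt_eqF// powRr1// mulrC.
rewrite -poweR_EFin; apply: gt0_ler_poweR => //; first exact: ltW.
- by rewrite in_itv/= diam_ge0 leey.
- by rewrite in_itv/= lee_fin mulr_ge0 ?subtree_radius_ge0// leey.
Qed.

Lemma subtree_mass_children i (e : R) : 0 < e ->
  exists M : nat, forall a, (M <= a)%N -> (subtree_mass (a :: i) < e%:E)%E.
Proof.
move=> e0; have [N hN] := nneseries_small_tail (fun k => wl_ge0 (word k)) summable_len e0.
(* This number exceeds every letter of the first [N] words. A larger letter [a] occurs in none of
   them, so all descendants of [a :: i] are coded in the tail. *)
exists (\sum_(k < N) sumn (word k)).+1 => a Ma; apply: le_lt_trans hN.
apply: nneseries_cond_le_tail => // k kN; apply/negP => ak.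
have : a \in word k.
  by move/suffixP : ak => [u ->]; rewrite mem_cat mem_head orbT.
move=> /le_sumn; rewrite leqNgt => /negP; apply; apply: leq_trans Ma.
by rewrite ltnS (bigD1 (Ordinal kN))//= leq_addr.
Qed.

Lemma subtree_radius_children i (e : R) : 0 < e ->
  exists M : nat, forall a, (M <= a)%N -> subtree_radius (a :: i) < e.
Proof.
move=> e0; pose K := (1 - y^-1)^-1.
have eK : 0 < (e / K) `^ s by rewrite powR_gt0// divr_gt0.
have [M hM] := subtree_mass_children i eK; exists M => a /hM.
rewrite -[X in (X < _)%E](fineK (subtree_mass_fin _)) lte_fin => h.
rewrite /subtree_radius -/K -ltr_pdivlMr//.
rewrite -[ltRHS]powRr1 ?(divr_ge0 (ltW e0) (ltW K_gt0))//.
rewrite -[X in _ < _ `^ X](@divff _ s) ?gt_eqF// powRrM.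
by apply: gt0_ltr_powR => //; rewrite ?invr_gt0// nnegrE ?powR_ge0// fine_ge0 ?subtree_mass_ge0.
Qed.

Lemma range_point_itv w : range (ipoint w) = ipoint w @` `[0, len_ w].
Proof.
apply/seteqP; split=> [_ [t _ <-]|_ [t _ <-]]; last by exists t.
exists (clamp (len_ w) t); first by rewrite /= in_itv/= clamp_itv.
apply: mdist_positivity; rewrite mdist_point_same (clamp_id (clamp_itv _ _ _ _))//.
by rewrite subrr normr0.
Qed.

Lemma closed_range_point w : closed (range (ipoint w)).
Proof.
apply: compact_closed; first exact: metric_hausdorff.
rewrite range_point_itv; apply: continuous_compact; last exact: segment_compact.
by apply: continuous_subspaceT; exact: continuous_point.
Qed.

(** Closure does not commute with the infinite union over the children of [i]. But [x] is at some
    distance [e > 0] from the closed interval of [i], and all children from some index [M] on have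
    subtrees within [e / 2] of that interval, which leaves a finite union. *)
Lemma limit_point_subtree (x : tree beta xi) n :
  ~ range (embed (tree_pseudodist beta xi)) x ->
  exists2 i, size i = n & closure (subtree i) x.
Proof.
move=> nx; elim: n => [|n [i <- xi_]].
  exists [::] => //; apply: closureS (_ : closure (range (embed _)) x).
    move=> _ /range_embedP[w [t [_ _ ->]]]; exists w; first exact: suffix0s.
    by exists t.
  move=> B /[dup] xB /(ex_intro (fun x => (interior B) x) x) h.
  have [z [Bz [u _ uz]]] := dense_embed h (@open_interior _ B).
  by exists z; split; [exists u|exact: interior_subset].
have nE : nbhs x (~` range (ipoint i)).
  apply: open_nbhs_nbhs; split; first exact/closed_openC/closed_range_point.
  by move=> [t _ tx]; apply: nx; rewrite -tx; exact: point_range.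
move: nE; rewrite -metricType_numDomainType.filter_from_mdist_nbhs => -[e e0 hE].
have e2 : 0 < e / 2 by rewrite divr_gt0.
have [M hM] := subtree_radius_children i e2.
apply: contrapT => nc.
have : \forall z \near x, forall a : 'I_M, ~ subtree (nat_of_ord a :: i) z.
  apply: (@filter_forall _ 'I_M (fun a => ~` subtree (nat_of_ord a :: i)) (nbhs x)) => a.
  have : ~ closure (subtree (nat_of_ord a :: i)) x by move=> h; apply: nc; eexists; last exact: h.
  move=> h; apply: contrapT => h2; apply: h => B xB; apply: contrapT => h3; apply: h2.
  by apply: filterS xB => z Bz sz; apply: h3; exists z.
move=> /(filterI (nbhsx_ballx x _ e2))/xi_[z [[w iw [t _ <-]]]] [].
rewrite ballEmdist/= => xw nw.
have [aw|aw] := pselect (exists a, suffix (a :: i) w); last first.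
  suff wi : w = i by apply: (hE (ipoint w t)) => /=; [lra|rewrite wi; exists t].
  apply: contrapT => wi; apply: aw; move/suffixP : iw wi => [u ->].
  case/lastP : u => [//|u a] _; exists a.
  by rewrite cat_rcons; exact: suffix_suffix.
move: aw => [a aw]; have [aM|Ma] := ltnP a M.
  by apply: (nw (Ordinal aM)); exists w => //; exists t.
have := mdist_subtree t aw; rewrite point_glue// => h.
apply: (hE (ipoint i (foot beta xi (a :: i)).2)); last by eexists.
have := hM a Ma; have := metric_triangle x (ipoint w t) (ipoint i (foot beta xi (a :: i)).2).
rewrite /=; lra.
Qed.

Lemma hausdorff_limit_points :
  hausdorff_measure s (~` range (embed (tree_pseudodist beta xi))) = 0%E.
Proof.
apply: hausdorff_measure0_cover => // e e0.
pose C := (2 * (1 - y^-1)^-1) `^ s.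
have C0 : 0 < C by rewrite powR_gt0// mulr_gt0.
have [N hN] := nneseries_small_tail (fun k => wl_ge0 (word k)) summable_len (divr_gt0 e0 C0).
(* Longer than each of the first [N] words, so that every word of length at least [n] is coded in
   the tail. *)
pose n := (\sum_(k < N) size (word k)).+1.
exists (fun k => if size (word k) == n then subtree_ball (word k) else set0); split.
  move=> x /(@limit_point_subtree _ n)[i sn /closure_subtree xi_].
  by exists (CodeSeq.code i) => //; rewrite CodeSeq.codeK sn eqxx.
(* Masses of the generation [n] subtrees as a double series. After the interchange each word [l] is
   counted at most once, since it has a single suffix of length [n]. *)
pose a k l := if (size (word k) == n) && suffix (word k) (word l) then
  (weighted_len (word l))%:E else 0%E.
have a0 k l : (0 <= a k l)%E by rewrite /a; case: ifP.
apply: (@le_trans _ _ (\sum_(0 <= k <oo) C%:E * \sum_(0 <= l <oo) a k l)%E).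
  apply: lee_nneseries => [k _ _|k _]; first exact: poweR_ge0.
  case: ifPn => [sn|sn]; last first.
    rewrite (_ : diam set0 = 0%E) ?poweR0r ?gt_eqF//.
      by rewrite mule_ge0 ?lee_fin ?(ltW C0)// nneseries_ge0.
    by apply/eqP; rewrite eq_le diam_ge0 andbT; apply: diam_le.
  rewrite (le_trans (diam_subtree_ball _))// lee_pmul2l// /subtree_mass eseries_mkcond.
  by apply: lee_nneseries => [l _ _|l _]; [case: ifP|rewrite /a sn].
rewrite nneseriesZl//; last by move=> k _; exact: nneseries_ge0.
rewrite -lee_pdivlMl// -EFinM mulrC.
rewrite nneseries_interchange//.
apply: (le_trans _ (ltW hN)).
apply: (@le_trans _ _ (\sum_(0 <= l <oo | (n <= size (word l))%N) (weighted_len (word l))%:E)%E).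
  rewrite [leRHS]eseries_mkcond; apply: lee_nneseries => [l _ _|l _].
    exact: nneseries_ge0.
  case: ifPn => [nl|nl]; last first.
    rewrite eseries0// => k _ _; rewrite /a; case: ifPn => // /andP[/eqP kn /size_suffix].
    by rewrite kn (negbTE nl).
  pose v := drop (size (word l) - n) (word l).
  have sv : size v = n by rewrite size_drop subKn.
  rewrite (@nneseriesD1 _ _ (CodeSeq.code v))// eseries0 ?adde0.
    by rewrite /a; case: ifP => // _; exact: wl_ge0.
  move=> k _ /andP[_ kv]; rewrite /a; case: ifPn => // /andP[/eqP kn ks].
  case/eqP: kv; rewrite -[k]CodeSeq.decodeK; congr CodeSeq.code.
  by apply: (suffix_size_eq ks); [exact: suffix_drop|rewrite kn sv].
apply: nneseries_cond_le_tail => // k kN; rewrite -ltnNge /n ltnS.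
by rewrite (bigD1 (Ordinal kN))//= leq_addr.
Qed.

End upper_bound.

(** * Dimension of the intervals *)

Section intervals.
Context {R : realType} (beta : R) (xi : seq nat -> block R).
Hypothesis len_gt0 : forall w, 0 < len (xi w).
Local Notation len_ := (interval_len beta xi).
Local Notation ipoint := (ipoint beta xi).

Lemma hausdorff_measure_interval w (t : R) : 1 < t ->
  hausdorff_measure t (range (ipoint w)) = 0%E.
Proof.
move=> t1; have t0 := lt_trans ltr01 t1.
apply: hausdorff_measure0_cover => // e e0; pose l := len_ w.
have l0 : 0 <= l by exact: interval_len_ge0.
have tm1 : 0 < t - 1 by rewrite subr_gt0.
(* Cutting into [m] equal pieces costs [l^t * m^(1-t)], and [z] below solves for [m]. Using [l + 1]
   keeps the base positive for an interval of length 0. *)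
have [m m0 hm] : exists2 m : nat, (0 < m)%N & (l + 1) `^ t * (m%:R^-1) `^ (t - 1) <= e.
  pose z := ((l + 1) `^ t / e) `^ (t - 1)^-1.
  have lt0 : 0 < (l + 1) `^ t / e by rewrite divr_gt0// powR_gt0// ltr_wpDl.
  exists (Num.truncn z).+1 => //.
  have zm : z <= (Num.truncn z).+1%:R by rewrite ltW// truncnS_gt.
  rewrite -[_^-1]powR_inv1 ?ler0n// -powRrM mulN1r powRN.
  rewrite ler_pdivrMr ?powR_gt0 ?ltr0n// -ler_pdivrMl// mulrC.
  rewrite -[leLHS]powRr1 ?(ltW lt0)// -[X in _ `^ X <= _](@mulVf _ (t - 1)) ?gt_eqF// powRrM.
  apply: ge0_ler_powR => //; rewrite ?nnegrE ?powR_ge0//; exact: ltW.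
exists (fun k => if (k < m)%N then ipoint w @` [set u | k%:R * (l / m%:R) <= u <= k.+1%:R * (l / m%:R)]
  else set0); split.
  move=> _ [u _ <-]; pose c := clamp l u.
  have c01 : 0 <= c <= l by exact: clamp_itv.
  have /andP[c0 cl] := c01.
  have cE : ipoint w u = ipoint w c.
    apply: mdist_positivity; rewrite mdist_point_same.
    by rewrite (clamp_id c01) subrr normr0.
  have mR : 0 < m%:R :> R by rewrite ltr0n.
  have [le0|lN0] := eqVneq l 0.
    exists 0%N => //; rewrite /= m0; exists c => //.
    have c00 : c = 0 by apply: le_anti; rewrite c0 andbT -[leRHS]le0.
    by rewrite /= c00 le0 !mul0r mulr0 lexx.
  have lp : 0 < l by rewrite lt_neqAle eq_sym lN0.
  pose k := Num.truncn (c / (l / m%:R)).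
  have d0 : 0 < l / m%:R by rewrite divr_gt0.
  have q0 : 0 <= c / (l / m%:R) by rewrite divr_ge0// ltW.
  (* Rounding down would give the right endpoint the index [m]; it belongs to the last piece. *)
  have [ce|cN] := eqVneq c l.
    exists m.-1 => //; rewrite /= prednK// leqnn; exists c => //=.
    have ml : m%:R * (l / m%:R) = l by rewrite mulrC divfK ?gt_eqF.
    by rewrite ce ml lexx andbT -[leRHS]ml ler_wpM2r ?(ltW d0)// ler_nat leq_pred.
  have {}cl : c < l by rewrite lt_neqAle cN.
  have kle : k%:R <= c / (l / m%:R) by rewrite truncn_le.
  have klt : c / (l / m%:R) < k.+1%:R by exact: truncnS_gt.
  have km : (k < m)%N.
    rewrite -(ltr_nat R) (le_lt_trans kle)// ltr_pdivrMr// mulrC divfK ?gt_eqF//.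
  exists k => //; rewrite /= km; exists c => //=.
  by rewrite -ler_pdivlMr// kle/= -ler_pdivrMr// ltW.
have dm : 0 <= l / m%:R by rewrite divr_ge0.
apply: (@le_trans _ _ (\sum_(0 <= k <oo | (k < m)%N) ((l / m%:R) `^ t)%:E)%E).
  rewrite [leRHS]eseries_mkcond; apply: lee_nneseries => [k _ _|k _].
    exact: poweR_ge0.
  case: ifPn => km; last first.
    rewrite (_ : diam set0 = 0%E) ?poweR0r ?gt_eqF//.
    by apply/eqP; rewrite eq_le diam_ge0 andbT; apply: diam_le.
  rewrite -poweR_EFin; apply: gt0_ler_poweR; first exact: ltW.
  - by rewrite in_itv/= diam_ge0 leey.
  - by rewrite in_itv/= lee_fin dm leey.
  apply: diam_le; first by rewrite lee_fin.
  move=> _ _ [u /= hu <-] [v /= hv <-]; rewrite lee_fin mdist_point_same.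
  rewrite (le_trans (clamp_lip _ _ _))// ler_norml.
  move: hu hv; rewrite -(natr1 k) mulrDl mul1r => /andP[? ?] /andP[? ?].
  by apply/andP; split; lra.
have pc k : (k < m)%N -> (0 <= ((l / m%:R) `^ t)%:E)%E by rewrite lee_fin powR_ge0.
rewrite (@nneseries_split_cond _ _ 0%N m _ pc) add0n [X in (_ + X)%E]eseries0 ?adde0; last first.
  by move=> k mk km; rewrite ltnNge mk in km.
rewrite big_mkcond/= (eq_big_nat _ _ (F2 := fun=> ((l / m%:R) `^ t)%:E)); last first.
  by move=> k /andP[_ ->].
rewrite sumEFin lee_fin sumr_const_nat subn0 (le_trans _ hm)//.
have mR : 0 < m%:R :> R by rewrite ltr0n.
have -> : (l / m%:R) `^ t *+ m = l `^ t * (m%:R^-1) `^ (t - 1).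
  rewrite powRM// ?invr_ge0 ?ler0n// powRB; last by rewrite invr_eq0 gt_eqF// implybT.
  by rewrite powRr1 ?invr_ge0 ?ler0n// invrK -mulr_natr mulrA.
apply: ler_pM => //; rewrite ?powR_ge0//.
by apply: ge0_ler_powR; rewrite ?nnegrE ?(ltW t0) ?addr_ge0// lerDl.
Qed.

(** The root interval has positive length. For [t < 1] and diameters at most 1 the diameter is at
    most its t-th power, so a cheap cover would make that interval too short in Lebesgue measure. *)
Lemma hausdorff_dim_tree_ge1 : (1 <= hausdorff_dim [set: tree beta xi])%E.
Proof.
apply: hausdorff_dim_ge => t t0; rewrite lte_fin => t1.
move=> /(hausdorff_measure_eq0P _ t0) h.
pose l := len_ [::].
have l0 : 0 < l by rewrite /l /interval_len/= powR1 mul1r.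
have l20 : 0 < l / 2 by rewrite divr_gt0.
have [U [TU U1 Us]] := h _ l20.
pose V k := `[0, l] `&` [set u | U k (ipoint [::] u)].
(* The covering sets need not be measurable, so their traces are replaced by interval hulls, which
   are no longer than the diameter; for an empty trace the hull is the point 0. *)
pose I k := `[inf (V k), sup (V k)]%classic.
have VI k : V k `<=` I k.
  move=> u Vu; rewrite /I/= in_itv/=; apply/andP; split.
    by apply: ge_inf => //; exists 0 => z [/=]; rewrite in_itv/= => /andP[].
  by apply: ub_le_sup => //; exists l => z [/=]; rewrite in_itv/= => /andP[].
have lI k : (lebesgue_measure (I k) <= poweR (diam (U k)) t)%E.
  apply: (@le_trans _ _ (diam (U k))).
    rewrite lebesgue_measure_itv/= lte_fin; case: ifPn => [ltV|_]; last exact: diam_ge0.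
    have V0 : V k !=set0.
      by apply/set0P/negP => /eqP V0; move: ltV; rewrite V0 sup0 inf0 ltxx.
    have hs : has_sup (V k) by split => //; exists l => z [/=]; rewrite in_itv/= => /andP[].
    have hi : has_inf (V k) by split => //; exists 0 => z [/=]; rewrite in_itv/= => /andP[].
    rewrite -EFinB; apply/lee_addgt0Pr => e e0.
    have e2 : 0 < e / 2 by rewrite divr_gt0.
    have [a [a01 Ua] ha] := sup_adherent e2 hs.
    have [b [b01 Ub] hb] := inf_adherent e2 hi.
    apply: (@le_trans _ _ ((mdist (ipoint [::] a) (ipoint [::] b))%:E + e%:E)%E); last first.
      by rewrite leeD2r//; exact: mdist_le_diam.
    rewrite -EFinD lee_fin mdist_point_same !clamp_id//.
      by have := ler_norm (a - b); lra.
  have := diam_ge0 (U k); have := U1 k.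
  case: (diam (U k)) => [r|//|//]; rewrite poweR_EFin !lee_fin => r1 r0.
  have [->|rN0] := eqVneq r 0; first by rewrite powR0 ?gt_eqF.
  apply: ger1_powR; rewrite ?(ltW t1)// r1 andbT lt_neqAle eq_sym rN0//.
have : (lebesgue_measure `[0%R, l]%classic <= (l / 2)%:E)%E.
  apply: le_trans (_ : _ <= \sum_(0 <= k <oo) lebesgue_measure (I k))%E _.
    apply: measure_sigma_subadditive => [k||u lu]; [exact: measurable_itv..|].
    have [k _ Uu] := TU (ipoint [::] u) Logic.I.
    by exists k => //; apply: VI; split.
  apply: le_trans Us; apply: lee_nneseries => // k _ _; exact: measure_ge0.
rewrite lebesgue_measure_itv/= lte_fin l0 -EFinB subr0 lee_fin; lra.
Qed.

End intervals.

(** * Cuts and the dimension of the leaves *)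

Fixpoint words (N n : nat) : seq (seq nat) :=
  if n is n'.+1 then [seq a :: w | a <- iota 0 N, w <- words N n'] else [:: [::]].

Lemma size_words N n w : w \in words N n -> size w = n.
Proof.
elim: n w => [|n IH] w /=; first by rewrite inE => /eqP ->.
by case/allpairsP => -[a v] /= [_ /IH <- ->].
Qed.

Lemma uniq_words N n : uniq (words N n).
Proof.
elim: n => [//|n IH] /=; apply: allpairs_uniq => //; first exact: iota_uniq.
by move=> [a v] [b u] _ _ /= [-> ->].
Qed.

(** With reversed words, [p] is the last common ancestor and [a], [b] are the letters at which the
    two lines part. *)
Lemma common_suffix (T : eqType) (u v : seq T) : size u = size v -> u != v ->
  exists u1 v1 a b p, [/\ a != b, u = u1 ++ a :: p & v = v1 ++ b :: p].
Proof.
elim: u v => [|c u IH] [|d v]//= [uv]; have [<-|nuv _] := eqVneq u v.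
  rewrite eqseq_cons eqxx andbT => cd.
  by exists [::], [::], c, d, u.
have [u1 [v1 [a [b [p [ab -> ->]]]]]] := IH v uv nuv.
by exists (c :: u1), (d :: v1), a, b, p.
Qed.

Section truncation.
Context {R : realType} (N m : nat) (eps q : R) (xi : seq nat -> block R).

(* The lower bound on [att b j] keeps the limits of distinct rays apart. *)
Definition truncw (b : block R) (j : nat) : R :=
  if [&& (j < N)%N, eps <= wgt b j <= eps^-1 & eps <= att b j] then wgt b j else 0.

Fixpoint relw (w j : seq nat) : R :=
  if j is a :: j' then relw w j' * truncw (xi (j' ++ w)) a else 1.

(* Only blocks that contract by 1/2 are kept, so that weights decrease
   geometrically along every ray. *)
Definition coef (w j : seq nat) : R :=
  if relw w j <= 2^-1 then relw w j `^ q else 0.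

(* The value of the minimal cut separating w from its descendants n * m
   generations below, when each vertex has capacity the q-th power of its
   weight relative to w. *)
Fixpoint mincut (n : nat) (w : seq nat) : R :=
  if n is n'.+1 then
    Num.min 1 (\sum_(j <- words N m) coef w j * mincut n' (j ++ w))
  else 1.

Lemma relw_cat w u v : relw w (u ++ v) = relw w v * relw (v ++ w) u.
Proof.
by elim: u => [|a u IH] /=; rewrite ?mulr1// IH catA mulrA.
Qed.

Lemma coef_ge0 w j : 0 <= coef w j.
Proof. by rewrite /coef; case: ifP => // _; exact: powR_ge0. Qed.

Lemma mincut_ge0 n w : 0 <= mincut n w.
Proof.
elim: n w => [|n IH] w //=; rewrite le_min ler01/=.
by rewrite sumr_ge0// => j _; rewrite mulr_ge0// coef_ge0.
Qed.

Lemma mincut_le1 n w : mincut n w <= 1.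
Proof. by case: n => [|n] //=; rewrite ge_min lexx. Qed.

Lemma mincut_decr n k w : (n <= k)%N -> mincut k w <= mincut n w.
Proof.
suff h l v : mincut l.+1 v <= mincut l v.
  by move=> /subnK <-; elim: (k - n)%N => [//|l IH]; rewrite addSn (le_trans (h _ _)).
elim: l v => [|l IH] v; first exact: mincut_le1.
rewrite /= le_min ge_min lexx/= ge_min; apply/orP; right.
rewrite [X in _ <= X](_ : _ = \sum_(j <- words N m) coef v j * mincut l (j ++ v))//.
by apply: ler_sum => j _; apply: ler_wpM2l; [exact: coef_ge0|exact: IH].
Qed.

Hypothesis eps_gt0 : 0 < eps.

Lemma truncw_ge0 b j : 0 <= truncw b j.
Proof. by rewrite /truncw; case: ifP => // /and3P[_ /andP[/(le_trans (ltW eps_gt0))]]. Qed.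

Lemma truncw_gt0 b j : 0 < truncw b j ->
  [/\ eps <= wgt b j, eps <= att b j & truncw b j = wgt b j].
Proof. by rewrite /truncw; case: ifP => [/and3P[_ /andP[]]|]; rewrite ?ltxx. Qed.

Lemma relw_ge0 w j : 0 <= relw w j.
Proof. by elim: j => //= a j IH; rewrite mulr_ge0// truncw_ge0. Qed.

Lemma relw_cat_gt0 w u v : 0 < relw w (u ++ v) -> 0 < relw w v /\ 0 < relw (v ++ w) u.
Proof.
rewrite relw_cat => h.
have := relw_ge0 w v; rewrite le_eqVlt => /orP[/eqP e|w0]; first by rewrite -e mul0r ltxx in h.
by split => //; rewrite pmulr_rgt0 in h.
Qed.

Lemma coef_gt0 w j : 0 < q -> 0 < coef w j ->
  [/\ 0 < relw w j, relw w j <= 2^-1 & coef w j = relw w j `^ q].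
Proof.
move=> q0; rewrite /coef; case: ifP => [h c|]; rewrite ?ltxx//; split => //.
rewrite lt_neqAle relw_ge0 andbT; apply/eqP => e.
by rewrite -e powR0 ?gt_eqF// ltxx in c.
Qed.

Lemma relw_cwgt w j : 0 < relw w j -> cwgt xi (j ++ w) = cwgt xi w * relw w j.
Proof.
elim: j => [|a j IH] /=; first by rewrite mulr1.
move=> /(@relw_cat_gt0 w [:: a] j)[j0].
by rewrite /= mul1r => /truncw_gt0[_ _ ->]; rewrite IH// mulrA.
Qed.

Lemma relw_lb w j : 0 < relw w j -> eps ^+ size j <= relw w j.
Proof.
elim: j => [|a j IH] //= /(@relw_cat_gt0 w [:: a] j)[j0].
rewrite /= mul1r => /truncw_gt0[h _ ->]; rewrite exprS mulrC.
by rewrite ler_pM ?exprn_ge0 ?(ltW eps_gt0)// IH.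
Qed.

End truncation.

(** * Rays, their limits, and the cuts defined by covers *)

Section lower_bound.
Context {R : realType} (beta : R) (xi : seq nat -> block R).
Hypothesis beta_gt0 : 0 < beta.
Hypothesis len_gt0 : forall w, 0 < len (xi w).
Hypothesis att_itv : forall w j, 0 <= att (xi w) j <= len (xi w).
Variables (N m : nat) (eps q : R).
Hypotheses (m_gt0 : (0 < m)%N) (eps_gt0 : 0 < eps) (eps_le1 : eps <= 1) (q_gt0 : 0 < q).
Variables (K x : R).
Hypotheses (K_ge0 : 0 <= K) (x_ge0 : 0 <= x) (x_lt1 : x < 1).
Local Notation len_ := (interval_len beta xi).
Hypothesis len_decay : forall v, len_ v <= K * x ^+ size v.
Local Notation ipoint := (ipoint beta xi).
Local Notation coef := (coef N eps q xi).
Local Notation relw := (relw N eps xi).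
Local Notation mincut := (mincut N m eps q xi).
Variables (i0 : seq nat) (eta : R).
Hypotheses (i0_alive : 0 < cwgt xi i0) (eta_gt0 : 0 < eta).
Hypothesis mincut_eta : forall n, eta <= mincut n i0.

Definition is_ray (r : nat -> seq nat) := r 0%N = [::] /\
  forall n, exists j, [/\ j \in words N m, 0 < coef (r n ++ i0) j & r n.+1 = j ++ r n].

Definition ray_limit (r : nat -> seq nat) (z : tree beta xi) :=
  ipoint (r n ++ i0) 0 @[n --> \oo] --> z.

Lemma ray_size r n : is_ray r -> size (r n) = (n * m)%N.
Proof.
move=> [r0 rS]; elim: n => [|n IH]; first by rewrite r0.
by have [j [/size_words jm _ ->]] := rS n; rewrite size_cat IH jm mulSn.
Qed.

Lemma ray_suffix r n k : is_ray r -> (n <= k)%N -> suffix (r n) (r k).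
Proof.
move=> [r0 rS]; elim: k => [|k IH]; first by rewrite leqn0 => /eqP ->; exact: suffix_refl.
rewrite leq_eqVlt => /orP[/eqP ->|/IH nk]; first exact: suffix_refl.
by have [j [_ _ ->]] := rS k; exact: suffix_catr.
Qed.

Lemma suffix_cat2r (s t u : seq nat) : suffix s t -> suffix (s ++ u) (t ++ u).
Proof. by move=> /suffixP[v ->]; rewrite -catA; exact: suffix_suffix. Qed.

Lemma ray_relw r n : is_ray r -> 0 < relw i0 (r n) <= 2^-1 ^+ n.
Proof.
move=> [r0 rS]; elim: n => [|n /andP[IH1 IH2]]; first by rewrite r0 /= ltr01 lexx.
have [j [_ /(coef_gt0 eps_gt0 q_gt0)[j0 j2 _] ->]] := rS n.
rewrite relw_cat mulr_gt0//= exprSr ler_pM//; exact: ltW.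
Qed.

Let c0 v : clamp (len_ v) 0 = 0.
Proof. by rewrite clamp_id// lexx interval_len_ge0. Qed.

Let xV_ge0 : 0 <= (1 - x)^-1. Proof. by rewrite invr_ge0 subr_ge0 ltW. Qed.

Lemma mdist_ray r n k : is_ray r -> (n <= k)%N ->
  mdist (ipoint (r k ++ i0) 0) (ipoint (r n ++ i0) 0) <= K * x ^+ n * (1 - x)^-1.
Proof.
move=> rr nk; have sn := ray_size n rr; rewrite mdist_point !c0.
have nw : (n <= size (r n ++ i0))%N.
  by rewrite size_cat sn (leq_trans _ (leq_addr _ _))// leq_pmulr.
apply: le_trans (tree_dist_le att_itv _ _ K_ge0 x_ge0 x_lt1 _) _.
- exact/suffix_cat2r/ray_suffix.
- by rewrite normr0 interval_len_ge0.
- by move=> v _.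
by rewrite ler_wpM2r// ler_wpM2l// ler_wiXn2l// ltW.
Qed.

Lemma ray_tail_small (e : R) : 0 < e -> exists n, K * x ^+ n * (1 - x)^-1 < e.
Proof.
move=> e0.
have : K * x ^+ n * (1 - x)^-1 @[n --> \oo] --> K * 0 * (1 - x)^-1.
  apply: cvgM; last exact: cvg_cst.
  apply: cvgM; first exact: cvg_cst.
  by apply: cvg_expr; rewrite ger0_norm.
rewrite mulr0 mul0r => /cvgrPdist_lt/(_ _ e0)[n _ /(_ n (leqnn n))] /=.
by rewrite sub0r normrN => h; exists n; exact: le_lt_trans (ler_norm _) h.
Qed.

Lemma ray_cvg r : is_ray r -> exists z, ray_limit r z.
Proof.
move=> rr; apply: completion_complete => e e0.
have [n hn] := ray_tail_small (divr_gt0 e0 (ltr0n R 2)).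
exists n => k l nk nl.
apply: le_lt_trans (metric_triangle _ (ipoint (r n ++ i0) 0) _) _.
rewrite (metric_sym (ipoint (r n ++ i0) 0)) (splitr e) ltrD//.
  exact: le_lt_trans (mdist_ray rr nk) hn.
exact: le_lt_trans (mdist_ray rr nl) hn.
Qed.

Lemma ray_limit_dist r z (y : tree beta xi) c n0 : ray_limit r z ->
  (forall n, (n0 <= n)%N -> c <= mdist (ipoint (r n ++ i0) 0) y) -> c <= mdist z y.
Proof.
move=> rz h; apply/ler_addgt0Pr => e e0.
move: rz => /metricType_numDomainType.cvgrPdist_lt/(_ e e0)[n1 _ h1].
have h2 := h1 (maxn n0 n1) (leq_maxr _ _); have h3 := h _ (leq_maxl n0 n1).
move: h2 h3 => /=; have := metric_triangle (ipoint (r (maxn n0 n1) ++ i0) 0) z y.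
rewrite (metric_sym _ z); lra.
Qed.

(* After the letters a :: p below r n, every ray continues with some letter b,
   attached at height at least eps times the scale of its parent. *)
Lemma ray_next r n u a p : is_ray r -> r n.+1 = u ++ a :: p ++ r n ->
  exists b, [/\ forall k, (n.+2 <= k)%N -> suffix (b :: a :: p ++ r n ++ i0) (r k ++ i0),
    eps <= att (xi (a :: p ++ r n ++ i0)) b &
    (cwgt xi i0 * relw i0 (r n) * eps ^+ m) `^ beta <=
      cwgt xi (a :: p ++ r n ++ i0) `^ beta].
Proof.
move=> rr e1; have [j [jw cj e2]] := rr.2 n.+1; have sj := size_words jw.
(* [b] is the letter right after [a :: p ++ r n]: it belongs to the same block if [u] is nonempty
   and to the next block otherwise, which is why two blocks are inspected. *)
have [v [b jub]] : exists v b, j ++ u = rcons v b.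
  case/lastP E : (j ++ u) => [|v b]; last by exists v, b.
  by have /eqP := congr1 size E; rewrite size_cat sj addn_eq0 gtn_eqF.
have e3 : r n.+2 = v ++ (b :: a :: p) ++ r n.
  by rewrite e2 e1 [LHS]catA jub cat_rcons.
have /andP[pos _] := ray_relw n.+2 rr; rewrite e3 in pos.
have [pos1 _] := relw_cat_gt0 eps_gt0 pos.
have [pos0 pos2] := relw_cat_gt0 eps_gt0 pos1.
have [pos3 pos4] := @relw_cat_gt0 _ _ _ _ eps_gt0 _ [:: b] (a :: p) pos2.
exists b; split.
- move=> k nk; rewrite -[_ :: _](_ : ((b :: a :: p) ++ r n) ++ i0 = _); last by rewrite -catA.
  apply: suffix_cat2r; apply: suffix_trans (ray_suffix rr nk).
  by rewrite e3; exact: suffix_suffix.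
- by move: pos4 => /=; rewrite mul1r => /(truncw_gt0)[].
- have sp : (size (a :: p) <= m)%N.
    have := ray_size n.+1 rr; rewrite e1 size_cat /= size_cat (ray_size _ rr) mulSn.
    by move=> /eqP; rewrite -addSn addnA eqn_add2r => /eqP <-; rewrite leq_addl.
  have -> : cwgt xi (a :: p ++ r n ++ i0) =
      cwgt xi i0 * relw i0 (r n) * relw (r n ++ i0) (a :: p).
    by rewrite -(relw_cwgt eps_gt0 pos0) -(relw_cwgt eps_gt0 pos3).
  have A0 : 0 <= cwgt xi i0 * relw i0 (r n) by rewrite mulr_ge0 ?(ltW i0_alive) ?(ltW pos0).
  have el : eps ^+ m <= relw (r n ++ i0) (a :: p).
    apply: le_trans (relw_lb eps_gt0 pos3).
    by rewrite ler_wiXn2l// ltW.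
  apply: ge0_ler_powR; rewrite ?nnegrE; first exact: ltW.
  + by apply: mulr_ge0 => //; exact/exprn_ge0/ltW.
  + by apply: mulr_ge0 => //; exact: ltW.
  + exact: ler_wpM2l.
Qed.

(** Combines [tree_dist_ge] and [ray_next] and passes to the limit along the ray. The word [v k]
    varies so that one statement serves for a fixed interval and for the vertices of another ray. *)
Lemma ray_gap_ge r n u a p v z (s : R) c : is_ray r -> ray_limit r z ->
  r n.+1 = u ++ a :: p ++ r n ->
  (forall k, (c <= k)%N -> ~~ suffix (a :: p ++ r n ++ i0) (v k)) ->
  forall k, (c <= k)%N ->
  (cwgt xi i0 * relw i0 (r n) * eps ^+ m) `^ beta * eps <= mdist z (ipoint (v k) s).
Proof.
move=> rr rz e1 hv k ck; have [b [h1 h2 h3]] := ray_next rr e1.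
apply: (ray_limit_dist (n0 := n.+2) rz) => l nl.
rewrite mdist_point.
apply: (le_trans _ (tree_dist_ge beta xi _ _ _ (h1 l nl) (hv k ck))) => //.
by rewrite /= ler_pM// ?powR_ge0// ltW.
Qed.

(** The ray ends inside subtrees rooted deeper than any given word [w], at a positive distance from
    everything outside of them, in particular from the interval of [w]. So its limit is on no
    interval. *)
Lemma ray_limit_leaf r z : is_ray r -> ray_limit r z -> leaves (tree_root beta xi) z.
Proof.
move=> rr rz; apply: limit_point_leaf => // /range_embedP[w [t [_ _ zE]]].
pose n := size w.
have [j [jw _ e1]] := rr.2 n; have sj := size_words jw.
case: j => [|a p] in jw sj e1; first by move: m_gt0; rewrite -sj.
have := @ray_gap_ge r n [::] a p (fun=> w) z t 0 rr rz e1.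
move=> /(_ _ 0%N (leqnn _)); rewrite zE mdistxx => h.
have /andP[pos _] := ray_relw n rr.
suff : 0 < (cwgt xi i0 * relw i0 (r n) * eps ^+ m) `^ beta * eps.
  rewrite ltNge => /negP; apply; apply: h => k _; apply/negP => /size_suffix.
  rewrite /= !size_cat (ray_size _ rr) leqNgt => /negP; apply.
  rewrite ltnS (leq_trans _ (leq_addl _ _))// (leq_trans _ (leq_addr _ _))//.
  by rewrite leq_pmulr.
by rewrite mulr_gt0// powR_gt0// !mulr_gt0// exprn_gt0.
Qed.

(** The rays part inside one block, at letters [a] and [b] above a common [p]. The second ray never
    enters the subtree at [a :: p ++ r n ++ i0], which the first one keeps climbing. *)
Lemma rays_apart r r' n z z' : is_ray r -> is_ray r' -> ray_limit r z -> ray_limit r' z' ->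
  r n = r' n -> r n.+1 <> r' n.+1 ->
  (cwgt xi i0 * relw i0 (r n) * eps ^+ m) `^ beta * eps <= mdist z z'.
Proof.
move=> rr rr' rz rz' e0 ne.
have [j [jw _ e1]] := rr.2 n; have [j' [jw' _ e1']] := rr'.2 n.
have sj := size_words jw; have sj' := size_words jw'.
have nj : j != j' by apply/eqP => jj; apply: ne; rewrite e1 e1' jj e0.
have [u [v [a [b [p [ab jE jE']]]]]] := common_suffix (etrans sj (esym sj')) nj.
rewrite jE -catA /= in e1; rewrite jE' -catA /= in e1'.
rewrite metric_sym; apply: (ray_limit_dist (n0 := n.+1) rz') => k nk.
rewrite metric_sym.
refine (@ray_gap_ge r n u a p (fun k => r' k ++ i0) z 0 n.+1 rr rz e1 _ k nk) => l nl.
apply/negP => h.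
have h' : suffix (b :: p ++ r n ++ i0) (r' l ++ i0).
  rewrite -[_ :: _](_ : ((b :: p) ++ r n) ++ i0 = _); last by rewrite -catA.
  apply: suffix_cat2r; apply: suffix_trans (ray_suffix rr' nl).
  by rewrite e1' e0; exact: suffix_suffix.
have [/eqP] := suffix_size_eq h h' erefl.
by rewrite (negbTE ab).
Qed.

Let t : R := q / beta.
Let t_gt0 : 0 < t. Proof. exact: divr_gt0. Qed.
(** Chosen so that the t-th power of the gap in [rays_apart] equals [D0] times the q-th power of
    [relw i0 (r n)]. *)
Let D0 : R := (cwgt xi i0 * eps ^+ m) `^ q * eps `^ t.
Let D0_gt0 : 0 < D0.
Proof. by rewrite mulr_gt0 ?powR_gt0// mulr_gt0// exprn_gt0. Qed.

Lemma pow_half_small (e : R) : 0 < e -> exists n, (2^-1 ^+ n) `^ q <= e.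
Proof.
move=> e0; have e'0 : 0 < e `^ q^-1 by rewrite powR_gt0.
have : 2^-1 ^+ n @[n --> \oo] --> (0 : R).
  by apply: cvg_expr; rewrite ger0_norm//; lra.
move=> /cvgrPdist_lt/(_ _ e'0)[n _ /(_ n (leqnn n))] /=.
have p0 : 0 <= 2^-1 ^+ n :> R by rewrite exprn_ge0.
rewrite sub0r normrN ger0_norm// => h; exists n.
have -> : e = (e `^ q^-1) `^ q by rewrite -powRrM mulVf ?gt_eqF// powRr1// ltW.
apply: ge0_ler_powR; [exact: ltW|by rewrite nnegrE|by rewrite nnegrE powR_ge0|exact: ltW].
Qed.

(** [v] is the last vertex common to all rays ending in [U]: two of them part right after it, so
    [diam U] is at least the corresponding gap. *)
Lemma cut_vertex (U : set (tree beta xi)) (d : R) : 0 < d ->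
  (exists r z, [/\ is_ray r, ray_limit r z & U z]) ->
  exists v, (forall r z, is_ray r -> ray_limit r z -> U z -> exists n, r n = v) /\
    ((D0 * relw i0 v `^ q)%:E <= poweR (diam U) t + d%:E)%E.
Proof.
move=> d0 [r0 [z0 [rr0 rz0 Uz0]]].
have [same|] := pselect (forall n r z, is_ray r -> ray_limit r z -> U z -> r n = r0 n).
  (* With a single ray ending in [U] the diameter may be 0. A vertex far out on the ray has capacity
     below [d]; this case is the reason for the slack. *)
  have [n hn] := pow_half_small (divr_gt0 d0 D0_gt0); exists (r0 n); split.
    by move=> r z rr rz Uz; exists n; exact: same rz Uz.
  apply: (@le_trans _ _ d%:E); last by rewrite leeDr// poweR_ge0.
  rewrite lee_fin mulrC -ler_pdivlMr//; apply: le_trans hn.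
  have /andP[h1 h2] := ray_relw n rr0.
  by apply: ge0_ler_powR; rewrite ?nnegrE ?exprn_ge0// ltW.
move=> /existsNP ex.
pose P n := `[< exists r z, [/\ is_ray r, ray_limit r z, U z & r n <> r0 n] >].
have exP : exists n, P n.
  have [n /existsNP[r /existsNP[z h]]] := ex; exists n; apply/asboolP; exists r, z.
  have [rr /not_implyP[rz /not_implyP[Uz ne]]] := (not_implyP _ _).1 h.
  by split.
case: (ex_minnP exP) => n /asboolP[r [z [rr rz Uz ne]]] hmin.
case: n ne hmin => [|n] ne hmin; first by rewrite rr.1 rr0.1 in ne.
have agree r' z' : is_ray r' -> ray_limit r' z' -> U z' -> r' n = r0 n.
  move=> rr' rz' Uz'; apply: contrapT => h.
  have Pn : P n by apply/asboolP; exists r', z'.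
  by have := hmin n Pn; rewrite ltnn.
exists (r0 n); split; first by move=> r' z' rr' rz' Uz'; exists n; exact: agree rz' Uz'.
have e0 := agree _ _ rr rz Uz.
have gap := rays_apart rr rr0 rz rz0 e0 ne.
have /andP[w0 _] := ray_relw n rr; rewrite e0 in gap w0.
apply: (@le_trans _ _ (poweR (diam U) t)); last by rewrite leeDl// lee_fin ltW.
set g := _ * eps in gap.
have {}gap : (g%:E <= diam U)%E by apply: le_trans (mdist_le_diam Uz Uz0); rewrite lee_fin.
have g0 : 0 <= g by rewrite mulr_ge0 ?powR_ge0// ltW.
have -> : (D0 * relw i0 (r0 n) `^ q)%:E = poweR g%:E t.
  rewrite poweR_EFin; congr EFin; rewrite /g /D0 [RHS]powRM ?powR_ge0 ?(ltW eps_gt0)//.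
  rewrite -powRrM mulrCA divff ?gt_eqF// mulr1 mulrAC -powRM ?(ltW w0)//.
    by rewrite mulrAC.
  by rewrite mulr_ge0 ?exprn_ge0 ?(ltW eps_gt0) ?(ltW i0_alive).
apply: gt0_ler_poweR => //; first exact: ltW.
- by rewrite in_itv/= lee_fin g0 leey.
- by rewrite in_itv/= diam_ge0 leey.
Qed.

(** The [v k] with [h k] are too cheap to cut [i0] from infinity. The ray is built block by block,
    keeping the capacity still to be avoided below the minimal cut. *)
Lemma ray_avoiding (v : nat -> seq nat) (h : pred nat) :
  (\sum_(0 <= k <oo | h k) (relw i0 (v k) `^ q)%:E < eta%:E)%E ->
  exists2 r, is_ray r & forall k, h k -> forall n, r n <> v k.
Proof.
move=> small.
pose c k := (relw i0 (v k) `^ q)%:E.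
have c_ge0 k : (0 <= c k)%E by rewrite lee_fin powR_ge0.
pose cost (r : seq nat) := (\sum_(0 <= k <oo | h k && suffix r (v k)) c k)%E.
(* All depths are required at once, because a bound at one fixed depth would be used up after
   finitely many blocks. *)
pose Inv r := forall n, (cost r < (relw i0 r `^ q * mincut n (r ++ i0))%:E)%E.
have disj r k : (\sum_(j <- words N m) (if h k && suffix (j ++ r) (v k) then c k else 0%E) <=
    if h k && suffix r (v k) then c k else 0%E)%E.
  have [/hasP[j jw /andP[hk sj]]|/hasPn nj] :=
      boolP (has (fun j => h k && suffix (j ++ r) (v k)) (words N m)).
    rewrite (bigD1_seq j)//= ?uniq_words// hk sj/= big_seq_cond big1 ?adde0.
      by rewrite (catl_suffix sj).
    move=> l /andP[lw lj]; case: ifPn => // sl; case/eqP: lj.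
    have := suffix_size_eq sl sj; rewrite !size_cat (size_words lw) (size_words jw).
    by move=> /(_ erefl) /eqP; rewrite eqseq_cat ?(size_words lw) ?(size_words jw)// => /andP[/eqP].
  rewrite big_seq big1; first by case: ifP.
  by move=> j /nj /negbTE ->.
have step r : Inv r -> exists j, [/\ j \in words N m, 0 < coef (r ++ i0) j & Inv (j ++ r)].
  move=> Ir; apply: contrapT => no.
  have bad j : exists n, j \in words N m ->
      ((relw i0 r `^ q * (coef (r ++ i0) j * mincut n (j ++ r ++ i0)))%:E <= cost (j ++ r))%E.
    have [jw|jw] := boolP (j \in words N m); last by exists 0%N.
    have := coef_ge0 N eps q xi (r ++ i0) j; rewrite le_eqVlt => /orP[/eqP <-|cj].
      by exists 0%N => _; rewrite mul0r mulr0; exact: nneseries_ge0.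
    have /existsNP[n hn] : ~ Inv (j ++ r) by move=> Ij; apply: no; exists j.
    exists n => _; rewrite leNgt; apply/negP => hh; apply: hn.
    have [j0 _ cE] := coef_gt0 eps_gt0 q_gt0 cj.
    by rewrite relw_cat powRM ?relw_ge0// -cE -catA -mulrA.
  have [nn hnn] := choice bad.
  (* If every child violates the invariant at some depth, then all do so at the largest one, as
     there are finitely many children and [mincut] decreases with depth; adding up contradicts
     [Inv r] at depth [M.+1]. *)
  pose M := (\max_(j <- words N m) nn j)%N.
  have := Ir M.+1; rewrite ltNge => /negP; apply.
  apply: (@le_trans _ _ (\sum_(j <- words N m) cost (j ++ r))%E).
    apply: (@le_trans _ _ (\sum_(j <- words N m) (relw i0 r `^ q *
        (coef (r ++ i0) j * mincut M (j ++ r ++ i0)))%:E)%E).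
      rewrite sumEFin lee_fin -mulr_sumr ler_wpM2l ?powR_ge0//=.
      by rewrite ge_min lexx orbT.
    rewrite big_seq [leRHS]big_seq; apply: lee_sum => j jw.
    apply: le_trans (hnn j jw); rewrite lee_fin ler_wpM2l ?powR_ge0// ler_wpM2l ?coef_ge0//.
    by apply: mincut_decr; exact: leq_bigmax_seq.
  rewrite /cost; under eq_bigr do rewrite eseries_mkcond.
  rewrite -nneseries_sum; last by move=> j k _; case: ifP.
  rewrite [leRHS]eseries_mkcond; apply: lee_nneseries => [k _ _|k _]; last exact: disj.
  by apply: sume_ge0 => j _; case: ifP.
have /choice[nx hnx] : forall r, exists j, Inv r ->
    [/\ j \in words N m, 0 < coef (r ++ i0) j & Inv (j ++ r)].
  move=> r; have [Ir|nI] := pselect (Inv r); last by exists [::].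
  by have [j hj] := step r Ir; exists j.
pose r n := iter n (fun r => nx r ++ r) [::].
have Ir n : Inv (r n).
  elim: n => [|n /hnx[]//] k; rewrite /= powR1 mul1r.
  apply: lt_le_trans (_ : eta%:E <= _)%E; last by rewrite lee_fin.
  apply: le_lt_trans small; rewrite /cost [leLHS]eseries_mkcond [leRHS]eseries_mkcond.
  by apply: lee_nneseries => [l _ _|l _]; [case: ifP|rewrite suffix0s andbT].
exists r; first by split => // n; have [jw cj _] := hnx _ (Ir n); exists (nx (r n)).
move=> k hk n rn.
(* At depth 0 the cut is the vertex itself, with value 1; [v k = r n] alone would already cost that
   much. *)
have := Ir n 0%N; rewrite /= mulr1 ltNge => /negP; apply.
rewrite /cost (@nneseriesD1 _ _ k)//; last by rewrite hk rn suffix_refl.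
rewrite {1}rn; apply: leeDl; apply: nneseries_ge0 => l _ _; exact: c_ge0.
Qed.

Lemma hausdorff_leaves_neq0 : hausdorff_measure t (leaves (tree_root beta xi)) <> 0%E.
Proof.
move=> /(hausdorff_measure_eq0P _ t_gt0) cover.
(* The cover and the slacks of [cut_vertex] contribute at most [e] each, and [2 * e] is still below
   [eta * D0]. *)
have e0 : 0 < eta * D0 / 4%:R by rewrite divr_gt0// mulr_gt0.
set e := _ / _ in e0.
have [U [LU U1 Us]] := cover _ e0.
pose hit k := exists r z, [/\ is_ray r, ray_limit r z & U k z].
have /choice[v hv] : forall k, exists v, hit k ->
    (forall r z, is_ray r -> ray_limit r z -> U k z -> exists n, r n = v) /\
    ((D0 * relw i0 v `^ q)%:E <= poweR (diam (U k)) t + (e / (2 ^ k.+1)%:R)%:E)%E.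
  move=> k; have [hk|nh] := pselect (hit k); last by exists [::].
  have d0 : 0 < e / (2 ^ k.+1)%:R by rewrite divr_gt0// ltr0n expn_gt0.
  by have [v hv] := cut_vertex d0 hk; exists v.
have [|r rr avoid] := @ray_avoiding v (fun k => `[< hit k >]).
  rewrite -(@lte_pmul2l _ D0%:E)// -nneseriesZl; last first.
    by move=> k _; rewrite lee_fin powR_ge0.
  apply: (@le_lt_trans _ _ (\sum_(0 <= k <oo) (poweR (diam (U k)) t + (e / (2 ^ k.+1)%:R)%:E))%E).
    rewrite eseries_mkcond; apply: lee_nneseries => [k _ _|k _].
      by case: ifP => // _; rewrite mule_ge0// lee_fin ?powR_ge0// ltW.
    case: asboolP => hk; first by rewrite -EFinM; exact: (hv k hk).2.
    by rewrite adde_ge0 ?poweR_ge0// lee_fin divr_ge0// ltW.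
  apply: le_lt_trans (epsilon_trick _ _ _) _ => [k||]; [exact: poweR_ge0|exact: ltW|].
  apply: (@le_lt_trans _ _ (e%:E + e%:E)%E); first by rewrite leeD2r.
  rewrite -EFinD -EFinM lte_fin /e (mulrC D0).
  have : 0 < eta * D0 by rewrite mulr_gt0.
  lra.
have [z rz] := ray_cvg rr.
have [k _ Ukz] := LU z (ray_limit_leaf rr rz).
have hk : hit k by exists r, z.
have [n rn] := (hv k hk).1 _ _ rr rz Ukz.
by apply: (avoid k _ n rn); apply/asboolP.
Qed.

End lower_bound.

(** * Independence and moments of weights *)

Section independent_sigma_algebras.
Context {R : realType} {d d' : measure_display} {T : measurableType d}
  {T' : measurableType d'} {P : probability T R} {I : choiceType}.
Variable X : I -> {RV P >-> T'}.
Hypothesis indepX : mutually_independent X.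

Definition generators (S : set I) : set (set T) :=
  [set A | exists i B, [/\ S i, measurable B & A = X i @^-1` B]].

Definition rectangles (S : set I) : set (set T) :=
  [set A | exists (s : seq I) (B : I -> set T'),
    [/\ uniq s, [set` s] `<=` S, forall i, measurable (B i) &
        A = \bigcap_(i in [set` s]) (X i @^-1` B i)]].

(* The underlying type T with the sigma-algebra of the variables indexed by S. *)
Definition obs (S : set I) := g_sigma_algebraType (generators S).

Lemma generators_measurable S : generators S `<=` measurable.
Proof.
move=> _ [i [B [_ mB ->]]]; rewrite -[_ @^-1` _]setTI.
exact: (measurable_funP (X i)).
Qed.

Lemma obs_measurable S (A : set T) : <<s generators S >> A -> measurable A.
Proof.
apply: smallest_sub; last exact: generators_measurable.
exact: sigma_algebra_measurable.
Qed.

Lemma setI_closed_rectangles S : setI_closed (rectangles S).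
Proof.
move=> _ _ [s [B [us sS mB ->]]] [t [C [ut tS mC ->]]].
exists (undup (s ++ t)), (fun i => (if i \in s then B i else setT) `&`
  (if i \in t then C i else setT)); split.
- exact: undup_uniq.
- move=> i /=; rewrite mem_undup mem_cat => /orP[/sS|/tS]; exact.
- by move=> i; apply: measurableI; case: ifP.
- apply/seteqP; split=> w /=.
    move=> [h1 h2] i /= _; split.
      by case: ifP => // /h1.
    by case: ifP => // /h2.
  move=> h; split=> i /= si.
    by have := h i; rewrite /= mem_undup mem_cat si => /(_ isT)[].
  by have := h i; rewrite /= mem_undup mem_cat si orbT => /(_ isT)[_].
Qed.

Lemma generators_rectangles S : generators S `<=` <<s rectangles S >>.
Proof.
move=> _ [i [B [Si mB ->]]]; apply: sub_gen_smallest.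
exists [:: i], (fun=> B); split => //.
  by move=> j /=; rewrite inE => /eqP ->.
apply/seteqP; split=> w /=; first by move=> h j /=; rewrite inE => /eqP ->.
by apply => /=; rewrite inE.
Qed.

Lemma rectangles_measurable S : rectangles S `<=` measurable.
Proof.
move=> _ [s [B [_ _ mB ->]]].
rewrite bigcap_seq; apply: bigsetI_measurable => i _.
rewrite -[_ @^-1` _]setTI; exact: (measurable_funP (X i)).
Qed.

Lemma sigma_generators_rectangles S A : <<s generators S >> A -> <<d rectangles S >> A.
Proof.
rewrite (setI_closed_g_dynkin_g_sigma_algebra (@setI_closed_rectangles S)).
apply: smallest_sub; last exact: generators_rectangles.
exact: smallest_sigma_algebra.
Qed.

Lemma indep_rectangles S S' A B : S `&` S' = set0 ->
  rectangles S A -> rectangles S' B -> P (A `&` B) = (P A * P B)%E.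
Proof.
move=> SS' [s [C [us sS mC ->]]] [t [D [ut tS mD ->]]].
have st i : i \in s -> i \in t -> False.
  by move=> /sS ? /tS ?; suff : (S `&` S') i by rewrite SS'.
have ust : uniq (s ++ t).
  rewrite cat_uniq us ut andbT /=; apply/hasPn => i it; apply/negP => is_; exact: st it.
have mE i : measurable ((fun i => if i \in s then C i else D i) i) by case: ifP.
have := indepX ust mE.
rewrite big_cat /= [X in (X * _)%E]big_seq [X in (_ * X)%E]big_seq.
rewrite (eq_bigr (fun i => P (X i @^-1` C i))); last by move=> i /= ->.
rewrite [X in (_ * X)%E](eq_bigr (fun i => P (X i @^-1` D i))); last first.
  by move=> i /= it; case: ifPn => // is_; case: (st i is_ it).
rewrite -!big_seq -(indepX us mC) -(indepX ut mD) => <-.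
congr (P _); apply/seteqP; split=> w /=.
  move=> [h1 h2] i /=; rewrite mem_cat => /orP[is_|it]; first by rewrite is_; exact: h1.
  by case: ifPn => [/st/(_ it)//|_]; exact: h2.
move=> h; split=> i /= hi.
  by have := h i; rewrite /= mem_cat hi => /(_ isT).
have := h i; rewrite /= mem_cat hi orbT => /(_ isT).
by case: ifPn => // /st/(_ hi).
Qed.

Let dynkin_indep B : measurable B ->
  dynkin [set A | measurable A /\ P (A `&` B) = (P A * P B)%E].
Proof.
move=> mB; split.
- by split => //; rewrite setTI probability_setT mul1e.
- move=> A [mA h]; split; first exact: measurableC.
  have -> : ~` A `&` B = B `\` (A `&` B).
    by rewrite setDIr setDv setU0 setDE setIC.
  rewrite measureD//; last 2 first.
  + exact: measurableI.
  + by rewrite ltey_eq fin_num_measure.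
  rewrite (setIidr (@subIsetr _ A B)) [X in (_ - X)%E = _](_ : _ = (P A * P B)%E)//.
  rewrite probability_setC// muleBl ?mul1e//.
  + exact: fin_num_measure.
- move=> F tF hF; split; first by apply: bigcup_measurable => k _; have [] := hF k.
  rewrite setI_bigcupl measure_bigcup//; last 2 first.
  + by move=> k _; apply: measurableI => //; have [] := hF k.
  + by apply: trivIset_setIr.
  rewrite measure_bigcup//; last by move=> k _; have [] := hF k.
  rewrite -(fineK (fin_num_measure P B mB)) muleC -nneseriesZl//.
  apply: eq_eseriesr => k _; have [_ hk] := hF k.
  by rewrite fineK ?fin_num_measure// muleC -hk.
Qed.

(** Two rounds of the pi-lambda theorem. For two rectangles the claim is mutual independence over
    the concatenated index list; then each side in turn is extended to its sigma-algebra. *)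
Lemma indep_obs S S' A B : S `&` S' = set0 ->
  <<s generators S >> A -> <<s generators S' >> B -> P (A `&` B) = (P A * P B)%E.
Proof.
move=> SS' sA sB; have mA := obs_measurable sA; have mB := obs_measurable sB.
have h1 C : rectangles S' C -> P (A `&` C) = (P A * P C)%E.
  move=> rC; have mC := rectangles_measurable rC.
  have : <<d rectangles S >> `<=` [set A | measurable A /\ P (A `&` C) = (P A * P C)%E].
    apply: smallest_sub; first exact: dynkin_indep.
    move=> D rD; split; first exact: rectangles_measurable rD.
    exact: indep_rectangles rD rC.
  by move=> /(_ A (sigma_generators_rectangles sA))[].
have : <<d rectangles S' >> `<=` [set C | measurable C /\ P (C `&` A) = (P C * P A)%E].
  apply: smallest_sub; first exact: dynkin_indep.
  move=> D rD; split; first exact: rectangles_measurable rD.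
  by rewrite setIC h1// muleC.
by move=> /(_ B (sigma_generators_rectangles sB))[_]; rewrite setIC muleC.
Qed.

Lemma obs_measurable_fun d1 (Y : measurableType d1) S (f : T -> Y) :
  measurable_fun (setT : set (obs S)) (f : obs S -> Y) -> measurable_fun setT f.
Proof.
move=> mf _ B mB; apply: obs_measurable; exact: mf.
Qed.

Lemma obs_measurable_funS d1 (Y : measurableType d1) S S' (f : T -> Y) : S `<=` S' ->
  measurable_fun (setT : set (obs S)) (f : obs S -> Y) ->
  measurable_fun (setT : set (obs S')) (f : obs S' -> Y).
Proof.
move=> SS' mf _ B mB; have : <<s generators S >> (setT `&` f @^-1` B) by exact: mf.
apply: smallest_sub; first exact: smallest_sigma_algebra.
move=> _ [i [C [Si mC ->]]]; apply: sub_gen_smallest.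
by exists i, C; split => //; exact: SS'.
Qed.

Lemma obs_measurable_var S i : S i ->
  measurable_fun (setT : set (obs S)) (X i : obs S -> T').
Proof.
move=> Si _ B mB; rewrite setTI; apply: sub_gen_smallest; by exists i, B.
Qed.

Lemma integral_indepM S S' (f g : T -> R) : S `&` S' = set0 ->
  measurable_fun (setT : set (obs S)) (f : obs S -> R) ->
  measurable_fun (setT : set (obs S')) (g : obs S' -> R) ->
  (forall w, 0 <= f w) -> (forall w, 0 <= g w) ->
  (\int[P]_w (f w * g w)%:E = (\int[P]_w (f w)%:E) * \int[P]_w (g w)%:E)%E.
Proof.
move=> SS' of_ og f0 g0.
have mf := obs_measurable_fun of_; have mg := obs_measurable_fun og.
pose fm := isMeasurableFun.Build _ _ _ _ _ mf.
pose F : {RV P >-> R} := HB.pack f fm.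
pose gm := isMeasurableFun.Build _ _ _ _ _ mg.
pose G : {RV P >-> R} := HB.pack g gm.
have mfg : measurable_fun setT (fun w => (f w, g w)) by apply: measurable_fun_pair.
pose fgm := isMeasurableFun.Build _ _ _ _ _ mfg.
pose FG : {RV P >-> (R * R)%type} := HB.pack (fun w => (f w, g w)) fgm.
have prodE : forall C, measurable C ->
    (distribution P F \x distribution P G)%E C = distribution P FG C.
  apply: product_measure_unique => A B mA mB.
  apply: (indep_obs (A := f @^-1` A) (B := g @^-1` B) SS').
    by rewrite -[_ @^-1` _]setTI; exact: of_.
  by rewrite -[_ @^-1` _]setTI; exact: og.
(* Tonelli needs a nonnegative integrand on the whole plane, whereas [f] and [g] are known to be
   nonnegative only as functions on [T]. *)
pose h0 (z : R * R) : R := `|z.1| * `|z.2|.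
have mh0 : measurable_fun [set: (R * R)%type] h0.
  apply: measurable_funM; apply: measurableT_comp => //.
pose h := EFin \o h0.
have mh : measurable_fun [set: (R * R)%type] h by exact/measurable_EFinP.
have h_ge0 z : (0 <= h z)%E by rewrite lee_fin mulr_ge0.
transitivity (\int[distribution P FG]_z h z)%E.
  rewrite ge0_integral_distribution//; apply: eq_integral => w _ /=.
  by rewrite /h /h0 /= !ger0_norm.
transitivity (\int[distribution P F \x distribution P G]_z h z)%E.
  by apply: eq_measure_integral => C mC _; apply/esym; exact: prodE.
rewrite fubini_tonelli1//.
have mn : measurable_fun setT (fun y : R => (`|y|)%:E).
  by apply/measurable_EFinP; exact: normr_measurable.
transitivity (\int[distribution P F]_x ((`|x|)%:E * \int[distribution P G]_y (`|y|)%:E))%E.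
  by apply: eq_integral => u _; rewrite /fubini_F -ge0_integralZl.
rewrite ge0_integralZr//; last by apply: integral_ge0 => y _; rewrite lee_fin.
congr (_ * _)%E; rewrite ge0_integral_distribution//;
  by apply: eq_integral => w _ /=; rewrite ger0_norm.
Qed.

End independent_sigma_algebras.

Lemma mem_words N w : (w \in words N (size w)) = all (fun a => a < N)%N w.
Proof.
elim: w => [|a w IH]; first by rewrite /= inE.
apply/allpairsP/idP => [[[b v] /= [bN vw [ab wv]]]|/= /andP[aN aw]].
  subst b v; move: bN; rewrite mem_iota add0n /= => -> /=.
  by rewrite -IH.
exists (a, w); split => //=; first by rewrite mem_iota.
by rewrite IH.
Qed.

Lemma ler_sum_uniq (R : numDomainType) (T : eqType) (F : T -> R) (s t : seq T) :
  (forall w, 0 <= F w) -> uniq s -> {subset s <= t} ->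
  \sum_(w <- s) F w <= \sum_(w <- t) F w.
Proof.
move=> F0; elim: s t => [|w s IH] t; first by rewrite big_nil sumr_ge0.
move=> /= /andP[ws us] st.
have wt : w \in t by apply: st; rewrite mem_head.
rewrite big_cons (perm_big _ (perm_to_rem wt)) big_cons /= lerD2l; apply: IH => // v vs.
have := st v; rewrite inE vs orbT => /(_ isT); rewrite (perm_mem (perm_to_rem wt)) inE.
by case: (eqVneq v w) => [vw|]//=; rewrite -vw vs in ws.
Qed.

Lemma sum_words_prod (R : comRingType) (mu : nat -> R) N l :
  \sum_(w <- words N l) \prod_(a <- w) mu a = (\sum_(0 <= a < N) mu a) ^+ l.
Proof.
elim: l => [|l IH]; first by rewrite big_seq1 big_nil.
rewrite /= big_allpairs_dep exprS -IH mulr_suml /index_iota subn0; apply: eq_bigr => a _.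
by rewrite mulr_sumr; apply: eq_bigr => w _; rewrite big_cons.
Qed.

(** A partial sum involves finitely many letters and lengths; grouped by length it is dominated by
    the geometric series of [y * A], through [sum_words_prod]. *)
Lemma nneseries_words_le (R : realType) (mu : nat -> R) (y A : R) :
  (forall a, 0 <= mu a) -> 0 <= y -> 0 <= A -> y * A < 1 ->
  (forall n, \sum_(0 <= a < n) mu a <= A) ->
  (\sum_(0 <= k <oo) (y ^+ size (CodeSeq.decode k) *
     \prod_(a <- CodeSeq.decode k) mu a)%:E <= ((1 - y * A)^-1)%:E)%E.
Proof.
move=> mu0 y0 A0 yA muA.
pose F w := y ^+ size w * \prod_(a <- w) mu a.
have F0 w : 0 <= F w by rewrite mulr_ge0 ?exprn_ge0// prodr_ge0.
apply: lime_le; first by apply: is_cvg_nneseries => k _ _; rewrite lee_fin F0.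
apply: nearW => K; rewrite sumEFin lee_fin.
pose s := [seq CodeSeq.decode k | k <- index_iota 0 K].
rewrite -(big_map CodeSeq.decode xpredT F) -/s.
pose N := (\max_(w <- s) \max_(a <- w) a.+1)%N.
pose L := (\max_(w <- s) (size w).+1)%N.
have us : uniq s.
  by rewrite map_inj_uniq ?iota_uniq//; exact: can_inj CodeSeq.decodeK.
have sub : {subset s <= flatten [seq words N l | l <- iota 0 L]}.
  move=> w ws; apply/flatten_mapP; exists (size w).
    by rewrite mem_iota add0n /L; exact: (@leq_bigmax_seq _ s xpredT (fun w => (size w).+1) w ws isT).
  rewrite mem_words; apply/allP => a aw.
  apply: leq_trans (@leq_bigmax_seq _ s xpredT (fun w => \max_(a <- w) a.+1)%N w ws isT).
  exact: (@leq_bigmax_seq _ w xpredT succn a aw isT).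
apply: le_trans (ler_sum_uniq F0 us sub) _.
rewrite big_flatten big_map /=.
apply: (@le_trans _ _ (\sum_(0 <= l < L) (y * A) ^+ l)).
  rewrite /index_iota subn0; apply: ler_sum => l _.
  rewrite big_seq (eq_bigr (fun w => y ^+ l * \prod_(a <- w) mu a)); last first.
    by move=> w /size_words lw; rewrite /F lw.
  rewrite -big_seq -mulr_sumr sum_words_prod exprMn ler_wpM2l ?exprn_ge0//.
  by rewrite lerXn2r ?nnegrE ?sumr_ge0//; apply: muA.
have := geo_sum_le 0 L (mulr_ge0 y0 A0) yA; rewrite expr0 mul1r.
exact.
Qed.

Section block_measurability.
Context {R : realType}.

Lemma measurable_len : measurable_fun [set: block R] (@len R).
Proof. by rewrite /len; apply: measurableT_comp; exact: measurable_fst. Qed.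

Lemma measurable_coord j : measurable_fun [set: rseq R] (fun u : rseq R => u j : R).
Proof.
move=> _ B mB; rewrite setTI; apply: sub_gen_smallest; by exists j, B.
Qed.

Lemma measurable_wgt j : measurable_fun [set: block R] (fun b => wgt b j).
Proof.
apply: (@measurableT_comp _ _ _ _ _ _ (fun u : rseq R => u j : R)).
  exact: measurable_coord.
exact: measurable_snd.
Qed.

Lemma measurable_att j : measurable_fun [set: block R] (fun b => att b j).
Proof.
apply: (@measurableT_comp _ _ _ _ _ _ (fun u : rseq R => u j : R)).
  exact: measurable_coord.
by apply: (measurableT_comp measurable_snd); exact: measurable_fst.
Qed.

End block_measurability.

(** * Moments of the weights and almost sure summability *)

Section iid_blocks.
Context {R : realType} {d0 : measure_display} {T0 : measurableType d0}
  {P0 : probability T0 R} {xi0 : {RV P0 >-> block R}}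
  {d : measure_display} {T : measurableType d} {P : probability T R}
  {xi : seq nat -> {RV P >-> block R}}.
Hypothesis iid : iid_copies xi xi0.
Local Notation word := CodeSeq.decode.
Local Notation obs := (obs xi).

Lemma integral_block i (f : block R -> \bar R) :
  measurable_fun setT f -> (forall b, 0 <= f b)%E ->
  (\int[P]_w f (xi i w) = \int[P0]_w f (xi0 w))%E.
Proof.
move=> mf f0.
rewrite -(ge0_integral_distribution (xi i) mf f0) -(ge0_integral_distribution xi0 mf f0).
by apply: eq_measure_integral => A mA _; exact: iid.2.
Qed.

Definition tree_at (w : T) : seq nat -> block R := fun i => xi i w.

(* The blocks that determine cwgt i: those of the strict ancestors of i. *)
Definition ancestors (i : seq nat) : set (seq nat) :=
  [set v | suffix v i /\ v <> i].

Lemma obs_block d1 (Y : measurableType d1) S i (f : block R -> Y) : S i ->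
  measurable_fun setT f ->
  measurable_fun (setT : set (obs S)) (fun w : obs S => f (xi i w)).
Proof.
move=> Si mf; apply: (measurableT_comp mf); exact: obs_measurable_var.
Qed.

Lemma obs_cwgt i :
  measurable_fun (setT : set (obs (ancestors i))) (fun w : obs _ => cwgt (tree_at w) i).
Proof.
elim: i => [|a i IH] /=; first exact: measurable_cst.
have ia : i <> a :: i by move=> /(congr1 size)/= /eqP; rewrite ltn_eqF.
apply: measurable_funM.
  apply: obs_measurable_funS IH => v [vi nvi]; split; first exact: suffix_trans (suffix_cons _ _).
  move=> va; have := size_suffix vi; rewrite va /= ltnn//.
apply: (obs_block (f := fun b => wgt b a)); last exact: measurable_wgt.
by split => //; exact: suffix_cons.
Qed.

(** Siblings share a block, but along one line of descent every letter is read from a different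
    block. The absolute values dispense with the sign conditions, which hold only almost surely. *)
Lemma expectation_cwgt (q : R) i :
  (\int[P]_w (`|cwgt (tree_at w) i| `^ q)%:E =
   \prod_(a <- i) \int[P0]_w (`|wgt (xi0 w) a| `^ q)%:E)%E.
Proof.
elim: i => [|a i IH].
  rewrite big_nil /= normr1 powR1 integral_cst//=.
  by rewrite probability_setT mule1.
rewrite big_cons -IH muleC.
pose g (b : block R) := `|wgt b a| `^ q.
have mg : measurable_fun setT g.
  apply: (measurableT_comp (measurable_powR q)).
  by apply: measurableT_comp => //; exact: measurable_wgt.
rewrite -(integral_block i (f := fun b => (g b)%:E)); last 2 first.
- exact/measurable_EFinP.
- by move=> b; rewrite lee_fin powR_ge0.
rewrite -(integral_indepM (S := ancestors i) (S' := [set i]) iid.1).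
- by apply: eq_integral => w _ /=; rewrite normrM powRM.
- by apply/seteqP; split=> v //= [[_ ?] ?].
- apply: (measurableT_comp (measurable_powR q)).
  by apply: measurableT_comp => //; exact: obs_cwgt.
- exact: obs_block.
- by move=> w; exact: powR_ge0.
- by move=> w; exact: powR_ge0.
Qed.

Lemma expectation_cwgt_block (q : R) i (f : block R -> R) :
  measurable_fun setT f -> (forall b, 0 <= f b) ->
  (\int[P]_w (`|cwgt (tree_at w) i| `^ q * f (xi i w))%:E =
   (\prod_(a <- i) \int[P0]_w (`|wgt (xi0 w) a| `^ q)%:E) * \int[P0]_w (f (xi0 w))%:E)%E.
Proof.
move=> mf f0.
rewrite -expectation_cwgt -(integral_block i (f := fun b => (f b)%:E)); last 2 first.
- exact/measurable_EFinP.
- by move=> b; rewrite lee_fin.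
rewrite -(integral_indepM (S := ancestors i) (S' := [set i]) iid.1)//.
- by apply/seteqP; split=> v //= [[_ ?] ?].
- apply: (measurableT_comp (measurable_powR q)).
  by apply: measurableT_comp => //; exact: obs_cwgt.
- exact: obs_block.
Qed.

Lemma ae_summable (q y : R) (f : block R -> R) :
  measurable_fun setT f -> (forall b, 0 <= f b) -> 0 <= y ->
  (\int[P0]_w (f (xi0 w))%:E < +oo)%E ->
  (y%:E * \sum_(0 <= j <oo) \int[P0]_w (`|wgt (xi0 w) j| `^ q)%:E < 1)%E ->
  (\sum_(0 <= j <oo) \int[P0]_w (`|wgt (xi0 w) j| `^ q)%:E < +oo)%E ->
  {ae P, forall w, (\sum_(0 <= k <oo) (y ^+ size (word k) *
    (`|cwgt (tree_at w) (word k)| `^ q * f (xi (word k) w)))%:E < +oo)%E}.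
Proof.
move=> mf f0 y0 fy hy hs.
pose g k w := (y ^+ size (word k) *
    (`|cwgt (tree_at w) (word k)| `^ q * f (xi (word k) w)))%:E.
have g0 k w : (0 <= g k w)%E.
  by rewrite lee_fin mulr_ge0 ?exprn_ge0// mulr_ge0// powR_ge0.
have mfk k : measurable_fun setT (fun w => f (xi (word k) w)).
  exact: (measurableT_comp mf).
have mpk k : measurable_fun setT (fun w => `|cwgt (tree_at w) (word k)| `^ q).
  apply: (measurableT_comp (measurable_powR q)).
  by apply: measurableT_comp => //; exact: (obs_measurable_fun (@obs_cwgt (word k))).
have mg k : measurable_fun setT (g k).
  apply/measurable_EFinP; apply: measurable_funM; first exact: measurable_cst.
  exact: measurable_funM.
pose m j := (\int[P0]_w (`|wgt (xi0 w) j| `^ q)%:E)%E.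
have m0 j : (0 <= m j)%E by apply: integral_ge0 => w _; rewrite lee_fin powR_ge0.
have mfin j : m j \is a fin_num.
  rewrite ge0_fin_numE//; apply: (@le_lt_trans _ _ (\sum_(0 <= j <oo) m j)%E) => //.
  by rewrite (@nneseriesD1 _ m j xpredT)// leeDl// nneseries_ge0.
pose A := fine (\sum_(0 <= j <oo) m j).
have AE : (\sum_(0 <= j <oo) m j = A%:E)%E.
  by rewrite fineK// ge0_fin_numE// nneseries_ge0.
have A0 : 0 <= A by rewrite fine_ge0// nneseries_ge0.
have yA : y * A < 1 by rewrite -lte_fin EFinM -AE.
pose c := fine (\int[P0]_w (f (xi0 w))%:E).
have c0 : 0 <= c by rewrite fine_ge0// integral_ge0// => w _; rewrite lee_fin.
have cE : (\int[P0]_w (f (xi0 w))%:E = c%:E)%E.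
  by rewrite fineK// ge0_fin_numE// integral_ge0// => w _; rewrite lee_fin.
have Eg k : (\int[P]_w g k w = c%:E * (y ^+ size (word k) *
    \prod_(a <- word k) fine (m a))%:E)%E.
  rewrite /g; under eq_integral do rewrite EFinM.
  rewrite ge0_integralZl//; last 3 first.
  - by apply/measurable_EFinP; exact: measurable_funM.
  - by move=> w _; rewrite lee_fin mulr_ge0// powR_ge0.
  - by rewrite lee_fin exprn_ge0.
  rewrite expectation_cwgt_block// cE.
  have -> : (\prod_(a <- word k) m a = (\prod_(a <- word k) fine (m a))%:E)%E.
    elim: (word k) => [|a v IH]; first by rewrite !big_nil.
    by rewrite !big_cons EFinM IH fineK.
  by rewrite -!EFinM; congr EFin; ring.
have sumE : (\int[P]_w (\sum_(0 <= k <oo) g k w) < +oo)%E.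
  rewrite integral_nneseries//.
  under eq_eseriesr do rewrite Eg.
  rewrite nneseriesZl; last first.
    move=> k _; rewrite lee_fin mulr_ge0 ?exprn_ge0// prodr_ge0// => a _.
    by rewrite fine_ge0.
  apply: (@le_lt_trans _ _ (c%:E * ((1 - y * A)^-1)%:E)%E); last by rewrite -EFinM ltry.
  rewrite lee_wpmul2l//; apply: nneseries_words_le => // [a|n].
    by rewrite fine_ge0.
  rewrite -lee_fin -sumEFin -AE.
  under eq_bigr do rewrite fineK//.
  exact: nneseries_lim_ge.
have : P.-integrable setT (fun w => \sum_(0 <= k <oo) g k w)%E.
  apply/integrableP; split.
    by apply: ge0_emeasurable_sum.
  by under eq_integral do rewrite gee0_abs ?nneseries_ge0//.
move=> /(integrable_ae measurableT); apply: filterS => w /(_ Logic.I).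
by rewrite ge0_fin_numE// nneseries_ge0.
Qed.

End iid_blocks.

(** * Expected minimal cuts *)

(** The off-diagonal sum is [Y ^+ 2] minus the diagonal, which is at most [Y] since the terms are at
    most 1; and [Y <= 1 + Y ^+ 2 - Y] because [(Y - 1) ^+ 2 >= 0]. *)
Lemma sum_le_min1 (R : realDomainType) (J : eqType) (s : seq J) (y : J -> R) (Z : R) :
  uniq s -> (forall j, 0 <= y j <= 1) -> \sum_(j <- s) y j <= Z ->
  \sum_(j <- s) y j <=
    Num.min 1 Z + \sum_(j <- s) \sum_(k <- s | k != j) y j * y k.
Proof.
move=> us y01; set Y := \sum_(j <- s) y j => YZ.
have -> : \sum_(j <- s) \sum_(k <- s | k != j) y j * y k =
    Y ^+ 2 - \sum_(j <- s) y j ^+ 2.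
  rewrite /Y expr2 mulr_suml -sumrB big_seq [RHS]big_seq; apply: eq_bigr => j js.
  have -> : \sum_(k <- s | k != j) y j * y k = y j * (Y - y j).
    by rewrite -mulr_sumr /Y (bigD1_seq j)//= addrAC subrr add0r.
  by rewrite -/Y; ring.
have sq : \sum_(j <- s) y j ^+ 2 <= Y.
  apply: ler_sum => j _; have /andP[a b] := y01 j.
  by rewrite expr2 ler_piMl.
have sq2 : \sum_(j <- s) y j ^+ 2 <= Y ^+ 2.
  rewrite /Y expr2 mulr_suml big_seq [leRHS]big_seq; apply: ler_sum => j js.
  have /andP[a b] := y01 j; rewrite expr2 ler_wpM2l// (bigD1_seq j)//= lerDl.
  by apply: sumr_ge0 => k _; have /andP[] := y01 k.
have := sqr_ge0 (Y - 1); rewrite expr2 => h.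
case: (leP 1 Z) => hZ; last lra.
move: h; rewrite expr2 in sq2 *; lra.
Qed.

Section trunc_measurability.
Context {R : realType} (N : nat) (eps : R).

Lemma measurable_truncw j : measurable_fun [set: block R] (fun b => truncw N eps b j).
Proof.
apply: measurable_fun_ifT; last exact: measurable_cst.
  apply: measurable_and; first exact: measurable_cst.
  apply: measurable_and; first apply: measurable_and.
  - by apply: measurable_fun_ler; [exact: measurable_cst|exact: measurable_wgt].
  - by apply: measurable_fun_ler; [exact: measurable_wgt|exact: measurable_cst].
  - by apply: measurable_fun_ler; [exact: measurable_cst|exact: measurable_att].
exact: measurable_wgt.
Qed.

End trunc_measurability.

Section mincut_expectation.
Context {R : realType} {d0 : measure_display} {T0 : measurableType d0}
  {P0 : probability T0 R} {xi0 : {RV P0 >-> block R}}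
  {d : measure_display} {T : measurableType d} {P : probability T R}
  {xi : seq nat -> {RV P >-> block R}}.
Hypothesis iid : iid_copies xi xi0.
Variables (N m : nat) (eps q : R).
Hypotheses (eps_gt0 : 0 < eps) (q_gt0 : 0 < q).
Local Notation obs := (obs xi).
Local Notation tree_at := (@tree_at _ _ _ P xi).
Local Notation relw_at w v j := (relw N eps (tree_at w) v j).
Local Notation coef_at w v j := (coef N eps q (tree_at w) v j).
Local Notation mincut_at w n v := (mincut N m eps q (tree_at w) n v).

(** The words whose blocks decide the weights relative to [v] of all words of length at most [k].
    For [j] of length [k] they avoid [below (j ++ v)], whence the independence used below. *)
Definition near_below (v : seq nat) (k : nat) : set (seq nat) :=
  [set u | suffix v u /\ (size u < size v + k)%N].
Definition below (v : seq nat) : set (seq nat) := [set u | suffix v u].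

Lemma obs_relw v j k : (size j <= k)%N ->
  measurable_fun (setT : set (obs (near_below v k))) (fun w : obs _ => relw_at w v j).
Proof.
elim: j => [|a j IH] /= jk; first exact: measurable_cst.
apply: measurable_funM; first by apply: IH; exact: ltnW.
apply: (obs_block (f := fun b => truncw N eps b a)); last exact: measurable_truncw.
by split; [exact: suffix_suffix|rewrite size_cat addnC ltn_add2l].
Qed.

Lemma obs_coef v j k : (size j <= k)%N ->
  measurable_fun (setT : set (obs (near_below v k))) (fun w : obs _ => coef_at w v j).
Proof.
move=> jk; apply: measurable_fun_ifT; last exact: measurable_cst.
  by apply: measurable_fun_ler; [exact: obs_relw|exact: measurable_cst].
by apply: (measurableT_comp (measurable_powR q)); exact: obs_relw.
Qed.

Lemma obs_mincut n v :
  measurable_fun (setT : set (obs (below v))) (fun w : obs _ => mincut_at w n v).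
Proof.
elim: n v => [|n IH] v /=; first exact: measurable_cst.
apply: measurable_minr; first exact: measurable_cst.
(* The guard keeps [size j = m] available when measurability is proved term by term. *)
rewrite (_ : (fun w => _) = (fun w : obs (below v) =>
  \sum_(j <- words N m) (if j \in words N m then
     coef_at w v j * mincut_at w n (j ++ v) else 0))); last first.
  apply/funext => w; rewrite big_seq [RHS]big_seq; apply: eq_bigr => j ->//.
apply: measurable_sum => j.
have [/size_words jm|_] := boolP (j \in words N m); last exact: measurable_cst.
apply: measurable_funM.
  apply: (obs_measurable_funS (S := near_below v m)); first by move=> u [].
  by apply: obs_coef; rewrite jm.
apply: obs_measurable_funS (IH (j ++ v)) => u; apply: suffix_trans.
exact: suffix_suffix.
Qed.

Lemma expectation_relw (r : R) v j :
  (\int[P]_w (relw_at w v j `^ r)%:E =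
   \prod_(a <- j) \int[P0]_w (truncw N eps (xi0 w) a `^ r)%:E)%E.
Proof.
elim: j => [|a j IH].
  by rewrite big_nil /= powR1 integral_cst//= probability_setT mule1.
rewrite big_cons -IH muleC.
pose g (b : block R) := truncw N eps b a `^ r.
have mg : measurable_fun setT g.
  by apply: (measurableT_comp (measurable_powR r)); exact: measurable_truncw.
rewrite -(integral_block iid (j ++ v) (f := fun b => (g b)%:E)); last 2 first.
- exact/measurable_EFinP.
- by move=> b; rewrite lee_fin powR_ge0.
rewrite -(integral_indepM (S := near_below v (size j)) (S' := [set j ++ v]) iid.1).
- by apply: eq_integral => w _ /=; rewrite powRM ?relw_ge0 ?truncw_ge0.
- by apply/seteqP; split=> u //= [[_ h] ue]; move: h; rewrite ue size_cat addnC ltnn.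
- by apply: (measurableT_comp (measurable_powR r)); exact: obs_relw.
- exact: obs_block.
- by move=> w; exact: powR_ge0.
- by move=> w; exact: powR_ge0.
Qed.

Lemma coef_le1 w v j : coef_at w v j <= 1.
Proof.
rewrite /coef; case: ifP => // h.
have h1 : relw N eps (tree_at w) v j <= 1 by rewrite (le_trans h)// invf_le1// ler1n.
have := ge0_ler_powR (ltW q_gt0) (relw_ge0 N (tree_at w) eps_gt0 v j) (ler01 : 1 \is Num.nneg) h1.
by rewrite powR1.
Qed.

Let E (f : T -> R) : \bar R := (\int[P]_w (f w)%:E)%E.

Let mT S (f : T -> R) : measurable_fun (setT : set (obs S)) (f : obs S -> R) ->
  measurable_fun setT (fun w => (f w)%:E).
Proof. by move=> mf; apply/measurable_EFinP; exact: obs_measurable_fun mf. Qed.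

Let mc v j : measurable_fun setT (fun w => (coef_at w v j)%:E).
Proof. exact: (mT (@obs_coef v j (size j) (leqnn _))). Qed.

Let ms n v : measurable_fun setT (fun w => (mincut_at w n v)%:E).
Proof. exact: (mT (@obs_mincut n v)). Qed.

(** A Markov-type bound on what [coef] discards: where the relative weight [r] exceeds 1/2, the
    factor [(2 * r)^(p - q)] is at least 1, so [r^q] is at most [2^(p - q) * r^p]. The variable [p]
    will be instantiated with [p * beta]. *)
Lemma expectation_coef_ge (p A B : R) v : q <= p ->
  (\sum_(0 <= a < N) \int[P0]_w (truncw N eps (xi0 w) a `^ q)%:E = A%:E)%E ->
  (\sum_(0 <= a < N) \int[P0]_w (truncw N eps (xi0 w) a `^ p)%:E = B%:E)%E ->
  ((A ^+ m - 2 `^ (p - q) * B ^+ m)%:E <=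
   \sum_(j <- words N m) \int[P]_w (coef_at w v j)%:E)%E.
Proof.
move=> qp AE BE.
have sumE r C : (\sum_(0 <= a < N) \int[P0]_w (truncw N eps (xi0 w) a `^ r)%:E = C%:E)%E ->
    (\sum_(j <- words N m) \int[P]_w (relw_at w v j `^ r)%:E = (C ^+ m)%:E)%E.
  move=> CE; pose mu a := fine (\int[P0]_w (truncw N eps (xi0 w) a `^ r)%:E)%E.
  have muE a : (a < N)%N -> (\int[P0]_w (truncw N eps (xi0 w) a `^ r)%:E = (mu a)%:E)%E.
    move=> aN; rewrite fineK// ge0_fin_numE; last first.
      by apply: integral_ge0 => w _; rewrite lee_fin powR_ge0.
    apply: (@le_lt_trans _ _ C%:E); last exact: ltry.
    rewrite -CE big_mkord (bigD1 (Ordinal aN))//= leeDl// sume_ge0// => i _.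
    by apply: integral_ge0 => w _; rewrite lee_fin powR_ge0.
  have -> : C = \sum_(0 <= a < N) mu a.
    apply: EFin_inj; rewrite -CE -sumEFin big_nat [RHS]big_nat.
    by apply: eq_bigr => a /andP[_ aN]; exact: muE.
  rewrite -sum_words_prod -sumEFin big_seq [RHS]big_seq; apply: eq_bigr => j jw.
  rewrite expectation_relw; have : all (fun a => a < N)%N j.
    by rewrite -mem_words (size_words jw).
  elim: (j) => [|a u IH] /=; first by rewrite !big_nil.
  by move=> /andP[aN /IH]; rewrite !big_cons EFinM muE// => ->.
pose c := 2 `^ (p - q) : R.
have c0 : 0 <= c by exact: powR_ge0.
have mr r j : measurable_fun setT (fun w => (relw_at w v j `^ r)%:E).
  apply: (mT (S := near_below v (size j))).
  by apply: (measurableT_comp (measurable_powR r)); exact: obs_relw.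
have pt w j : relw_at w v j `^ q <= coef_at w v j + c * relw_at w v j `^ p.
  have r0 := relw_ge0 N (tree_at w) eps_gt0 v j.
  rewrite /coef; case: (leP (relw_at w v j) 2^-1) => h.
    by rewrite lerDl mulr_ge0// powR_ge0.
  have rp : 0 < relw N eps (tree_at w) v j by apply: lt_trans h; rewrite invr_gt0.
  have -> : relw N eps (tree_at w) v j `^ p = relw N eps (tree_at w) v j `^ (p - q) *
      relw N eps (tree_at w) v j `^ q.
    by rewrite -powRD ?subrK// (gt_eqF rp) implybT.
  rewrite add0r /c mulrA ler_peMl ?powR_ge0// -powRM//.
  have h1 : 1 <= 2 * relw N eps (tree_at w) v j by move: h => /ltW; lra.
  have pq : 0 <= p - q by rewrite subr_ge0.
  have := ge0_ler_powR pq (ler01 : 1 \is Num.nneg) (mulr_ge0 (ler0n _ 2) r0) h1.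
  by rewrite powR1.
have key : (\sum_(j <- words N m) \int[P]_w (relw_at w v j `^ q)%:E <=
  \sum_(j <- words N m) \int[P]_w (coef_at w v j)%:E +
  c%:E * \sum_(j <- words N m) \int[P]_w (relw_at w v j `^ p)%:E)%E.
  rewrite ge0_sume_distrr; last first.
    by move=> j _; apply: integral_ge0 => w _; rewrite lee_fin powR_ge0.
  rewrite -big_split; apply: lee_sum => j _ /=.
  rewrite -ge0_integralZl//; last first.
    by move=> w _; rewrite lee_fin powR_ge0.
  rewrite -ge0_integralD//; first last.
  - by apply: measurable_funeM; exact: mr.
  - by move=> w _; rewrite mule_ge0// lee_fin powR_ge0.
  - by move=> w _; rewrite lee_fin coef_ge0.
  apply: ge0_le_integral => //.
  - by move=> w _; rewrite lee_fin powR_ge0.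
  - by apply: emeasurable_funD => //; apply: measurable_funeM; exact: mr.
  - by move=> w _; rewrite -EFinM -EFinD lee_fin.
move: key; rewrite (sumE _ _ AE) (sumE _ _ BE) => key.
by rewrite EFinB leeBlDr// EFinM.
Qed.

Let E_fin (f : T -> R) : (forall w, 0 <= f w <= 1) -> measurable_fun setT (fun w => (f w)%:E) ->
  exists2 u, 0 <= u <= 1 & E f = u%:E.
Proof.
move=> f01 mf.
have E0 : (0 <= E f)%E by apply: integral_ge0 => w _; rewrite lee_fin; have /andP[] := f01 w.
have E1 : (E f <= 1)%E.
  rewrite -[leRHS]mule1 -[X in (_ * X)%E](@probability_setT _ _ _ P) -integral_cst//.
  apply: ge0_le_integral => //.
  - by move=> w _; rewrite lee_fin; have /andP[] := f01 w.
  - by move=> w _; rewrite lee_fin; have /andP[] := f01 w.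
move: E0 E1; rewrite /E; case: (\int[P]_w (f w)%:E)%E => [u|//|//].
by rewrite !lee_fin => u0 u1; exists u => //; rewrite u0.
Qed.

(** Induction on depth with [sum_le_min1]: the first moments add up to at least [2 * delta] and the
    pairs to at most [M * delta ^+ 2], with [M] the squared number of words, so [M * delta <= 1]
    leaves [delta]. *)
Lemma expectation_mincut_ge (delta : R) :
  (forall v, 2%:E <= \sum_(j <- words N m) \int[P]_w (coef_at w v j)%:E)%E ->
  0 < delta <= 1 -> (size (words N m))%:R ^+ 2 * delta <= 1 ->
  forall n v, (delta%:E <= \int[P]_w (mincut_at w n v)%:E)%E.
Proof.
move=> hc /andP[dl0 dl1] hJ; elim=> [|n IH] v.
  by rewrite /= integral_cst//= probability_setT mule1 lee_fin.
have m01 k u w : 0 <= mincut_at w k u <= 1 by rewrite mincut_ge0 mincut_le1.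
have /choice[u hu] : forall j, exists u, [/\ 0 <= u <= 1,
    E (fun w => mincut_at w n (j ++ v)) = u%:E & delta <= u].
  move=> j; have [u u01 uE] := E_fin (m01 n (j ++ v)) (@ms n (j ++ v)).
  by exists u; split => //; rewrite -lee_fin -uE; exact: IH.
have u_gt0 j : 0 < u j by have [_ _] := hu j; exact: lt_le_trans.
(* Scaling each [mincut] by [th j] makes all means equal to delta, so that
   [sum_le_min1] only involves first and second moments. *)
pose th j := delta / u j.
have th01 j : 0 <= th j <= 1.
  have [_ _ du] := hu j.
  by rewrite divr_ge0 ?(ltW dl0) ?(ltW (u_gt0 j))//= ler_pdivrMr// mul1r.
have th0 j : 0 <= th j by have /andP[] := th01 j.
have thu j : th j * u j = delta by rewrite divfK// gt_eqF.
pose s j w := th j * mincut_at w n (j ++ v).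
have s01 j w : 0 <= s j w <= 1.
  have /andP[a b] := th01 j; have /andP[a' b'] := m01 n (j ++ v) w.
  by rewrite mulr_ge0//= mulr_ile1.
have s0 j w : 0 <= s j w by have /andP[] := s01 j w.
have os j : measurable_fun (setT : set (obs (below (j ++ v)))) (s j : obs (below (j ++ v)) -> R).
  by apply: measurable_funM; [exact: measurable_cst|exact: obs_mincut].
have Es j : E (s j) = delta%:E.
  rewrite /E /s; under eq_integral do rewrite EFinM.
  rewrite ge0_integralZl ?lee_fin//; last by move=> w _; rewrite lee_fin mincut_ge0.
  by have [_ h _] := hu j; rewrite -/(E _) h -EFinM thu.
pose y w j := coef_at w v j * s j w.
have y01 w j : 0 <= y w j <= 1.
  have /andP[a b] := s01 j w.
  by rewrite mulr_ge0 ?coef_ge0//= mulr_ile1 ?coef_ge0 ?coef_le1.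
have y0 w j : 0 <= y w j by have /andP[] := y01 w j.
have my j : measurable_fun setT (fun w => y w j).
  apply: measurable_funM.
    exact: (obs_measurable_fun (@obs_coef v j (size j) (leqnn _))).
  exact: (obs_measurable_fun (os j)).
have disj j : size j = m -> near_below v m `&` below (j ++ v) = set0.
  move=> jm; apply/seteqP; split=> a //= [[_ h]] /size_suffix.
  by rewrite size_cat jm addnC leqNgt h.
have Ey j : size j = m -> E (y^~ j) = (E (fun w => coef_at w v j) * delta%:E)%E.
  move=> jm; rewrite /E /y (integral_indepM iid.1 (disj j jm))//.
  - by rewrite -/(E (s j)) Es.
  - by apply: obs_coef; rewrite jm.
  - by move=> w; exact: coef_ge0.
(* The two coefficients may depend on common blocks and are merely bounded by 1; [s j] and [s k]
   live on disjoint subtrees, independent of each other and of the coefficients. *)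
have Eyy j k : size j = m -> size k = m -> k != j ->
    (E (fun w => (y w j * y w k)%R) <= (delta ^+ 2)%:E)%E.
  move=> jm km kj.
  have -> : E (fun w => (y w j * y w k)%R) =
      E (fun w => (coef_at w v j * coef_at w v k) * (s j w * s k w)).
    by apply: eq_integral => w _; rewrite /y mulrACA.
  have jk : below (j ++ v) `&` below (k ++ v) = set0.
    apply/seteqP; split=> a //= [h1 h2].
    have := suffix_size_eq h1 h2; rewrite !size_cat jm km => /(_ erefl)/eqP.
    by rewrite eqseq_cat ?jm ?km// eqxx andbT eq_sym (negbTE kj).
  have Ess : E (fun w => (s j w * s k w)%R) = (delta * delta)%:E.
    by rewrite /E (integral_indepM iid.1 jk)// -/(E (s j)) -/(E (s k)) !Es.
  rewrite /E (integral_indepM (S := near_below v m)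
    (S' := below (j ++ v) `|` below (k ++ v)) iid.1).
  - rewrite -/(E (fun w => (s j w * s k w)%R)) Ess -/(E (fun w => (coef_at w v j * coef_at w v k)%R)).
    have [||c /andP[c0 c1] ->] := @E_fin (fun w => coef_at w v j * coef_at w v k).
    + by move=> w; rewrite mulr_ge0 ?coef_ge0//= mulr_ile1 ?coef_ge0 ?coef_le1.
    + apply: (mT (S := near_below v m)).
      by apply: measurable_funM; apply: obs_coef; rewrite ?jm ?km.
    by rewrite -!EFinM lee_fin expr2 ler_piMl// mulr_ge0// ltW.
  - by rewrite setIUr !disj// setU0.
  - by apply: measurable_funM; apply: obs_coef; rewrite ?jm ?km.
  - apply: measurable_funM.
      by apply: obs_measurable_funS (os j) => a; left.
    by apply: obs_measurable_funS (os k) => a; right.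
  - by move=> w; rewrite mulr_ge0 ?coef_ge0.
  - by move=> w; rewrite mulr_ge0.
have pt w : \sum_(j <- words N m) y w j <= mincut_at w n.+1 v +
    \sum_(j <- words N m) \sum_(k <- words N m | k != j) y w j * y w k.
  apply: sum_le_min1; [exact: uniq_words|exact: y01|].
  apply: ler_sum => j _; rewrite ler_wpM2l ?coef_ge0// /s.
  by rewrite ler_piMl ?mincut_ge0//; have /andP[] := th01 j.
have my2 j k : measurable_fun setT (fun w => (y w j * y w k)%R%:E).
  by apply/measurable_EFinP; exact: measurable_funM.
have my3 j : measurable_fun setT (fun w =>
    \sum_(k <- words N m | k != j) (y w j * y w k)%R%:E)%E.
  under eq_fun do rewrite big_mkcond/=.
  by apply: emeasurable_sum => k; case: (k != j).
have key : (\sum_(j <- words N m) E (y^~ j) <= E (fun w => mincut_at w n.+1 v) +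
    \sum_(j <- words N m) \sum_(k <- words N m | k != j) E (fun w => (y w j * y w k)%R))%E.
  have i1 : (\sum_(j <- words N m) E (y^~ j) =
      \int[P]_w (\sum_(j <- words N m) (y w j)%:E))%E.
    rewrite ge0_integral_sum//; first by move=> j; exact/measurable_EFinP.
    by move=> j w _; rewrite lee_fin.
  have i2 : (\sum_(j <- words N m) \sum_(k <- words N m | k != j) E (fun w => (y w j * y w k)%R) =
      \int[P]_w (\sum_(j <- words N m) \sum_(k <- words N m | k != j) (y w j * y w k)%R%:E))%E.
    rewrite ge0_integral_sum//.
    - apply: eq_bigr => j _; under [in RHS]eq_integral do rewrite big_mkcond/=.
      rewrite ge0_integral_sum//.
      + rewrite [LHS]big_mkcond; apply: eq_bigr => k _.
        by case: (k != j) => //=; rewrite integral0.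
      + by move=> k; case: (k != j).
      + by move=> k w _; case: ifP => // _; rewrite lee_fin mulr_ge0.
    - by move=> j w _; apply: sume_ge0 => k _; rewrite lee_fin mulr_ge0.
  rewrite i1 i2 -ge0_integralD//; last 3 first.
  - by move=> w _; rewrite lee_fin mincut_ge0.
  - move=> w _; apply: sume_ge0 => j _; apply: sume_ge0 => k _.
    by rewrite lee_fin mulr_ge0.
  - by apply: emeasurable_sum.
  apply: ge0_le_integral => //.
  - by move=> w _; apply: sume_ge0 => j _; rewrite lee_fin.
  - by apply: emeasurable_sum => j; exact/measurable_EFinP.
  - apply: emeasurable_funD => //.
    by apply: emeasurable_sum.
  - move=> w _; under [in leRHS]eq_bigr do rewrite sumEFin.
    by rewrite !sumEFin -EFinD lee_fin; exact: pt.
have [z z01 zE] := E_fin (m01 n.+1 v) (@ms n.+1 v).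
rewrite -/(E _) zE lee_fin; rewrite zE in key.
have low : ((2 * delta)%:E <= \sum_(j <- words N m) E (y^~ j))%E.
  rewrite big_seq (eq_bigr (fun j => E (fun w => coef_at w v j) * delta%:E)%E); last first.
    by move=> j /size_words; exact: Ey.
  rewrite -big_seq -ge0_sume_distrl; last first.
    by move=> j _; apply: integral_ge0 => w _; rewrite lee_fin coef_ge0.
  by rewrite EFinM; apply: lee_wpmul2r; [rewrite lee_fin ltW|exact: hc].
have up : (\sum_(j <- words N m) \sum_(k <- words N m | k != j) E (fun w => (y w j * y w k)%R) <=
    ((size (words N m))%:R ^+ 2 * delta ^+ 2)%:E)%E.
  apply: (@le_trans _ _ (\sum_(j <- words N m) \sum_(k <- words N m) (delta ^+ 2)%:E)%E).
    rewrite big_seq [leRHS]big_seq; apply: lee_sum => j /size_words jm.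
    rewrite big_mkcond big_seq [leRHS]big_seq; apply: lee_sum => k /size_words km.
    case: ifP => kj; first exact: Eyy.
    by rewrite lee_fin exprn_ge0// ltW.
  rewrite !sumEFin lee_fin.
  by rewrite !big_const_seq !count_predT !iter_addr_0 expr2 -mulrA !mulr_natl.
have := le_trans low (le_trans key (leeD2l z%:E up)); rewrite -EFinD lee_fin => h.
have : (size (words N m))%:R ^+ 2 * delta ^+ 2 <= delta.
  by rewrite [X in _ * X]expr2 mulrA ler_piMl// ltW.
lra.
Qed.

Definition survives (c : R) (v : seq nat) : set T :=
  \bigcap_n [set w | c <= mincut_at w n v].

Lemma obs_survives c v : <<s generators xi (below v) >> (survives c v).
Proof.
have : measurable (survives c v : set (obs (below v))).
  apply: bigcapT_measurable => n.
  have : measurable_fun (setT : set (obs (below v))) (fun w : obs _ => c <= mincut_at w n v).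
    by apply: measurable_fun_ler; [exact: measurable_cst|exact: obs_mincut].
  move=> /(_ measurableT [set true]); rewrite setTI; exact.
by [].
Qed.

(** Since [mincut] is at most 1, a mean of [delta] forces values of at least [delta / 2] with
    probability at least [delta / 2]; these events decrease with the depth. *)
Lemma probability_survives (delta : R) v : 0 < delta ->
  (forall n, delta%:E <= \int[P]_w (mincut_at w n v)%:E)%E ->
  ((delta / 2)%:E <= P (survives (delta / 2) v))%E.
Proof.
move=> dl0 hE; pose F n := [set w | delta / 2 <= mincut_at w n v].
have mF n : measurable (F n).
  have : measurable_fun setT (fun w => delta / 2 <= mincut_at w n v).
    apply: measurable_fun_ler; [exact: measurable_cst|].
    exact: (obs_measurable_fun (@obs_mincut n v)).
  by move=> /(_ measurableT [set true]); rewrite setTI; exact.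
have PF n : ((delta / 2)%:E <= P (F n))%E.
  have : (\int[P]_w (mincut_at w n v)%:E <= \int[P]_w ((\1_(F n) w)%:E + (delta / 2)%:E))%E.
    have d20 : 0 <= delta / 2 by rewrite divr_ge0// ltW.
    apply: ge0_le_integral => //.
    - by move=> w _; rewrite lee_fin mincut_ge0.
    - by apply: emeasurable_funD => //; apply/measurable_EFinP; exact: measurable_indic.
    - move=> w _; rewrite -EFinD lee_fin indicE.
      have [wF|wF] := boolP (w \in F n).
        by rewrite (le_trans (mincut_le1 _ _ _ _ _ _ _))// lerDl.
      rewrite add0r ltW//; rewrite notin_setE /F /= in wF.
      by rewrite ltNge; apply/negP.
  rewrite ge0_integralD//; last 2 first.
  - by apply/measurable_EFinP; exact: measurable_indic.
  - by move=> w _; rewrite lee_fin divr_ge0// ltW.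
  rewrite integral_indic// setIT integral_cst//= probability_setT mule1 => h.
  have := le_trans (hE n) h; rewrite -leeBlDr// -EFinB.
  by apply: le_trans; rewrite lee_fin; lra.
have cvg : P (F n) @[n --> \oo] --> P (survives (delta / 2) v).
  apply: nonincreasing_cvg_mu => //.
  - by rewrite ltey_eq fin_num_measure.
  - exact: bigcapT_measurable.
  - move=> n k nk; apply/subsetPset => w; rewrite /F /= => h; apply: le_trans h _.
    exact: mincut_decr.
rewrite -(cvg_lim _ cvg)//; apply: lime_ge; first exact: (cvgP _ cvg).
exact: nearW.
Qed.

End mincut_expectation.

(** * Non-extinction *)

Section zero_one.
Context {R : realType} {d0 : measure_display} {T0 : measurableType d0}
  {P0 : probability T0 R} {xi0 : {RV P0 >-> block R}}
  {d : measure_display} {T : measurableType d} {P : probability T R}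
  {xi : seq nat -> {RV P >-> block R}}.
Hypothesis iid : iid_copies xi xi0.
Local Notation word := CodeSeq.decode.
Local Notation sigma S := <<s generators xi S >>.
Local Notation tree_at := (@tree_at _ _ _ P xi).

Definition level_lt (n : nat) : set (seq nat) := [set v | (size v < n)%N].

Lemma sigmaS S S' A : S `<=` S' -> sigma S A -> sigma S' A.
Proof.
move=> SS'; apply: smallest_sub; first exact: smallest_sigma_algebra.
move=> _ [i [C [Si mC ->]]]; apply: sub_gen_smallest.
by exists i, C; split => //; exact: SS'.
Qed.

Let sigma_mE S (A : set T) : sigma S A = measurable (A : set (obs xi S)).
Proof. by []. Qed.

Let approx (A : set T) := forall e : R, 0 < e ->
  exists n C, sigma (level_lt n) C /\ (P ((A `\` C) `|` (C `\` A)) <= e%:E)%E.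

Let mC n C : sigma (level_lt n) C -> measurable C.
Proof. exact: obs_measurable. Qed.

Let msd (A B : set T) : measurable A -> measurable B -> measurable ((A `\` B) `|` (B `\` A)).
Proof. by move=> mA mB; apply: measurableU; exact: measurableD. Qed.

(** By continuity of the measure a finite union suffices, and the finitely many approximating events
    share a common last generation. *)
Let approx_bigcup (A : nat -> set T) : (forall k, measurable (A k)) ->
  (forall k, approx (A k)) -> approx (\bigcup_k A k).
Proof.
move=> mA apA e e0.
have mUA : measurable (\bigcup_k A k) by exact: bigcup_measurable.
pose B n := \big[setU/set0]_(k < n) A k.
have mB n : measurable (B n) by exact: bigsetU_measurable.
have [N hN] : exists N, (P ((\bigcup_k A k) `\` B N) <= (e / 2)%:E)%E.
  have e20 : 0 < e / 2 by rewrite divr_gt0.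
  have := bigcup_bigsetU_bigcup A; rewrite -/B => BE.
  have cvgB : P (B n.+1) @[n --> \oo] --> P (\bigcup_k A k).
    rewrite -BE; apply: nondecreasing_cvg_mu => //.
      by rewrite BE.
    move=> a b ab; exact/subsetPset/subset_bigsetU.
  have : fine (P (B n.+1)) @[n --> \oo] --> fine (P (\bigcup_k A k)).
    by apply: fine_cvg; rewrite fineK// fin_num_measure.
  move=> /cvgrPdist_le/(_ _ e20)[n _ /(_ n (leqnn n))] /= h; exists n.+1.
  have sub : B n.+1 `<=` \bigcup_k A k by rewrite -BE => w ?; exists n.
  rewrite measureD//; last by rewrite ltey_eq fin_num_measure.
  rewrite (setIidr sub) -(fineK (fin_num_measure P _ mUA)).
  rewrite -(fineK (fin_num_measure P _ (mB n.+1))) -EFinB lee_fin.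
  exact: le_trans (ler_norm _) h.
(* Half of [e] pays for the sets dropped from the union, the rest is shared by the [N] sets kept;
   [N.+1] because [N] may be 0. *)
have eN : 0 < e / 2 / N.+1%:R by rewrite !divr_gt0.
have /choice[nC hC] : forall k, exists nC : nat * set T, sigma (level_lt nC.1) nC.2 /\
    (P ((A k `\` nC.2) `|` (nC.2 `\` A k)) <= (e / 2 / N.+1%:R)%:E)%E.
  by move=> k; have [n [C hC]] := apA k _ eN; exists (n, C).
pose M := (\max_(k < N) (nC k).1)%N.
have sC (k : 'I_N) : sigma (level_lt M) (nC k).2.
  apply: sigmaS (hC k).1 => v /= h; apply: leq_trans h _.
  exact: (@leq_bigmax _ (fun k : 'I_N => (nC k).1)).
exists M, (\big[setU/set0]_(k < N) (nC k).2); split.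
  rewrite sigma_mE; apply: bigsetU_measurable => k _; exact: sC.
set C := \big[setU/set0]_(k < N) (nC k).2.
have mCC : measurable C by apply: bigsetU_measurable => k _; exact: mC (sC k).
pose D k := (A k `\` (nC k).2) `|` ((nC k).2 `\` A k).
have mD k : measurable (D k).
  by apply: msd => //; exact: mC (hC k).1.
have sub : ((\bigcup_k A k) `\` C) `|` (C `\` (\bigcup_k A k)) `<=`
    ((\bigcup_k A k) `\` B N) `|` \big[setU/set0]_(k < N) D k.
  rewrite /C /B -(bigcup_mkord N (fun k => (nC k).2)) -(bigcup_mkord N A) -(bigcup_mkord N D).
  move=> w [[[k _ Ak] nC_]|[[k /= kN Ck] nA]].
    have [[j /= jN Aj]|nB] := pselect ((\bigcup_(i in `I_N) A i) w).
      right; exists j => //; left; split => // Cj; apply: nC_; by exists j.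
    by left; split => //; exists k.
  by right; exists k => //; right; split => // Ak; apply: nA; exists k.
apply: (@le_trans _ _ (P (((\bigcup_k A k) `\` B N) `|` \big[setU/set0]_(k < N) D k))).
  apply: le_measure => //; rewrite inE.
  - exact: msd.
  - apply: measurableU; first exact: measurableD.
    by apply: bigsetU_measurable => k _.
apply: (le_trans (measureU2 P _ _)); [exact: measurableD|exact: bigsetU_measurable|].
apply: (@le_trans _ _ ((e / 2)%:E + (e / 2)%:E)%E); last first.
  by rewrite -EFinD lee_fin -splitr.
apply: leeD => //.
apply: (le_trans (Boole_inequality P _)) => //.
apply: (@le_trans _ _ (\sum_(k < N) (e / 2 / N.+1%:R)%:E)%E).
  by apply: lee_sum => k _; exact: (hC k).2.
rewrite sumEFin lee_fin sumr_const card_ord -[leLHS]mulr_natr mulrAC -mulrA.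
rewrite ler_piMr//; first by rewrite divr_ge0// ltW.
by rewrite ler_pdivrMr// mul1r ler_nat.
Qed.

Let approxP (A : set T) : sigma setT A -> approx A.
Proof.
move=> sA; suff : sigma setT `<=` [set A | measurable A /\ approx A].
  by move=> /(_ A sA)[].
apply: smallest_sub; first split.
- split => // e e0; exists 0%N, set0; split; first by rewrite sigma_mE.
  by rewrite !setD0 setU0 measure0 lee_fin ltW.
- move=> B [mB apB]; rewrite setTD; split; first exact: measurableC.
  move=> e /apB[n [C [sC hC]]]; exists n, (~` C); split.
    by rewrite sigma_mE; apply: measurableC.
  rewrite !setDE !setCK setUC; apply: le_trans hC.
  by rewrite !setDE [B `&` _]setIC [C `&` _]setIC setUC.
- move=> F hF; split; first by apply: bigcup_measurable => k _; have [] := hF k.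
  by apply: approx_bigcup => k; have [] := hF k.
- move=> _ [i [B [_ mB ->]]]; split.
    by rewrite -[_ @^-1` _]setTI; exact: (measurable_funP (xi i)).
  move=> e e0; exists (size i).+1, (xi i @^-1` B); split.
    by apply: sub_gen_smallest; exists i, B; split => //; exact: ltnSn.
  by rewrite !setDv setU0 measure0 lee_fin ltW.
Qed.

Definition alive (i : seq nat) : set T := [set w | cwgt (tree_at w) i <> 0].

Let sigma_alive i : sigma (level_lt (size i)) (alive i).
Proof.
apply: (@sigmaS (ancestors i)).
  move=> v [vi nvi]; rewrite /level_lt /= ltn_neqAle size_suffix// andbT.
  by apply/eqP => sv; apply: nvi; apply: (suffix_size_eq vi) => //; exact: suffix_refl.
have mf := @obs_cwgt _ _ _ P xi i.
rewrite (_ : alive i = ~` [set w | cwgt (tree_at w) i = 0])//.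
apply: (@measurableC _ (obs xi (ancestors i))).
have := mf measurableT [set 0] (measurable_set1 0); rewrite setTI; exact.
Qed.

Variables (G : seq nat -> set T) (eta : R).
Hypothesis sigma_G : forall i, sigma (below i) (G i).
Hypothesis eta_gt0 : 0 < eta.
Hypothesis PG : forall i, (eta%:E <= P (G i))%E.

Definition alive_at n : set T := \bigcup_(i in [set i | size i = n]) alive i.
Definition never : set T := \bigcap_i (~` (alive i `&` G i)).

Let mG i : measurable (G i). Proof. exact: (obs_measurable (@sigma_G i)). Qed.
Let mal i : measurable (alive i). Proof. exact: (mC (@sigma_alive i)). Qed.

(** [seqDU (A n) k] is then the event that [word k] is the first living individual of generation [n]
    in the order of the codes. *)
Let A n k := if size (word k) == n then alive (word k) else set0.

Let alive_atE n : alive_at n = \bigcup_k seqDU (A n) k.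
Proof.
rewrite -seqDU_bigcup_eq; apply/seteqP; split=> [w [i /= si wi]|w [k _]].
  by exists (CodeSeq.code i) => //; rewrite /A CodeSeq.codeK si eqxx.
by rewrite /A; case: eqP => // sk wk; exists (word k).
Qed.

Let sigma_A n k : sigma (level_lt n) (A n k).
Proof.
rewrite /A; case: eqP => [<-|_]; first exact: sigma_alive.
by rewrite sigma_mE.
Qed.

Let sigma_seqDU n k : sigma (level_lt n) (seqDU (A n) k).
Proof.
rewrite sigma_mE; apply: measurableD; first exact: sigma_A.
by apply: bigsetU_measurable => j _; exact: sigma_A.
Qed.

Let sigma_alive_at n : sigma (level_lt n) (alive_at n).
Proof.
rewrite alive_atE sigma_mE; apply: bigcup_measurable => k _; exact: sigma_seqDU.
Qed.

Let sigma_never : sigma setT never.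
Proof.
rewrite (_ : never = \bigcap_k (~` (alive (word k) `&` G (word k)))).
  rewrite sigma_mE; apply: bigcapT_measurable => k; apply: measurableC; apply: measurableI.
    by apply: sigmaS (@sigma_alive _).
  by apply: sigmaS (@sigma_G _).
apply/seteqP; split=> [w h k _|w h i _]; first exact: h.
by rewrite -(CodeSeq.codeK i); apply: h.
Qed.

Let mnever : measurable never. Proof. exact: (obs_measurable sigma_never). Qed.

(* Given the first n generations, the first individual alive in generation n
   is good with probability at least eta. *)
Let step n C : sigma (level_lt n) C ->
  (P (never `&` C `&` alive_at n) <= (1 - eta)%:E * P (C `&` alive_at n))%E.
Proof.
move=> sC; have mCC := mC sC.
pose D k := C `&` seqDU (A n) k.
have sD k : sigma (level_lt n) (D k).
  by rewrite sigma_mE; apply: measurableI; [exact: sC|exact: sigma_seqDU].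
have mD k : measurable (D k) := mC (sD k).
have tD : trivIset setT D.
  by apply: trivIset_setIl; exact: trivIset_seqDU.
have DE : C `&` alive_at n = \bigcup_k D k by rewrite alive_atE setI_bigcupr.
pose E k := D k `\` G (word k).
have mE k : measurable (E k) by exact: measurableD.
have sub : never `&` C `&` alive_at n `<=` \bigcup_k E k.
  rewrite -setIA DE => w [nw [k _ Dk]]; exists k => //; split => // Gk.
  apply: (nw (word k) Logic.I); split => //.
  by move: Dk => [_ [+ _]]; rewrite /A; case: ifP.
have mat : measurable (alive_at n) := mC (@sigma_alive_at n).
apply: (@le_trans _ _ (\sum_(0 <= k <oo) P (E k))%E).
  apply: measure_sigma_subadditive => //.
  by apply: measurableI => //; exact: measurableI.
have -> : (P (C `&` alive_at n) = \sum_(0 <= k <oo) P (D k))%E.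
  by rewrite DE measure_bigcup//; apply: eq_eseriesl => k; rewrite in_setT.
rewrite -nneseriesZl//.
apply: lee_nneseries => [k _ _|k _]; first exact: measure_ge0.
have [kn|kn] := eqVneq (size (word k)) n; last first.
  have D0 : D k = set0.
    by rewrite /D /seqDU /A (negbTE kn) set0D setI0.
  by rewrite /E D0 set0D measure0 mule0.
(* Life in generation [n] is decided by the earlier blocks, [G (word k)] by the block of [word k]
   and those of its descendants. *)
have disj : level_lt n `&` below (word k) = set0.
  apply/seteqP; split=> v //= [h /size_suffix]; rewrite kn leqNgt.
  by rewrite h.
rewrite /E setDE (indep_obs iid.1 disj (sD k)); last first.
  by rewrite sigma_mE; apply: measurableC; exact: sigma_G.
rewrite probability_setC// muleC; apply: lee_wpmul2r => //.
by rewrite EFinB leeB.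
Qed.

Lemma ae_alive_good :
  {ae P, forall w, (forall n, alive_at n w) -> exists i, alive i w /\ G i w}.
Proof.
set BS := never `&` \bigcap_n alive_at n; suff : P.-negligible BS.
  apply: negligibleS => w /= /not_implyP[aw /forallNP nw].
  by split=> [i _|n _]; [exact: nw|exact: aw].
have sBS : sigma setT BS.
  rewrite sigma_mE; apply: measurableI => //; apply: bigcapT_measurable => n.
  by apply: sigmaS (@sigma_alive_at n).
have mBS : measurable BS := obs_measurable sBS.
suff : P BS = 0%E by move=> h; exact/negligibleP.
have eta1 : eta <= 1.
  by rewrite -lee_fin (le_trans (PG [::]))// probability_le1.
pose x := fine (P BS).
have xE : P BS = x%:E by rewrite fineK// fin_num_measure.
have x0 : 0 <= x by rewrite fine_ge0.
suff : x <= 0 by move=> h; rewrite xE; congr EFin; lra.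
apply/ler_addgt0Pr => e e0; rewrite add0r.
(* With [x] the probability of failure, the estimates give [x <= (1 - eta) * (x + e') + e'], hence
   [eta * x <= 2 * e'], which is [eta * e]. *)
have e'0 : 0 < e * eta / 2 by rewrite divr_gt0// mulr_gt0.
set e' := _ / 2 in e'0.
have [n [C [sC hC]]] := approxP sBS e'0.
have mCC := mC sC; have mat : measurable (alive_at n) := mC (@sigma_alive_at n).
have mCd : measurable (C `\` BS) by exact: measurableD.
have mBd : measurable (BS `\` C) by exact: measurableD.
have h1 : (P BS <= P (never `&` C `&` alive_at n) + P (BS `\` C))%E.
  apply: (le_trans _ (measureU2 P _ _)) => //; last by apply: measurableI => //; exact: measurableI.
  apply: le_measure; rewrite ?inE//.
    by apply: measurableU => //; apply: measurableI => //; exact: measurableI.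
  move=> w BSw; have [nw aw] := BSw.
  have [Cw|nCw] := pselect (C w); last by right.
  by left; split => //; exact: aw.
have h2 : (P (BS `\` C) <= e'%:E)%E.
  by apply: le_trans hC; apply: le_measure; rewrite ?inE//; exact: measurableU.
have h3 : (P (C `&` alive_at n) <= P BS + e'%:E)%E.
  apply: (@le_trans _ _ (P (BS `|` (C `\` BS)))).
    apply: le_measure; rewrite ?inE//; [exact: measurableI|exact: measurableU|].
    move=> w [Cw _]; have [Bw|nBw] := pselect (BS w); [by left|by right].
  apply: (le_trans (measureU2 P _ _)) => //; rewrite leeD2l//.
  by apply: le_trans hC; apply: le_measure; rewrite ?inE//; exact: measurableU.
have h4 : (P BS <= (1 - eta)%:E * (P BS + e'%:E) + e'%:E)%E.
  apply: le_trans h1 _; apply: leeD => //; apply: le_trans (step sC) _.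
  by apply: lee_wpmul2l => //; rewrite lee_fin subr_ge0.
move: h4; rewrite xE -EFinD lee_fin => h4.
have h5 : eta * x <= 2 * e' by have := mulr_ge0 (ltW eta_gt0) (ltW e'0); lra.
have h6 : 2 * e' = eta * e by rewrite /e'; field.
by rewrite h6 ler_pM2l in h5.
Qed.

End zero_one.

(** * The exponent qstar *)

(** Young's inequality with the conjugate exponents [1 / l] and [1 / (1 - l)]. *)
Lemma powR_interpolate (R : realType) (x a b l : R) : 0 <= x -> 0 < a -> 0 < b ->
  0 < l < 1 -> x `^ (l * a + (1 - l) * b) <= l * x `^ a + (1 - l) * x `^ b.
Proof.
move=> x0 a0 b0 /andP[l0 l1].
have l10 : 0 < 1 - l by rewrite subr_gt0.
have := @conjugate_powR R (x `^ (l * a)) (x `^ ((1 - l) * b)) l^-1 (1 - l)^-1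
  (powR_ge0 _ _) (powR_ge0 _ _).
rewrite !invr_gt0 !invrK => /(_ l0 l10); rewrite addrC subrK => /(_ erefl).
rewrite -!powRrM mulrAC divff ?gt_eqF// mul1r mulrAC divff ?gt_eqF// mul1r.
rewrite -powRD; first by rewrite ![_ `^ _ * _]mulrC.
by rewrite gt_eqF// addr_gt0// mulr_gt0.
Qed.

Section moments.
Context {R : realType} {d0 : measure_display} {T0 : measurableType d0}
  {P0 : probability T0 R} {xi0 : {RV P0 >-> block R}}.
Variables (beta p : R).
Hypotheses (beta_gt0 : 0 < beta) (p_ge1 : 1 <= p).
Hypothesis hP : {ae P0, forall w, forall j : nat,
  0 <= wgt (xi0 w) j.+1 <= wgt (xi0 w) j}.
Hypothesis hPp :
  (\int[P0]_w (\sum_(0 <= j <oo) ((wgt (xi0 w) j `^ (p * beta))%R)%:E) < 1)%E.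
Hypothesis hXpos : {ae P0, forall w, forall j : nat,
  0 < wgt (xi0 w) j -> 0 < att (xi0 w) j}.

Definition moment (q : R) (j : nat) : \bar R := (\int[P0]_w (`|wgt (xi0 w) j| `^ q)%:E)%E.
Definition Phi (q : R) : \bar R := (\sum_(0 <= j <oo) moment q j)%E.

Lemma moment_ge0 q j : (0 <= moment q j)%E.
Proof. by apply: integral_ge0 => w _; rewrite lee_fin powR_ge0. Qed.

Let p_gt0 : 0 < p. Proof. exact: lt_le_trans p_ge1. Qed.
Let pb_gt0 : 0 < p * beta. Proof. exact: mulr_gt0. Qed.

Let mw j : measurable_fun setT (fun w => wgt (xi0 w) j).
Proof. by apply: (measurableT_comp (measurable_wgt j)). Qed.

Let mwq q j : measurable_fun setT (fun w => (`|wgt (xi0 w) j| `^ q)%:E).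
Proof.
apply/measurable_EFinP; apply: (measurableT_comp (measurable_powR q)).
exact: measurableT_comp.
Qed.

Lemma ae_wgt_ge0 : {ae P0, forall w, forall j, 0 <= wgt (xi0 w) j}.
Proof.
apply: filterS hP => w h j; have /andP[h1 h2] := h j.
exact: le_trans h2.
Qed.

Lemma PhiE q : (\int[P0]_w (\sum_(0 <= j <oo) (`|wgt (xi0 w) j| `^ q)%:E) = Phi q)%E.
Proof.
by rewrite integral_nneseries// => j w _; rewrite lee_fin powR_ge0.
Qed.

Lemma phi_Phi q : 0 < q -> phi xi0 q = Phi q.
Proof.
move=> q0; rewrite /phi -PhiE.
pose g j w := (if 0 < wgt (xi0 w) j then wgt (xi0 w) j `^ q else 0)%:E.
have mg j : measurable_fun setT (g j).
  apply/measurable_EFinP; apply: measurable_fun_ifT; last exact: measurable_cst.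
    by apply: measurable_fun_ltr; [exact: measurable_cst|exact: mw].
  by apply: (measurableT_comp (measurable_powR q)).
have g0 j w : (0 <= g j w)%E by rewrite /g; case: ifP => // _; rewrite lee_fin powR_ge0.
have gE w : (\sum_(0 <= j <oo | (0 < wgt (xi0 w) j)%R) (wgt (xi0 w) j `^ q)%:E =
    \sum_(0 <= j <oo) g j w)%E.
  by rewrite eseries_mkcond; apply: eq_eseriesr => j _; rewrite /g; case: ifP.
under eq_integral do rewrite gE.
apply: ge0_ae_eq_integral => //.
- exact: ge0_emeasurable_sum.
- by apply: ge0_emeasurable_sum => // j w _; rewrite lee_fin powR_ge0.
- by move=> w _; exact: nneseries_ge0.
- by move=> w _; apply: nneseries_ge0 => j _ _; rewrite lee_fin powR_ge0.
- apply: filterS ae_wgt_ge0 => w h _; apply: eq_eseriesr => j _; rewrite /g.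
  rewrite ger0_norm//; case: ifPn => //; rewrite -leNgt => w0.
  have -> : wgt (xi0 w) j = 0 by apply: le_anti; rewrite w0 h.
  by rewrite powR0 ?gt_eqF.
Qed.

Lemma Phi_lt1 : (Phi (p * beta) < 1)%E.
Proof.
apply: le_lt_trans hPp; rewrite -PhiE le_eqVlt; apply/orP; left; apply/eqP.
apply: ge0_ae_eq_integral => //.
- by apply: ge0_emeasurable_sum => // j w _; rewrite lee_fin powR_ge0.
- apply: ge0_emeasurable_sum => [j w _ _|j _]; first by rewrite lee_fin powR_ge0.
  by apply/measurable_EFinP; apply: (measurableT_comp (measurable_powR _)).
- by move=> w _; apply: nneseries_ge0 => j _ _; rewrite lee_fin powR_ge0.
- by move=> w _; apply: nneseries_ge0 => j _ _; rewrite lee_fin powR_ge0.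
- apply: filterS ae_wgt_ge0 => w h _; apply: eq_eseriesr => j _.
  by rewrite ger0_norm.
Qed.

Let S := [set q : R | 0 < q /\ (phi xi0 q < 1)%E].

Let Sp : S (p * beta).
Proof. by split => //; rewrite phi_Phi// Phi_lt1. Qed.

Let S_lb : has_lbound S. Proof. by exists 0 => q [/ltW]. Qed.

Lemma qstar_le : qstar xi0 <= p * beta.
Proof. exact: ge_inf. Qed.

(** The bound [s <= p] keeps the s-th moment of the length finite. If the near-minimiser lies above
    [p * beta], then [p] itself is close enough. *)
Lemma qstar_approx (e : R) : 0 < e -> exists s,
  [/\ 0 < s, s <= p, s < qstar xi0 / beta + e & (Phi (s * beta) < 1)%E].
Proof.
move=> e0.
have [|q [q0 hq] qe] := @inf_adherent _ S (e * beta) (mulr_gt0 e0 beta_gt0).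
  by split => //; exists (p * beta).
have [qp|pq] := lerP q (p * beta).
  exists (q / beta); split; [exact: divr_gt0|by rewrite ler_pdivrMr| |].
    by rewrite ltr_pdivrMr// mulrDl divfK// gt_eqF.
  by rewrite divfK ?gt_eqF// -phi_Phi.
exists p; split => //; last exact: Phi_lt1.
rewrite -(ltr_pM2r beta_gt0) mulrDl divfK ?gt_eqF//.
exact: lt_trans pq qe.
Qed.

Lemma Phi_ge1 q : 0 < q < qstar xi0 -> (1 <= Phi q)%E.
Proof.
move=> /andP[q0 qq]; rewrite leNgt; apply/negP => h.
have Sq : S q by split; [exact: q0|rewrite phi_Phi].
have : qstar xi0 <= q := ge_inf S_lb Sq.
by rewrite leNgt qq.
Qed.

(* Phi is convex, at least 1 on (0, qstar) and smaller than 1 at p * beta. *)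
Lemma Phi_gt1 q : 0 < q < qstar xi0 -> (1 < Phi q)%E.
Proof.
(* If [Phi q] were at most 1, interpolation between [q] and [p * beta] would give [Phi q1 < 1]
   although [q1] is still below [qstar]. *)
move=> /andP[q0 qq]; pose q1 := (q + qstar xi0) / 2.
have qq1 : q < q1 by rewrite /q1; lra.
have q1q : q1 < qstar xi0 by rewrite /q1; lra.
have q1p : q1 < p * beta := lt_le_trans q1q qstar_le.
pose l := (p * beta - q1) / (p * beta - q).
have pq : 0 < p * beta - q by rewrite subr_gt0 (lt_trans qq1).
have l0 : 0 < l by rewrite divr_gt0// subr_gt0.
have l1 : l < 1 by rewrite ltr_pdivrMr// mul1r; lra.
have q1E : q1 = l * q + (1 - l) * (p * beta).
  by rewrite /l; field; rewrite gt_eqF.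
have h1 : (1 <= Phi q1)%E by apply: Phi_ge1; rewrite q1q (lt_trans q0).
have l10 : 0 <= 1 - l by rewrite subr_ge0 ltW.
have h2 : (Phi q1 <= l%:E * Phi q + (1 - l)%:E * Phi (p * beta))%E.
  have hj j : (moment q1 j <= l%:E * moment q j + (1 - l)%:E * moment (p * beta) j)%E.
    have m0 r w : [set: T0] w -> (0 <= (`|wgt (xi0 w) j| `^ r)%:E)%E.
      by move=> _; rewrite lee_fin powR_ge0.
    have ml r (c : R) : measurable_fun setT (fun w => c%:E * (`|wgt (xi0 w) j| `^ r)%:E)%E.
      exact: measurable_funeM.
    have cl r (c : R) w : 0 <= c -> [set: T0] w -> (0 <= c%:E * (`|wgt (xi0 w) j| `^ r)%:E)%E.
      by move=> c0 tw; rewrite mule_ge0// m0.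
    rewrite /moment -(ge0_integralZl P0 measurableT (mwq q j) (m0 q))// ?lee_fin ?(ltW l0)//.
    rewrite -(ge0_integralZl P0 measurableT (mwq (p * beta) j) (m0 (p * beta)))//.
    rewrite -(ge0_integralD P0 measurableT (fun w => cl q l w (ltW l0)) (ml q l)
      (fun w => cl (p * beta) (1 - l) w l10) (ml (p * beta) (1 - l))).
    apply: ge0_le_integral => //.
    - by apply: emeasurable_funD; exact: ml.
    - move=> w _; rewrite -!EFinM -EFinD lee_fin q1E.
      by apply: powR_interpolate => //; rewrite l0 l1.
  apply: (le_trans (lee_nneseries (fun j _ _ => moment_ge0 q1 j) (fun j _ => hj j))).
  have c0 r (c : R) j : 0 <= c -> (0 <= c%:E * moment r j)%E.
    by move=> c0; rewrite mule_ge0// moment_ge0.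
  rewrite nneseriesD; [|by move=> j _ _; exact/c0/ltW|by move=> j _ _; exact: c0].
  by rewrite nneseriesZl ?nneseriesZl// => j _; exact: moment_ge0.
rewrite ltNge; apply/negP => h.
have fin r : (Phi r <= 1)%E -> exists2 x, Phi r = x%:E & 0 <= x <= 1.
  move=> hr; have : (0 <= Phi r)%E by apply: nneseries_ge0 => j _ _; exact: moment_ge0.
  by move: hr; case: (Phi r) => [x|//|//]; rewrite !lee_fin => x1 x0; exists x; rewrite ?x0.
have [x xE /andP[x0 x1]] := fin _ h.
have [z zE /andP[z0 _]] := fin _ (ltW Phi_lt1).
have z1 : z < 1 by rewrite -lte_fin -zE; exact: Phi_lt1.
have := le_trans h1 h2; rewrite xE zE -!EFinM -EFinD lee_fin.
have : l * x <= l by rewrite ler_piMr// ltW.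
have : (1 - l) * z < 1 - l by rewrite -[ltRHS]mulr1 ltr_pM2l// subr_gt0.
lra.
Qed.

(** One index drives both truncation parameters, so that the truncations increase with [n] and
    monotone convergence applies. *)
Let tr n (b : block R) j := truncw n n.+1%:R^-1 b j.

Let eps_gt0 n : 0 < n.+1%:R^-1 :> R. Proof. by rewrite invr_gt0 ltr0n. Qed.

Let tr_le n b j : tr n b j <= `|wgt b j|.
Proof. by rewrite /tr /truncw; case: ifP => // _; exact: ler_norm. Qed.

Let tr_nd n k b j : (n <= k)%N -> tr n b j <= tr k b j.
Proof.
move=> nk; rewrite {1}/tr /truncw; case: ifPn => [/and3P[jn /andP[h1 h2] h3]|_]; last first.
  exact: truncw_ge0.
have kn : k.+1%:R^-1 <= n.+1%:R^-1 :> R by rewrite lef_pV2 ?posrE ?ltr0n// ler_nat.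
rewrite /tr /truncw (leq_trans jn nk) (le_trans kn h1) (le_trans kn h3) andbT /=.
rewrite ifT// invrK (le_trans h2)// invrK ler_nat//.
Qed.

Let tr_eventually b j : 0 <= wgt b j -> (0 < wgt b j -> 0 < att b j) ->
  exists n, forall k, (n <= k)%N -> tr k b j = `|wgt b j|.
Proof.
move=> w0 wa; rewrite ger0_norm//.
have [w00|wN0] := eqVneq (wgt b j) 0.
  exists 0%N => k _; apply: le_anti; rewrite w00 truncw_ge0// andbT.
  by have := tr_le k b j; rewrite w00 normr0.
have wp : 0 < wgt b j by rewrite lt_neqAle eq_sym wN0.
have ap := wa wp.
pose n1 := Num.truncn (wgt b j)^-1; pose n2 := Num.truncn (wgt b j).
pose n3 := Num.truncn (att b j)^-1.
have inv_le (z : R) k : 0 < z -> (Num.truncn z^-1 <= k)%N -> k.+1%:R^-1 <= z.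
  move=> z0 zk; rewrite -[leRHS]invrK lef_pV2 ?posrE ?invr_gt0 ?ltr0n//.
  apply: le_trans (ltW (truncnS_gt z^-1)) _; by rewrite ler_nat.
exists (maxn j.+1 (maxn n1 (maxn n2 n3))) => k.
rewrite !geq_max => /and4P[jk h1 h2 h3]; rewrite /tr /truncw jk inv_le// inv_le//.
rewrite /= invrK ifT// andbT.
by apply: le_trans (ltW (truncnS_gt _)) _; rewrite ler_nat.
Qed.

(** Finitely many letters already bring the q-th moments above 1, and on these the truncations
    increase to the full weights. Positive attachment points enter here: they ensure that the
    condition [eps <= att] loses nothing in the limit. *)
Lemma truncation_exists q : 0 < q < qstar xi0 -> exists n (A B : R),
  [/\ 1 < A, 0 <= B < 1,
   (\sum_(0 <= a < n) \int[P0]_w (truncw n n.+1%:R^-1 (xi0 w) a `^ q)%:E = A%:E)%E &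
   (\sum_(0 <= a < n) \int[P0]_w (truncw n n.+1%:R^-1 (xi0 w) a `^ (p * beta))%:E = B%:E)%E].
Proof.
move=> hq; have /andP[q0 _] := hq.
have mtr n r j : measurable_fun setT (fun w => (tr n (xi0 w) j `^ r)%:E).
  apply/measurable_EFinP; apply: (measurableT_comp (measurable_powR r)).
  by apply: (measurableT_comp (measurable_truncw n _ j)).
have tr0 n r j w : (0 <= (tr n (xi0 w) j `^ r)%:E)%E by rewrite lee_fin powR_ge0.
have I0 n r j : (0 <= \int[P0]_w (tr n (xi0 w) j `^ r)%:E)%E.
  by apply: integral_ge0.
have [M hM] : exists M, (1 < \sum_(0 <= j < M) moment q j)%E.
  apply: contrapT => /forallNP no; have := Phi_gt1 hq; rewrite ltNge => /negP; apply.
  apply: lime_le; first by apply: is_cvg_nneseries => j _ _; exact: moment_ge0.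
  by apply: nearW => M; rewrite leNgt; apply/negP; exact: no.
pose F n w := (\sum_(0 <= j < M) (tr n (xi0 w) j `^ q)%:E)%E.
have mF n : measurable_fun setT (F n) by apply: emeasurable_sum.
have F0 n w : [set: T0] w -> (0 <= F n w)%E by move=> _; apply: sume_ge0.
have FE n : (\int[P0]_w F n w = \sum_(0 <= j < M) \int[P0]_w (tr n (xi0 w) j `^ q)%:E)%E.
  by rewrite ge0_integral_sum.
have [n hn] : exists n, (1 < \int[P0]_w F n w)%E.
  apply: contrapT => /forallNP no; move: hM; rewrite ltNge => /negP; apply.
  have nd w : [set: T0] w -> {homo F^~ w : n k / (n <= k)%N >-> (n <= k)%E}.
    move=> _ n k nk; apply: lee_sum => j _; rewrite lee_fin.
    apply: ge0_ler_powR; rewrite ?nnegrE ?truncw_ge0 ?(ltW q0)//.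
    exact: tr_nd.
  have cv := cvg_monotone_convergence measurableT mF F0 nd.
  have limE : (\int[P0]_w (limn (F^~ w)) = \sum_(0 <= j < M) moment q j)%E.
    transitivity (\int[P0]_w (\sum_(0 <= j < M) (`|wgt (xi0 w) j| `^ q)%:E))%E; last first.
      by rewrite ge0_integral_sum// => j w _; rewrite lee_fin powR_ge0.
    apply: ge0_ae_eq_integral => //.
    - by apply: (emeasurable_fun_cvg F) => // w _; apply: ereal_nondecreasing_is_cvgn; exact: nd.
    - by apply: emeasurable_sum.
    - move=> w _; apply: lime_ge; last by apply: nearW => n; exact: F0.
      by apply: ereal_nondecreasing_is_cvgn; exact: nd.
    - by move=> w _; apply: sume_ge0 => j _; rewrite lee_fin powR_ge0.
    apply: filterS2 ae_wgt_ge0 hXpos => w h1 h2 _.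
    have /choice[nn hnn] := fun j => tr_eventually (h1 j) (h2 j).
    apply: lim_near_cst => //; exists (\max_(j < M) nn j)%N => // k /= hk.
    rewrite /F; apply: eq_big_nat => j /andP[_ jM]; rewrite hnn//.
    exact: leq_trans (@leq_bigmax _ (fun j : 'I_M => nn j) (Ordinal jM)) hk.
  rewrite -limE -(cvg_lim _ (cv P0))//; apply: lime_le; first exact: (cvgP _ (cv P0)).
  by apply: nearW => n; rewrite leNgt; apply/negP; exact: no.
(* [n] makes the truncated moment exceed 1, and [M] retains all the letters counted in it. *)
pose k := maxn n M.
have bound r : 0 < r -> exists2 C : R, 0 <= C &
    (\sum_(0 <= a < k) \int[P0]_w (tr k (xi0 w) a `^ r)%:E = C%:E)%E.
  move=> r0; have s0 : (0 <= \sum_(0 <= a < k) \int[P0]_w (tr k (xi0 w) a `^ r)%:E)%E.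
    by apply: sume_ge0.
  suff : (\sum_(0 <= a < k) \int[P0]_w (tr k (xi0 w) a `^ r)%:E < +oo)%E.
    move: s0; case: (\sum_(_ <= _ < _) _)%E => [C|//|//]; rewrite lee_fin => C0 _.
    by exists C.
  apply: lte_sum_pinfty => a _.
  apply: (@le_lt_trans _ _ (\int[P0]_w (k.+1%:R `^ r)%:E)%E); last first.
    by rewrite integral_cst//= probability_setT mule1 ltry.
  apply: ge0_le_integral => //.
  - move=> w _; rewrite lee_fin; apply: ge0_ler_powR; rewrite ?nnegrE ?truncw_ge0 ?(ltW r0)//.
    rewrite /tr /truncw; case: ifP => // /and3P[_ /andP[_]].
    by rewrite invrK.
have [A A0 AE] := bound q q0; have [B B0 BE] := bound _ pb_gt0.
exists k, A, B; split => //.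
- rewrite -lte_fin -AE; apply: lt_le_trans hn _; rewrite FE.
  apply: (@le_trans _ _ (\sum_(0 <= j < M) \int[P0]_w (tr k (xi0 w) j `^ q)%:E)%E).
    apply: lee_sum => j _; apply: ge0_le_integral => // w _; rewrite lee_fin.
    apply: ge0_ler_powR; rewrite ?nnegrE ?truncw_ge0 ?(ltW q0)//.
    by apply: tr_nd; exact: leq_maxl.
  by apply: lee_sum_nneg_natr => //; exact: leq_maxr.
- rewrite B0 -lte_fin -BE; apply: le_lt_trans Phi_lt1.
  apply: (@le_trans _ _ (\sum_(0 <= a < k) moment (p * beta) a)%E); last first.
    by apply: nneseries_lim_ge => j _ _; exact: moment_ge0.
  apply: lee_sum => a _; apply: ge0_le_integral => // w _.
  rewrite lee_fin; apply: ge0_ler_powR; rewrite ?nnegrE ?truncw_ge0 ?(ltW pb_gt0)//.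
Qed.

End moments.

(** * Dimensions of the random tree *)

Section dimension_upper_bound.
Context {R : realType} (beta : R) (xi : seq nat -> block R).
Hypothesis len_gt0 : forall w, 0 < len (xi w).
Hypothesis att_itv : forall w j, 0 <= att (xi w) j <= len (xi w).
Variables (y s : R).
Hypotheses (y_gt1 : 1 < y) (s_gt0 : 0 < s).
Hypothesis summable_len :
  (\sum_(0 <= k <oo) (weighted_len beta xi y s (CodeSeq.decode k))%:E < +oo)%E.

Lemma hausdorff_dim_leaves_le : (hausdorff_dim (leaves (tree_root beta xi)) <= s%:E)%E.
Proof.
apply: hausdorff_dim_le => //.
pose x b k := ipoint beta xi (CodeSeq.decode k)
  (if b then interval_len beta xi (CodeSeq.decode k) else 0).
apply: (@hausdorff_measure0_sub _ _ s _ (~` range (embed (tree_pseudodist beta xi)) `|`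
  (range (x false) `|` range (x true)))) => //.
  move=> z lz; have [rz|] := pselect (range (embed (tree_pseudodist beta xi)) z); last by left.
  have [w [->|->]] := leaf_endpoint len_gt0 att_itv lz rz; right; [left|right];
    by exists (CodeSeq.code w) => //; rewrite /x CodeSeq.codeK.
apply: hausdorff_measure0U => //; first exact: hausdorff_limit_points summable_len.
by apply: hausdorff_measure0U => //; exact: hausdorff_measure0_countable.
Qed.

Lemma hausdorff_dim_tree_le :
  (hausdorff_dim [set: tree beta xi] <= (Num.max s 1)%:E)%E.
Proof.
apply/lee_addgt0Pr => e e0; rewrite -EFinD; set t := _ + e.
have st : s < t by rewrite /t ltr_pwDr// le_max lexx.
have t1 : 1 < t by rewrite /t ltr_pwDr// le_max lexx orbT.
have t0 : 0 < t := lt_trans s_gt0 st.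
apply: hausdorff_dim_le => //.
apply: (@hausdorff_measure0_sub _ _ t _ (~` range (embed (tree_pseudodist beta xi)) `|`
  \bigcup_k range (ipoint beta xi (CodeSeq.decode k)))) => //.
  move=> z _; have [|] := pselect (range (embed (tree_pseudodist beta xi)) z); last by left.
  move=> /range_embedP[w [r [_ _ ->]]]; right; exists (CodeSeq.code w) => //.
  by rewrite CodeSeq.codeK; exists r.
apply: hausdorff_measure0U => //.
  apply: (hausdorff_measure0_le s_gt0 (ltW st)).
  exact: hausdorff_limit_points summable_len.
by apply: hausdorff_measure0_bigcup => // k; exact: hausdorff_measure_interval.
Qed.

(** The decay required by [lower_bound] for the convergence of rays, obtained from the summability
    behind the upper bound. *)
Lemma interval_len_geometric : exists K x : R, [/\ 0 <= K, 0 <= x, x < 1 &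
  forall v, interval_len beta xi v <= K * x ^+ size v].
Proof.
have y0 : 0 < y := lt_trans ltr01 y_gt1.
exists (fine (subtree_mass beta xi y s [::]) `^ s^-1), y^-1; split.
- exact: powR_ge0.
- by rewrite invr_ge0 ltW.
- by rewrite invf_lt1.
by move=> v; apply: interval_len_le => //; exact: suffix0s.
Qed.

End dimension_upper_bound.

(** The constants 3 and 1 differ by the mean 2 that [expectation_mincut_ge] asks for. *)
Lemma exists_power (R : realType) (A B C : R) : 1 < A -> 0 <= B < 1 ->
  exists m, [/\ (0 < m)%N, 3 <= A ^+ m & C * B ^+ m <= 1].
Proof.
move=> A1 /andP[B0 B1]; have A0 : 0 < A := lt_trans ltr01 A1.
have cA : A^-1 ^+ n @[n --> \oo] --> (0 : R).
  by apply: cvg_expr; rewrite ger0_norm ?invr_ge0 ?(ltW A0)// invf_lt1.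
have cB : C * B ^+ n @[n --> \oo] --> (0 : R).
  rewrite -[X in _ --> X](mulr0 C); apply: cvgMr.
  by apply: cvg_expr; rewrite ger0_norm.
have e3 : 0 < 3^-1 :> R by rewrite invr_gt0.
move/cvgrPdist_le : cA => /(_ _ e3)[n1 _ h1].
move/cvgrPdist_le : cB => /(_ _ ltr01)[n2 _ h2].
exists (maxn n1 n2).+1; split => //.
  have := h1 (maxn n1 n2).+1 (leq_trans (leq_maxl n1 n2) (leqnSn _)) => /=.
  rewrite sub0r normrN ger0_norm ?exprn_ge0 ?invr_ge0 ?(ltW A0)//.
  by rewrite exprVn lef_pV2 ?posrE ?exprn_gt0.
have := h2 (maxn n1 n2).+1 (leq_trans (leq_maxr n1 n2) (leqnSn _)) => /=.
by rewrite sub0r normrN; apply: le_trans; exact: ler_norm.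
Qed.

Section random_tree.
Context {R : realType} {d0 : measure_display} {T0 : measurableType d0}
  {P0 : probability T0 R} {xi0 : {RV P0 >-> block R}}
  {d : measure_display} {T : measurableType d} {P : probability T R}
  {xi : seq nat -> {RV P >-> block R}}.
Hypothesis iid : iid_copies xi xi0.
Local Notation tree_at := (@tree_at _ _ _ P xi).
Local Notation word := CodeSeq.decode.

Lemma ae_block (B : set (block R)) : measurable B ->
  {ae P0, forall w, B (xi0 w)} -> {ae P, forall w, forall i, B (xi i w)}.
Proof.
move=> mB hB.
have mX (d' : measure_display) (U : measurableType d') (Q : probability U R)
    (X : {RV Q >-> block R}) : measurable [set w | ~ B (X w)].
  have := @measurable_funP _ _ _ _ setT X measurableT _ (measurableC mB).
  by rewrite setTI.
have h0 : P0 (xi0 @^-1` (~` B)) = 0%E.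
  have : P0.-negligible (xi0 @^-1` (~` B)) by exact: hB.
  by move=> /negligibleP; apply; exact: mX.
suff : {ae P, forall w, forall k, B (xi (word k) w)}.
  by apply: filterS => w h i; have := h (CodeSeq.code i); rewrite CodeSeq.codeK.
apply/ae_foralln => k; apply/negligibleP; first exact: mX.
by transitivity (P0 (xi0 @^-1` (~` B))); [exact: iid.2 (measurableC mB)|exact: h0].
Qed.

Variables (beta p : R).
Hypotheses (beta_gt0 : 0 < beta) (p_ge1 : 1 <= p).
Hypothesis hL : {ae P0, forall w, 0 < len (xi0 w)}.
Hypothesis hX : {ae P0, forall w, forall j : nat, 0 <= att (xi0 w) j <= len (xi0 w)}.
Hypothesis hP : {ae P0, forall w, forall j : nat,
  0 <= wgt (xi0 w) j.+1 <= wgt (xi0 w) j}.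
Hypothesis hLp : ('E_P0[fun w => (len (xi0 w) `^ p)%R] < +oo)%E.
Hypothesis hPp :
  (\int[P0]_w (\sum_(0 <= j <oo) ((wgt (xi0 w) j `^ (p * beta))%R)%:E) < 1)%E.
Hypothesis hXpos : {ae P0, forall w, forall j : nat,
  0 < wgt (xi0 w) j -> 0 < att (xi0 w) j}.

Let measurable_boolP (f : block R -> bool) : measurable_fun setT f -> measurable [set b | f b].
Proof. by move=> /(_ measurableT [set true]); rewrite setTI; exact. Qed.

Lemma ae_len_gt0 : {ae P, forall w, forall i, 0 < len (xi i w)}.
Proof.
apply: (@ae_block [set b | 0 < len b]) => //; apply: measurable_boolP.
by apply: measurable_fun_ltr; [exact: measurable_cst|exact: measurable_len].
Qed.

Lemma ae_att_itv : {ae P, forall w, forall i j, 0 <= att (xi i w) j <= len (xi i w)}.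
Proof.
apply: (@ae_block [set b | forall j, 0 <= att b j <= len b]) => //.
rewrite (_ : mkset _ = \bigcap_j [set b | 0 <= att b j <= len b]); last first.
  by apply/seteqP; split=> b h j => [_|]; exact: h.
apply: bigcapT_measurable => j; apply: measurable_boolP; apply: measurable_and.
  by apply: measurable_fun_ler; [exact: measurable_cst|exact: measurable_att].
by apply: measurable_fun_ler; [exact: measurable_att|exact: measurable_len].
Qed.

Lemma ae_cwgt_ge0 : {ae P, forall w, forall i, 0 <= cwgt (tree_at w) i}.
Proof.
suff : {ae P, forall w, forall i j, 0 <= wgt (xi i w) j}.
  by apply: filterS => w h; elim=> //= j i IH; rewrite mulr_ge0//; exact: h.
apply: (@ae_block [set b | forall j, 0 <= wgt b j]); last exact: ae_wgt_ge0.
rewrite (_ : mkset _ = \bigcap_j [set b | 0 <= wgt b j]); last first.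
  by apply/seteqP; split=> b h j => [_|]; exact: h.
apply: bigcapT_measurable => j; apply: measurable_boolP.
by apply: measurable_fun_ler; [exact: measurable_cst|exact: measurable_wgt].
Qed.

Let measurable_len_powR (s : R) : measurable_fun setT (fun b : block R => `|len b| `^ s).
Proof.
apply: (measurableT_comp (measurable_powR s)); apply: measurableT_comp => //.
exact: measurable_len.
Qed.

Lemma integral_len_powR (s : R) : 0 < s <= p -> (\int[P0]_w (`|len (xi0 w)| `^ s)%:E < +oo)%E.
Proof.
move=> /andP[s0 sp].
have ms r : measurable_fun setT (fun w => (`|len (xi0 w)| `^ r)%:E).
  by apply/measurable_EFinP; apply: (measurableT_comp (measurable_len_powR r)).
have pE : (\int[P0]_w (`|len (xi0 w)| `^ p)%:E < +oo)%E.
  move: hLp; rewrite unlock; apply: le_lt_trans; rewrite le_eqVlt; apply/orP; left; apply/eqP.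
  apply: ge0_ae_eq_integral => //.
  - apply/measurable_EFinP; apply: (measurableT_comp (measurable_powR p)).
    by apply: (measurableT_comp measurable_len).
  - by move=> w _; rewrite lee_fin powR_ge0.
  - by apply: filterS hL => w h _; rewrite gtr0_norm.
apply: (@le_lt_trans _ _ (\int[P0]_w (1%:E + (`|len (xi0 w)| `^ p)%:E))%E); last first.
  rewrite ge0_integralD//.
  by rewrite integral_cst//= probability_setT mule1 lte_add_pinfty// ltry.
apply: ge0_le_integral => //.
- exact: emeasurable_funD.
move=> w _; rewrite -EFinD lee_fin.
have [l1|/ltW l1] := lerP `|len (xi0 w)| 1.
  apply: (@le_trans _ _ 1); last by rewrite lerDl powR_ge0.
  by have := @ge0_ler_powR R s (ltW s0) `|len (xi0 w)| 1; rewrite powR1 => ->; rewrite ?nnegrE.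
by apply: (@le_trans _ _ (`|len (xi0 w)| `^ p)); [exact: ler_powR|rewrite lerDr].
Qed.

Lemma ae_summable_len (s : R) : 0 < s <= p -> (Phi (xi0 := xi0) (s * beta) < 1)%E ->
  exists2 y : R, 1 < y & {ae P, forall w, (\sum_(0 <= k <oo)
    (weighted_len beta (tree_at w) y s (word k))%:E < +oo)%E}.
Proof.
move=> sp; have /andP[s0 _] := sp.
move=> phi1; have Phi0 : (0 <= Phi (xi0 := xi0) (s * beta))%E.
  by apply: nneseries_ge0 => j _ _; exact: moment_ge0.
have [u uE] : exists u, Phi (xi0 := xi0) (s * beta) = u%:E.
  have := lt_trans phi1 (ltry 1); move: Phi0.
  by case: (Phi _) => [u|//|//]; exists u.
move: phi1; rewrite uE lte_fin => u1; have u0 : 0 <= u by rewrite -lee_fin -uE.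
(* A number above 1 with [rho * u < 1], meaningful also for [u = 0]. Its root of order [s] is taken
   for [y], so that the s-th power in [weighted_len] turns [y ^+ size w] into [rho ^+ size w]. *)
pose rho := 2 / (1 + u); have rho1 : 1 < rho by rewrite ltr_pdivlMr; lra.
have rhou : rho * u < 1 by rewrite /rho mulrAC ltr_pdivrMr; lra.
have rho0 : 0 <= rho by rewrite ltW// (lt_trans ltr01).
exists (rho `^ s^-1).
  by have := @gt0_ltr_powR R s^-1 _ 1 rho; rewrite powR1 => ->; rewrite ?nnegrE ?invr_gt0.
have ys : (rho `^ s^-1) `^ s = rho by rewrite -powRrM mulVf ?gt_eqF// powRr1.
have := ae_summable iid (measurable_len_powR s) (fun b => powR_ge0 _ _) rho0
  (integral_len_powR sp).
move=> /(_ (s * beta)); rewrite -/(Phi (s * beta)) uE -EFinM lte_fin ltry.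
move=> /(_ rhou isT) hs; apply: filterS3 ae_len_gt0 ae_cwgt_ge0 hs => w l0 c0.
apply: le_lt_trans; rewrite le_eqVlt; apply/orP; left; apply/eqP.
apply: eq_eseriesr => k _; congr EFin; rewrite /weighted_len /interval_len.
have len0 := ltW (l0 (word k)).
rewrite powRM ?mulr_ge0 ?exprn_ge0 ?powR_ge0// powRM ?powR_ge0//.
rewrite -/(tree_at w) (ger0_norm (c0 _)) (ger0_norm len0).
rewrite -powRrM [beta * s]mulrC [RHS]mulrC; congr (_ * _).
by rewrite -powR_mulrn ?powR_ge0// -powRrM mulrC powRrM ys powR_mulrn.
Qed.

Lemma ae_hausdorff_leaves_neq0 (q : R) : 0 < q < qstar xi0 ->
  {ae P, forall w, (forall n, alive_at (xi := xi) n w) ->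
    hausdorff_measure (q / beta) (leaves (tree_root beta (tree_at w))) <> 0%E}.
Proof.
move=> hq; have /andP[q0 qlt] := hq.
have qp : q <= p * beta := le_trans (ltW qlt) (qstar_le beta_gt0 p_ge1 hP hPp).
have [N [A [B [A1 B01 AE BE]]]] := truncation_exists beta_gt0 p_ge1 hP hPp hXpos hq.
have [m [m0 hA hB]] := exists_power (2 `^ (p * beta - q)) A1 B01.
set eps := N.+1%:R^-1 : R in AE BE.
have eps0 : 0 < eps by rewrite invr_gt0 ltr0n.
have eps1 : eps <= 1 by rewrite invf_le1 ?ltr0n// ler1n.
have h2 v : (2%:E <= \sum_(j <- words N m) \int[P]_w (coef N eps q (tree_at w) v j)%:E)%E.
  apply: le_trans (expectation_coef_ge iid m eps0 v qp AE BE).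
  by rewrite lee_fin; lra.
pose M : R := (size (words N m))%:R ^+ 2.
(* Meets both demands [dl <= 1] and [M * dl <= 1], whatever the number of words. *)
pose dl : R := (M + 1)^-1.
have M0 : 0 <= M by rewrite exprn_ge0.
have dl0 : 0 < dl by rewrite invr_gt0; lra.
have dl1 : 0 < dl <= 1 by rewrite dl0 invf_le1; lra.
have Mdl : M * dl <= 1 by rewrite ler_pdivrMr; lra.
have hE := expectation_mincut_ge iid eps0 q0 h2 dl1 Mdl.
have dl2 : 0 < dl / 2 by rewrite divr_gt0.
pose G v := survives (P := P) (xi := xi) N m eps q (dl / 2) v.
have hG := ae_alive_good iid (G := G) (fun i => @obs_survives _ _ _ _ _ N m eps q (dl / 2) i)
  dl2 (fun v => probability_survives dl0 (hE^~ v)).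
(* Only the geometric decay of the lengths is wanted, so any [s] with [Phi (s * beta) < 1] will do
   and the tolerance 1 is arbitrary. *)
have [s [s0 sp _ hs]] := qstar_approx beta_gt0 p_ge1 hP hPp ltr01.
have [|y y1 hy] := ae_summable_len _ hs; first by rewrite s0.
have good : {ae P, forall w, (forall i, 0 < len (xi i w)) /\
    (forall i j, 0 <= att (xi i w) j <= len (xi i w))}.
  by apply: filterS2 ae_len_gt0 ae_att_itv => w; split.
have alive_good : {ae P, forall w, (forall i, 0 <= cwgt (tree_at w) i) /\
    ((forall n, alive_at (xi := xi) n w) -> exists i, alive (xi := xi) i w /\ G i w)}.
  by apply: filterS2 ae_cwgt_ge0 hG => w; split.
apply: filterS3 good alive_good hy => w [l0 a0] [c0 hw] sw /hw[i [ai Gi]].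
have [K [x [K0 x0 x1 hK]]] := interval_len_geometric l0 y1 s0 sw.
apply: (hausdorff_leaves_neq0 beta_gt0 l0 a0 m0 eps0 eps1 q0 K0 x0 x1 hK _ dl2).
  by rewrite lt_neqAle c0 andbT eq_sym; apply/eqP; exact: ai.
by move=> n; exact: Gi.
Qed.

Lemma nonextinct_alive_at w : ~ (extinction_time (tree_at w) < +oo)%E ->
  forall n, alive_at (xi := xi) n w.
Proof.
move=> ne [|n].
  by exists [::] => //; rewrite /alive /= => /eqP; rewrite oner_eq0.
apply: contrapT => h; apply: ne; apply: (@le_lt_trans _ _ (n.+1%:R)%:E); last exact: ltry.
apply: ereal_inf_lbound; exists n.+1 => //; split => // i si.
by apply: contrapT => ci; apply: h; exists i.
Qed.

(** Each exponent has its own null set, so only a sequence [s k] with limit superior at most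
    [qstar / beta] is used. *)
Lemma ae_hausdorff_dim_leaves_le : {ae P, forall w,
  (hausdorff_dim (leaves (tree_root beta (tree_at w))) <= (qstar xi0 / beta)%:E)%E /\
  (hausdorff_dim [set: tree beta (tree_at w)] <= (Num.max (qstar xi0 / beta) 1)%:E)%E}.
Proof.
have sk k : exists s, 0 < s <= p /\ s < qstar xi0 / beta + k.+1%:R^-1 /\
    (Phi (xi0 := xi0) (s * beta) < 1)%E.
  have k0 : 0 < k.+1%:R^-1 :> R by rewrite invr_gt0 ltr0n.
  have [s [s0 sp sq hs]] := qstar_approx beta_gt0 p_ge1 hP hPp k0.
  by exists s; rewrite s0.
have /choice[s hs] := sk.
have hk : {ae P, forall w, forall k,
  (hausdorff_dim (leaves (tree_root beta (tree_at w))) <= (s k)%:E)%E /\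
  (hausdorff_dim [set: tree beta (tree_at w)] <= (Num.max (s k) 1)%:E)%E}.
  apply/ae_foralln => k; have [/[dup] sp /andP[s0 _] [_ Ps]] := hs k.
  have [y y1 hy] := ae_summable_len sp Ps.
  apply: filterS3 ae_len_gt0 ae_att_itv hy => w l0 a0 sw.
  by split; [exact: hausdorff_dim_leaves_le sw|exact: hausdorff_dim_tree_le sw].
apply: filterS hk => w h.
have inv (e : R) : 0 < e -> exists k, s k <= qstar xi0 / beta + e.
  move=> e0; exists (Num.truncn e^-1); have [_ [/ltW ski _]] := hs (Num.truncn e^-1).
  apply: le_trans ski _; rewrite lerD2l -[leRHS]invrK lef_pV2 ?posrE ?invr_gt0 ?ltr0n//.
  exact: ltW (truncnS_gt _).
split; apply/lee_addgt0Pr => e e0; have [k ske] := inv e e0; have [h1 h2] := h k.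
  by apply: le_trans h1 _; rewrite -EFinD lee_fin.
apply: le_trans h2 _; rewrite -EFinD lee_fin ge_max; apply/andP; split.
  by apply: le_trans ske _; rewrite lerD2r le_max lexx.
by rewrite -[leLHS]addr0 lerD ?(ltW e0)// le_max lexx orbT.
Qed.

(** Again countably many exponents [q k], increasing to [qstar]; those that are not positive impose
    nothing. *)
Lemma ae_hausdorff_dim_leaves_ge : {ae P, forall w, (forall n, alive_at (xi := xi) n w) ->
  ((qstar xi0 / beta)%:E <= hausdorff_dim (leaves (tree_root beta (tree_at w))))%E}.
Proof.
pose q k := qstar xi0 - k.+1%:R^-1.
have hq : {ae P, forall w, forall k, 0 < q k -> (forall n, alive_at (xi := xi) n w) ->
    hausdorff_measure (q k / beta) (leaves (tree_root beta (tree_at w))) <> 0%E}.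
  apply/ae_foralln => k; have [qk|qk] := ltrP 0 (q k); last exact: aeW.
  have : 0 < q k < qstar xi0 by rewrite qk /= ltrBlDr ltrDl invr_gt0 ltr0n.
  by move=> /ae_hausdorff_leaves_neq0; apply: filterS => w h _.
apply: filterS hq => w hw aw; apply: hausdorff_dim_ge => s s0.
rewrite lte_fin ltr_pdivlMr// => sq.
have [k sk] : exists k, s * beta <= q k.
  have gap : 0 < qstar xi0 - s * beta by rewrite subr_gt0.
  exists (Num.truncn (qstar xi0 - s * beta)^-1); rewrite /q lerBrDr addrC -lerBrDr.
  rewrite -[leRHS]invrK lef_pV2 ?posrE ?invr_gt0 ?ltr0n//.
  exact: ltW (truncnS_gt _).
have qk : 0 < q k by apply: lt_le_trans sk; exact: mulr_gt0.
move=> H0; apply: (hw k qk aw); apply: hausdorff_measure0_le H0 => //.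
by rewrite ler_pdivlMr.
Qed.

End random_tree.

Theorem theorem4p5 (R : realType)
  (d0 : measure_display) (T0 : measurableType d0) (P0 : probability T0 R)
  (xi0 : {RV P0 >-> block R})
  (d : measure_display) (T : measurableType d) (P : probability T R)
  (xi : seq nat -> {RV P >-> block R})
  (beta p : R)
  (hbeta : 0 < beta) (hp : 1 <= p)
  (hiid : iid_copies xi xi0)
  (hL : {ae P0, forall w, 0 < len (xi0 w)})
  (hX : {ae P0, forall w, forall j : nat, 0 <= att (xi0 w) j <= len (xi0 w)})
  (hP : {ae P0, forall w, forall j : nat,
           0 <= wgt (xi0 w) j.+1 <= wgt (xi0 w) j})
  (hLp : ('E_P0[fun w => (len (xi0 w) `^ p)%R] < +oo)%E)
  (hPp : (\int[P0]_w (\sum_(0 <= j <oo) ((wgt (xi0 w) j `^ (p * beta))%R)%:E) < 1)%E)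
  (hLq : forall q : R, 0 < q < qstar xi0 ->
     ('E_P0[fun w => (len (xi0 w) `^ (- (q / beta)))%R] < +oo)%E)
  (hXpos : {ae P0, forall w, forall j : nat,
              0 < wgt (xi0 w) j -> 0 < att (xi0 w) j}) :
  {ae P, forall w, ~ (extinction_time (fun i => xi i w) < +oo)%E ->
    hausdorff_dim (leaves (tree_root beta (fun i => xi i w)))
      = (qstar xi0 / beta)%:E /\
    hausdorff_dim [set: tree beta (fun i => xi i w)]
      = (Num.max (qstar xi0 / beta) 1)%:E}.

Proof.
apply: filterS3 (ae_len_gt0 hiid hL)
  (ae_hausdorff_dim_leaves_le hiid hbeta hp hL hX hP hLp hPp)
  (ae_hausdorff_dim_leaves_ge hiid hbeta hp hL hX hP hLp hPp hXpos).
move=> w l0 [h1 h2] h3 /nonextinct_alive_at aw.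
have h4 := h3 aw.
have leavesE : hausdorff_dim (leaves (tree_root beta (fun i => xi i w))) =
    (qstar xi0 / beta)%:E by apply/eqP; rewrite eq_le h1 h4.
(* For the lower bound, the tree contains its leaves, and its root interval alone forces dimension
   at least 1. *)
split => //; apply/eqP; rewrite eq_le h2 /= EFin_max ge_max -leavesE.
by rewrite hausdorff_dim_sub//= hausdorff_dim_tree_ge1.
Qed.
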